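(* Let $b>\frac16$ and $a=c=\frac16-b$. For all $\epsilon,\delta>0$ there exists $\varepsilon_0>0$ such that every global solution $(u,\eta)\in C(\mathbb R,(H^1\times H^1)(\mathbb R))$ of the $abcd$ system with $\|(u,\eta)(0)\|_{H^1\times H^1}<\varepsilon_0$ satisfies $$\lim_{t\to\pm\infty}\|(u,\eta)(t)\|_{(H^1\times H^1)(I(t))}=0,\qquad I(t)=(-\infty,-(2+\epsilon)|t|)\cup((2+\delta)|t|,\infty).$$ In particular, there are no small solitary waves of speed greater than $2$: for every $s>2$ there is $\varepsilon_0>0$ such that no nonzero solution of the form $(u,\eta)(t,x)=(U,N)(x-\omega t)$ with $(U,N)\in H^1\times H^1$, $|\omega|\ge s$ and $\|(U,N)\|_{H^1\times H^1}<\varepsilon_0$ exists.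
   Context: The Hamiltonian $abcd$ system (with $b=d$) is $$(1-b\partial_x^2)\partial_t\eta+\partial_x(a\,\partial_x^2u+u+u\eta)=0,\qquad (1-b\partial_x^2)\partial_tu+\partial_x\big(c\,\partial_x^2\eta+\eta+\tfrac12u^2\big)=0,\qquad (t,x)\in\mathbb R\times\mathbb R,$$ with real-valued unknowns $u,\eta$. $\|(u,\eta)\|_{(H^1\times H^1)(I)}^2=\int_I(u^2+u_x^2+\eta^2+\eta_x^2)\,dx$ (up to equivalent norm). *)

(* Defs.v *)
From HB Require Import structures.
From mathcomp Require Import all_boot all_order all_algebra.
From mathcomp Require Import all_classical all_reals all_analysis.

Set Implicit Arguments.
Unset Strict Implicit.
Unset Printing Implicit Defensive.

Import Order.TTheory GRing.Theory Num.Theory.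
Import numFieldNormedType.Exports.

Local Open Scope classical_set_scope.
Local Open Scope ring_scope.

Local Notation leb := (@lebesgue_measure _).

Section test_functions.
Context {R : realType} {V : normedModType R}.

(* In finite dimension this is the usual notion of a C^oo function: all
   iterated directional derivatives exist and are differentiable (hence
   continuous) everywhere. *)
Definition smooth (f : V -> R) : Prop :=
  forall (vs : seq V) (x : V), differentiable (foldr (fun v g => 'D_v g) f vs) x.

Definition test_function (f : V -> R) : Prop :=
  smooth f /\ compact (closure [set x | f x != 0]).

End test_functions.

Section sobolev.
Context {R : realType}.
Implicit Types (f g u eta : R -> R) (I : set R).

Definition L2 f : Prop := f \in Lfun (@lebesgue_measure R) 2%:E.

Definition is_weak_derivative f g : Prop :=
  forall phi : R -> R, test_function phi ->
    \int[leb]_x (f x * phi^`()%classic x) = - \int[leb]_x (g x * phi x).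

(* Elements of H^1 are represented by functions; two representatives of the
   same element agree almost everywhere. *)
Definition H1 f : Prop := L2 f /\ exists g, L2 g /\ is_weak_derivative f g.

(* A representative of the weak derivative of f in H^1 (unique up to a null
   set); the value outside H^1 is irrelevant. *)
Definition wderiv f : R -> R :=
  xget (cst 0) [set g | L2 g /\ is_weak_derivative f g].

(* The norm of (u, eta) in (H^1 x H^1)(I), meaningful for u, eta in H^1. *)
Definition H1norm I u eta : R :=
  Num.sqrt (\int[leb]_(x in I)
    (u x ^+ 2 + wderiv u x ^+ 2 + eta x ^+ 2 + wderiv eta x ^+ 2)).

(* (u, eta) belongs to C(R, (H^1 x H^1)(R)); the first argument is time. *)
Definition continuous_in_H1 (u eta : R -> R -> R) : Prop :=
  (forall t, H1 (u t) /\ H1 (eta t)) /\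
  (forall t, H1norm setT (u s \- u t) (eta s \- eta t) @[s --> t] --> 0).

End sobolev.

Section abcd.
Context {R : realType}.

Definition dt (phi : R * R -> R) : R * R -> R := 'D_(1, 0) phi.
Definition dx (phi : R * R -> R) : R * R -> R := 'D_(0, 1) phi.

(* The system in the sense of distributions on R_t x R_x: each equation is
   multiplied by - phi and all the derivatives are moved to phi.  The integrals
   are iterated so that they do not depend on the representatives chosen for
   the elements u t, eta t of H^1. *)
Definition abcd_solution (a b c : R) (u eta : R -> R -> R) : Prop :=
  forall phi : R * R -> R, test_function phi ->
    \int[leb]_t (\int[leb]_x
      (eta t x * (dt phi (t, x) - b * dx (dx (dt phi)) (t, x))
       + a * u t x * dx (dx (dx phi)) (t, x)
       + (u t x + u t x * eta t x) * dx phi (t, x))) = 0 /\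
    \int[leb]_t (\int[leb]_x
      (u t x * (dt phi (t, x) - b * dx (dx (dt phi)) (t, x))
       + c * eta t x * dx (dx (dx phi)) (t, x)
       + (eta t x + 2^-1 * u t x ^+ 2) * dx phi (t, x))) = 0.

Definition travelling (omega : R) (U : R -> R) : R -> R -> R :=
  fun t x => U (x - omega * t).

Definition exterior_region (eps delta t : R) : set R :=
  `]-oo, - ((2 + eps) * `|t|)[ `|` `](2 + delta) * `|t|, +oo[.

End abcd.

(* Main.v *)
(* Write a = c = - kappa b with 0 < kappa < 1, A = (1 - b d^2/dx^2)^-1,
   M = A ((1 - kappa) u + u eta), N = A ((1 - kappa) eta + u^2 / 2).  The system
   becomes u_t = - (kappa eta + N)_x, eta_t = - (kappa u + M)_x.  The conserved
   energy has density
     e = (kappa b (u_x^2 + eta_x^2) + u^2 + eta^2 + u^2 eta) / 2,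
   and for a weight w moving at speed s
     d/dt int w(x - s t) e = int w'(x - s t) (f - s e),
     f = (kappa u + M) (kappa eta + N) - b M_x N_x + b kappa^2 u_x eta_x.
   The energy controls the H^1 norm of small solutions, so a small solution stays
   small.  When |w''| is small compared with |w'|, a weighted estimate for A gives
   |int w' f| <= 2 int |w'| e, so an energy weighted by a profile receding at speed
   2 is monotone.  At time t the profile is centred at distance (2 + delta) |t|; at
   time 0 it is then centred at distance delta |t|, where the initial energy tends
   to 0.  A travelling wave satisfies omega eta = kappa u + M, omega u = kappa eta + N,
   which for |omega| > 2 forces u = eta = 0 because A is a contraction of L^2.

   The energy identity is justified without regularizing in time: u and eta are
   differentiable in L^2, and u_x + eta_x and u_x - eta_x become so in frames moving
   at speed kappa and - kappa, where the principal part of the equation disappears. *)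

Require Import Defs.
From HB Require Import structures.
From mathcomp Require Import all_boot all_order all_algebra.
From mathcomp Require Import all_classical all_reals all_analysis.
From mathcomp Require Import measurable_realfun.
From mathcomp Require Import ring lra.

Set Implicit Arguments.
Unset Strict Implicit.
Unset Printing Implicit Defensive.

Import Order.TTheory GRing.Theory Num.Theory.
Import numFieldNormedType.Exports.

Local Open Scope classical_set_scope.
Local Open Scope ring_scope.

(** * Smooth functions *)

Section smooth_theory.
Context {R : realType} {V : normedModType R}.
Implicit Types f g : V -> R.

(** Two difficulties shape the development. [A] is nonlocal, so the flux is not bounded pointwise by
    the energy density. The weights therefore vary slowly on the scale sqrt b: with |w''| <= |w'| /
    (4 sqrt b) the weighted estimate for [A] loses only a factor 4/3. The flux is split convexly:
    kappa u + M is read as a mean with weights kappa and 1 - kappa, because M is (1 - kappa) A u up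
    to a quadratic term. This yields a constant close to kappa + (4/3) (1 - kappa), and the gap to 2
    absorbs the nonlinear terms. The other difficulty is regularity. Solutions are merely continuous
    in H^1, and u_xt would contain eta_xx, so the energy cannot be differentiated formally. A chi is
    not compactly supported when chi is, so the system is tested with (1 - b d^2/dx^2) chi instead.
    This turns it into ordinary derivatives of scalar pairings, and differentiability in L^2 follows
    from the density of these functions. No Fourier transform is used: [A] is the mean of two
    one-sided exponential averages. *)

Lemma smooth_family (P : (V -> R) -> Prop) :
  (forall f, P f -> forall x, differentiable f x) ->
  (forall f, P f -> forall v, P ('D_v f)) -> forall f, P f -> smooth f.
Proof.
move=> dP DP f Pf vs x; apply: dP; elim: vs => //= v vs ih; exact: DP.
Qed.

Lemma smooth_differentiable f x : smooth f -> differentiable f x.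
Proof. by move=> /(_ [::] x). Qed.

Lemma smooth_derive f v : smooth f -> smooth ('D_v f).
Proof. by move=> sf vs x; have := sf (rcons vs v) x; rewrite foldr_rcons. Qed.

End smooth_theory.

Section smooth_algebra.
Context {R : realType} {V : normedModType R}.
Implicit Types f g : V -> R.

(** Smoothness speaks of all iterated directional derivatives at once, so closure under products is
    obtained from a class stable under every ['D_v]. The maps [l] with constant directional
    derivatives stand for affine maps; the class is used both on [R] and on [R * R]. *)
Inductive smooth_algebra : (V -> R) -> Prop :=
| smooth_algebra_comp (h : R -> R) (l : V -> R) : smooth h ->
    (forall x, differentiable l x) -> (forall v, exists k, 'D_v l = cst k) ->
    smooth_algebra (h \o l)
| smooth_algebra_cst (k : R) : smooth_algebra (cst k)
| smooth_algebraD f g : smooth_algebra f -> smooth_algebra g ->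
    smooth_algebra (f + g)
| smooth_algebraM f g : smooth_algebra f -> smooth_algebra g ->
    smooth_algebra (f * g).

Lemma derive_comp1 (h : R -> R) (l : V -> R) x v :
  differentiable l x -> differentiable h (l x) ->
  'D_v (h \o l) x = 'D_1 h (l x) * 'D_v l x.
Proof.
move=> dl dh; rewrite !deriveE//; last exact: differentiable_comp.
by rewrite diff_comp//= diff1E//= scale1r mulrC.
Qed.

Lemma smooth_algebra_smooth f : smooth_algebra f -> smooth f.
Proof.
move: f; apply: smooth_family => f.
  elim=> {f} [h l sh dl _|k|f g _ df _ dg|f g _ df _ dg] x.
  - by apply: differentiable_comp; [exact: dl|exact: smooth_differentiable].
  - exact: differentiable_cst.
  - exact: differentiableD.
  - exact: differentiableM.
(* Stability under ['D_v] is proved jointly with differentiability, which the Leibniz rule requires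
   of both factors. *)
suff H : smooth_algebra f -> (forall x, differentiable f x) /\
    forall v, smooth_algebra ('D_v f) by move=> /H[].
elim=> {f} [h l sh dl dl'|k|f g af [df Df] ag [dg Dg]|f g af [df Df] ag [dg Dg]].
- split=> [x|v].
    by apply: differentiable_comp; [exact: dl|exact: smooth_differentiable].
  have [k kE] := dl' v.
  have -> : 'D_v (h \o l) = (('D_1 h) \o l) * cst k.
    apply/funext => x; rewrite derive_comp1//; last exact: smooth_differentiable.
    by congr (_ * _); exact: (congr1 (fun g => g x) kE).
  apply: smooth_algebraM; last exact: smooth_algebra_cst.
  by apply: smooth_algebra_comp => //; exact: smooth_derive.
- split=> [x|v]; first exact: differentiable_cst.
  have -> : 'D_v (cst k : V -> R) = cst 0.
    by apply/funext => x; rewrite derive_cst.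
  exact: smooth_algebra_cst.
- split=> [x|v]; first exact: differentiableD.
  have -> : 'D_v (f + g) = 'D_v f + 'D_v g.
    by apply/funext => x; rewrite deriveD//; exact: diff_derivable.
  exact: smooth_algebraD.
- split=> [x|v]; first exact: differentiableM.
  have -> : 'D_v (f * g) = f * 'D_v g + g * 'D_v f.
    apply/funext => x; rewrite deriveM//; exact: diff_derivable.
  by apply: smooth_algebraD; apply: smooth_algebraM.
Qed.

End smooth_algebra.

Section smooth_real.
Context {R : realType}.
Implicit Types f g h : R -> R.

Lemma derive_scale f x v : differentiable f x -> 'D_v f x = v * 'D_1 f x.
Proof.
by move=> df; rewrite !deriveE// diff1E//= scale1r.
Qed.

Lemma smooth_derive1 f : smooth f -> smooth f^`()%classic.
Proof.
move=> sf; have -> : f^`()%classic = 'D_1 f by apply/funext => x; rewrite derive1E.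
exact: smooth_derive.
Qed.

Lemma smooth_derivable f x : smooth f -> derivable f x 1.
Proof. by move=> sf; apply/derivable1_diffP; exact: smooth_differentiable. Qed.

Lemma smooth_is_derive f x : smooth f -> is_derive (x : R) (1 : R) f (f^`()%classic x).
Proof. by move=> sf; rewrite derive1E; apply: derivableP; exact: smooth_derivable. Qed.

Lemma smooth_continuous f : smooth f -> continuous f.
Proof.
by move=> sf x; apply: differentiable_continuous; exact: smooth_differentiable.
Qed.

Lemma smooth_family1 (P : (R -> R) -> Prop) :
  (forall f, P f -> forall x, derivable f x 1) ->
  (forall f, P f -> P f^`()%classic) -> forall f, P f -> smooth f.
Proof.
move=> dP DP f Pf.
(* On the line ['D_v f] is [v] times the ordinary derivative, so scalar multiples are added to make
   the family stable under all directions. *)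
pose Q g := exists k h, P h /\ g = k *: h.
apply: (@smooth_family _ _ Q); last by exists 1, f; rewrite scale1r.
  move=> _ [k [h [Ph ->]]] x; apply: differentiableZ.
  by apply/derivable1_diffP; exact: dP.
move=> _ [k [h [Ph ->]]] v; exists (v * k), h^`()%classic; split; first exact: DP.
apply/funext => x.
have dh : derivable h x 1 by exact: dP.
rewrite derive_scale; last by apply: differentiableZ; apply/derivable1_diffP.
by rewrite deriveZ// -derive1E /GRing.scale/= mulrA.
Qed.

Lemma affine_derive (k c : R) v : 'D_v (fun x : R => k * x + c) = cst (k * v).
Proof.
apply/funext => x; rewrite deriveD//.
by rewrite deriveM// !derive_cst derive_id scaler0 !addr0.
Qed.

Lemma affine_differentiable (k c : R) x : differentiable (fun x : R => k * x + c) x.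
Proof. by apply/derivable1_diffP; apply: derivableD. Qed.

Lemma smooth_algebra_affine h k c : smooth h ->
  smooth_algebra (fun x : R => h (k * x + c)).
Proof.
move=> sh; apply: (@smooth_algebra_comp _ _ h (fun x => k * x + c)) => //.
by move=> v; exists (k * v); rewrite affine_derive.
Qed.

Lemma smooth_affine h k c : smooth h -> smooth (fun x : R => h (k * x + c)).
Proof. by move=> sh; apply/smooth_algebra_smooth/smooth_algebra_affine. Qed.

Lemma smooth_smooth_algebra h : smooth h -> smooth_algebra h.
Proof.
move=> sh; have -> : h = (fun x : R => h (1 * x + 0)).
  by apply/funext => x; rewrite mul1r addr0.
exact: smooth_algebra_affine.
Qed.

Lemma smoothM f g : smooth f -> smooth g -> smooth (f * g).
Proof.
by move=> sf sg; apply/smooth_algebra_smooth/smooth_algebraM;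
  exact: smooth_smooth_algebra.
Qed.

Lemma smoothZ k f : smooth f -> smooth (k *: f).
Proof.
move=> sf; have -> : k *: f = cst k * f by [].
apply/smooth_algebra_smooth/smooth_algebraM; last exact: smooth_smooth_algebra.
exact: smooth_algebra_cst.
Qed.

Lemma derive1_affine h k c x : (forall y, derivable h y 1) ->
  (fun x : R => h (k * x + c))^`()%classic x = k * h^`()%classic (k * x + c).
Proof.
move=> dh; rewrite derive1E.
rewrite (_ : (fun x => _) = h \o (fun x => k * x + c))//.
rewrite derive_comp1; last 2 first.
  exact: affine_differentiable.
  exact/derivable1_diffP.
rewrite [X in _ * X](_ : _ = k); first by rewrite derive1E mulrC.
by have := congr1 (fun g => g x) (affine_derive k c 1); rewrite /= mulr1.
Qed.

(** For [p = 1] this is the classical flat function exp (- 1/x). The polynomial in 1/x makes the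
    family closed under differentiation, which sends [p] to X^2 (p - p'). *)
Definition flat (p : {poly R}) : R -> R :=
  fun x => if 0 < x then p.[x^-1] * expR (- x^-1) else 0.

Lemma expR_ge_pow n (y : R) : 0 <= y -> y ^+ n <= n`!%:R * expR y.
Proof.
move=> y0; have := @exp_coeff_ge0 R; move=> _.
elim: n y y0 => [y y0|n ih y y0].
  by rewrite expr0 mul1r -expR0 ler_expR.
pose F := fun x : R => n.+1`!%:R * expR x - x ^+ n.+1.
have dF x : is_derive x (1 : R) F (n.+1`!%:R * expR x - n.+1%:R * x ^+ n).
  have d1 : is_derive x (1 : R) (fun x : R => n.+1`!%:R * expR x) (n.+1`!%:R * expR x).
    exact: is_deriveZ.
  have d2 : is_derive x (1 : R) (fun x : R => x ^+ n.+1) (n.+1%:R * x ^+ n).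
    apply: DeriveDef; first exact: exprn_derivable.
    by rewrite exp_derive /GRing.scale/= mulr1.
  exact: is_deriveB.
have : F 0 <= F y.
  apply: (@ger0_derive1_le_cc _ F 0 y) => //.
  - move=> x; rewrite in_itv/= => /andP[x0 _].
    rewrite derive1E; have [_ ->] := dF x; rewrite subr_ge0 factS natrM -mulrA.
    by rewrite ler_wpM2l// ih// ltW.
  - by apply: derivable_within_continuous => x _; have [] := dF x.
  - by rewrite in_itv/= lexx.
  - by rewrite in_itv/= y0 lexx.
rewrite /F expr0n/= subr0 expR0 mulr1 => h.
rewrite -subr_ge0; apply: le_trans h; exact: ler0n.
Qed.

(** Quadratic vanishing makes the difference quotient at 0, the only delicate point, tend to 0. *)
Lemma flat_bound p : exists2 C, 0 <= C & forall x, `|x| <= 1 ->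
  `|flat p x| <= C * x ^+ 2.
Proof.
(* Two powers of 1/x are traded for the factor x^2; the remaining ones dominate every monomial of
   [p], since 1/x >= 1. *)
pose n := (size p).+2.
exists (\sum_(i < size p) `|p`_i| * n`!%:R).
  by apply: sumr_ge0 => i _; rewrite mulr_ge0// ler0n.
move=> x; rewrite ler_norml => /andP[_ x1]; rewrite /flat.
case: ifPn => x0; last by rewrite normr0 mulr_ge0 ?sqr_ge0//
  sumr_ge0// => i _; rewrite mulr_ge0// ler0n.
rewrite normrM (ger0_norm (expR_ge0 _)) horner_coef mulr_suml.
apply: (@le_trans _ _ ((\sum_(i < size p) `|p`_i| * x^-1 ^+ i) * expR (- x^-1))).
  rewrite ler_wpM2r ?expR_ge0//; apply: le_trans (ler_norm_sum _ _ _) _.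
  apply: ler_sum => i _; rewrite normrM ler_wpM2l//.
  by rewrite ger0_norm// exprn_ge0// invr_ge0 ltW.
rewrite mulr_suml; apply: ler_sum => i _.
rewrite -!mulrA ler_wpM2l//.
have y1 : 1 <= x^-1 by rewrite -invr1 lef_pV2 ?posrE.
have y0 : 0 <= x^-1 by rewrite (le_trans ler01).
rewrite expRN.
rewrite ler_pdivrMr ?expR_gt0//.
have -> : x ^+ 2 = (x^-1) ^- 2 by rewrite exprVn invrK.
rewrite mulrAC ler_pdivlMr; last by rewrite exprn_gt0// (lt_le_trans ltr01).
rewrite -exprD; apply: le_trans (expR_ge_pow n y0).
by rewrite ler_weXn2l// addn2 !ltnS ltnW.
Qed.

Lemma flat_derive p x : is_derive (x : R) (1 : R) (flat p) (flat ('X^2 * (p - p^`())) x).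
Proof.
have [x0|x0|<-] := ltgtP 0 x.
- have near_eq : \forall y \near x, flat p y = p.[y^-1] * expR (- y^-1).
    near=> y; rewrite /flat ifT//; near: y; exact: lt_nbhsr.
  have xn : x != 0 by rewrite gt_eqF.
  have dinv : is_derive x (1 : R) (fun y : R => y^-1) (- x ^- 2).
    by apply: is_derive_eq; first exact: is_deriveV; rewrite /GRing.scale/= mulr1.
  have d1 : is_derive x (1 : R) (fun y : R => p.[y^-1]) (- x ^- 2 * p^`().[x^-1]).
    have := @is_derive1_comp _ (fun z => p.[z]) (fun y : R => y^-1) x _ _
      (is_derive_poly p (x^-1)) dinv.
    by move=> H; apply: (is_derive_eq H); rewrite mulrC.
  have d2 : is_derive x (1 : R) (fun y : R => expR (- y^-1)) (x ^- 2 * expR (- x^-1)).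
    have dn : is_derive x (1 : R) (fun y : R => - y^-1) (x ^- 2).
      by apply: (is_derive_eq (is_deriveN dinv)); rewrite opprK.
    have := @is_derive1_comp _ (@expR R) (fun y : R => - y^-1) x _ _
      (is_derive_expR (- x^-1)) dn.
    by move=> H; apply: (is_derive_eq H); rewrite mulrC.
  have d3 : is_derive x (1 : R) (fun y => p.[y^-1] * expR (- y^-1))
      (flat ('X^2 * (p - p^`())) x).
    apply: (is_derive_eq (is_deriveM d1 d2)).
    rewrite /flat x0 !hornerE /GRing.scale/=.
    by rewrite -exprVn; ring.
  apply: (near_eq_is_derive _ d3).
  by near=> y; apply/esym; near: y.
- have near_eq : \forall y \near x, flat p y = 0.
    near=> y; rewrite /flat ifF//; apply/negbTE; rewrite -leNgt ltW//; near: y.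
    exact: lt_nbhsl.
  have -> : flat ('X^2 * (p - p^`())) x = 0.
    by rewrite /flat ltNge (ltW x0).
  apply: (near_eq_is_derive _ (is_derive_cst (0 : R) x 1)).
  by near=> y; apply/esym; near: y.
- have -> : flat ('X^2 * (p - p^`())) 0 = 0 by rewrite /flat ltxx.
  have [C C0 Cb] := flat_bound p.
  have H : h^-1 *: (flat p (h *: 1 + 0) - flat p 0) @[h --> 0^'] --> (0 : R).
    apply/cvgrPdist_le => e e0; near=> h.
    have h0 : h != 0 by near: h; exact: nbhs_dnbhs_neq.
    have h1 : `|h| <= 1.
      near: h; apply: dnbhs0_le => //.
    have h2 : `|h| <= e / (C + 1).
      near: h; apply: dnbhs0_le; rewrite divr_gt0// ltr_wpDl//.
    rewrite sub0r normrN {2}/flat ltxx subr0 addr0 {1}/GRing.scale/= normrM.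
    rewrite /GRing.scale/= mulr1 normfV ler_pdivrMl ?normr_gt0//.
    apply: (le_trans (Cb _ h1)).
    rewrite -real_normK ?num_real// expr2 mulrA mulrC ler_wpM2l//.
    apply: le_trans (_ : (C + 1) * `|h| <= _).
      by rewrite ler_wpM2r// lerDl.
    by rewrite mulrC -ler_pdivlMr// ltr_wpDl.
  apply: DeriveDef; first by apply/cvg_ex; exists 0.
  exact/cvg_lim.
Unshelve. all: end_near. Qed.

Lemma flat_smooth p : smooth (flat p).
Proof.
apply: (@smooth_family1 (fun f => exists q, f = flat q)); last by exists p.
  by move=> _ [q ->] x; have [] := flat_derive q x.
move=> _ [q ->]; exists ('X^2 * (q - q^`())); apply/funext => x.
by rewrite derive1E; have [] := flat_derive q x.
Qed.

(* proportional to exp (- 2 / (1 - x^2)) on ]-1, 1[ *)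
Definition bump0 : R -> R := fun x => flat 1 (1 * x + 1) * flat 1 (-1 * x + 1).

Lemma bump0_smooth : smooth bump0.
Proof.
apply: (@smoothM (fun x => flat 1 (1 * x + 1)) (fun x => flat 1 (-1 * x + 1)));
  apply: smooth_affine; exact: flat_smooth.
Qed.

Lemma flat1_ge0 x : 0 <= flat 1 x.
Proof. by rewrite /flat; case: ifP => // _; rewrite hornerE mul1r expR_ge0. Qed.

Lemma flat1_gt0 x : 0 < x -> 0 < flat 1 x.
Proof. by rewrite /flat => ->; rewrite hornerE mul1r expR_gt0. Qed.

Lemma flat_le0 p x : x <= 0 -> flat p x = 0.
Proof. by rewrite /flat leNgt => /negbTE ->. Qed.

Lemma bump0_ge0 x : 0 <= bump0 x.
Proof. by rewrite mulr_ge0 ?flat1_ge0. Qed.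

Lemma bump0_gt0 x : `|x| < 1 -> 0 < bump0 x.
Proof.
rewrite ltr_norml => /andP[x1 x2]; rewrite mulr_gt0// flat1_gt0//; lra.
Qed.

Lemma bump0_out x : 1 <= `|x| -> bump0 x = 0.
Proof.
rewrite ler_normr /bump0 => /orP[x1|x1].
  by rewrite (flat_le0 _ (_ : -1 * x + 1 <= 0)) ?mulr0//; lra.
by rewrite (flat_le0 _ (_ : 1 * x + 1 <= 0)) ?mul0r//; lra.
Qed.

End smooth_real.

(** * Integration and square integrable functions on the line *)

Section lebesgue_affine.
Context {R : realType}.
Local Notation mu := (@lebesgue_measure R).
Variables (a c : R) (a0 : a != 0).
Let phi : measurableTypeR R -> measurableTypeR R := fun x => a * x + c.

Let mphi : measurable_fun setT phi.
Proof. by apply: measurable_funD => //; exact: measurable_funM. Qed.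

Let nu : {measure set (measurableTypeR R) -> \bar R} :=
  measure_function_pushforward__canonical__measure_function_Measure mu mphi.
Let an : {nonneg R} := NngNum (normr_ge0 a).

(** By uniqueness of Lebesgue measure only half-open intervals have to be compared. A negative [a]
    reverses the interval and swaps its closed end, leaving the length formula unchanged. *)
Let lebesgue_affine_set (A : set R) : measurable A ->
  mu A = mscale an nu A.
Proof.
move=> mA; apply: lebesgue_measure_unique => //= _ [[p q] _ <-].
rewrite /mscale/= /pushforward lebesgue_measure_itv/= lte_fin.
have [ag0|al0|] := ltgtP 0 a; last by move/esym/eqP; rewrite (negbTE a0).
- have -> : phi @^-1` `]p, q] = `](p - c) / a, (q - c) / a]%classic.
    apply/seteqP; split=> x /=; rewrite !in_itv/= /phi ltr_pdivrMr// ler_pdivlMr//;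
    by rewrite ltrBlDr lerBrDr (mulrC x).
  rewrite lebesgue_measure_itv/= lte_fin ltr_pM2r ?invr_gt0// ltrD2r.
  case: ifPn => _; last by rewrite mule0.
  rewrite -!EFinB -EFinM; congr EFin; rewrite gtr0_norm//.
  by field.
- have -> : phi @^-1` `]p, q] = `[(q - c) / a, (p - c) / a[%classic.
    apply/seteqP; split=> x /=; rewrite !in_itv/= /phi ltr_ndivlMr// ler_ndivrMr//;
    by rewrite ltrBlDr lerBrDr (mulrC x) andbC.
  rewrite lebesgue_measure_itv/= lte_fin ltr_nM2r ?invr_lt0// ltrD2r.
  case: ifPn => _; last by rewrite mule0.
  rewrite -!EFinB -EFinM; congr EFin; rewrite ltr0_norm//.
  by field.
Qed.

Local Open Scope ereal_scope.

Lemma ge0_integral_affine (f : R -> \bar R) : measurable_fun setT f ->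
  (forall x, 0 <= f x) ->
  \int[mu]_x f x = `|a|%:E * \int[mu]_x f (a * x + c)%R.
Proof.
move=> mf f0; rewrite (@eq_measure_integral _ _ _ setT (mscale an nu)).
  rewrite ge0_integral_mscale// /nu (ge0_integral_pushforward mphi)//.
by move=> A mA _; exact: lebesgue_affine_set.
Qed.

End lebesgue_affine.

Section integrals.
Context {R : realType}.
Local Notation mu := (@lebesgue_measure R).
Implicit Types (f g h : R -> R) (k : R).

Lemma ae_imp (P Q : R -> Prop) : {ae mu, forall x, P x} ->
  (forall x, P x -> Q x) -> {ae mu, forall x, Q x}.
Proof.
by move=> aeP PQ; exact: (@filterS _ _ (ae_filter_ringOfSetsType mu) _ _ PQ).
Qed.

Lemma ae_and (P Q : R -> Prop) : {ae mu, forall x, P x} ->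
  {ae mu, forall x, Q x} -> {ae mu, forall x, P x /\ Q x}.
Proof. exact: (@filterI _ _ (ae_filter_ringOfSetsType mu)). Qed.

Definition itg f := mu.-integrable setT (EFin \o f).
Definition Itg f := \int[mu]_x f x.

Lemma itg_measurable f : itg f -> measurable_fun setT f.
Proof. by move=> /integrableP[/measurable_EFinP]. Qed.

Lemma itg_le f g : measurable_fun setT f -> itg g ->
  (forall x, `|f x| <= g x) -> itg f.
Proof.
move=> mf ig fg; apply: (le_integrable _ _ _ ig) => //=.
  exact/measurable_EFinP.
by move=> x _; rewrite lee_fin (le_trans (fg x))// ler_norm.
Qed.

Lemma itg_ae f g : measurable_fun setT f -> itg g ->
  {ae mu, forall x, f x = g x} -> itg f.
Proof.
move=> mf /integrableP[mg gb] fg; apply/integrableP; split.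
  exact/measurable_EFinP.
rewrite (_ : (\int[mu]_x `|(f x)%:E|)%E = (\int[mu]_x `|(g x)%:E|)%E)//.
apply: ae_eq_integral => //.
- by apply: measurableT_comp => //; exact/measurable_EFinP.
- exact: measurableT_comp.
- by apply: (ae_imp fg) => x /= -> _.
Qed.

Lemma itg_le_ae f g : measurable_fun setT f -> itg g ->
  {ae mu, forall x, `|f x| <= g x} -> itg f.
Proof.
move=> mf ig fg.
have mg := itg_measurable ig.
(* [h] clips [f] to [-|g|, |g|]: it is dominated everywhere and equals [f] almost everywhere. *)
pose h x := Num.max (- `|g x|) (Num.min `|g x| (f x)).
have mng : measurable_fun setT (fun x => `|g x|) by exact: measurableT_comp.
have mh : measurable_fun setT h.
  apply: measurable_maxr; first exact: measurableT_comp.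
  exact: measurable_minr.
have ih : itg h.
  apply: (@itg_le _ (fun x => `|g x|)) => //; first exact: integrable_norm.
  move=> x; rewrite ler_norml /h le_max lexx/= ge_max ge_min lexx/= andbT.
  by rewrite (le_trans _ (normr_ge0 _))// oppr_le0.
apply: (itg_ae mf ih); apply: (ae_imp fg) => x {}fg.
have : `|f x| <= `|g x| by rewrite (le_trans fg)// ler_norm.
rewrite ler_norml /h => /andP[h1 h2].
by rewrite (min_idPr h2) (max_idPr h1).
Qed.

Lemma itgD f g : itg f -> itg g -> itg (fun x => f x + g x).
Proof. by move=> fi gi; exact: integrableD fi gi. Qed.

Lemma itgB f g : itg f -> itg g -> itg (fun x => f x - g x).
Proof. by move=> fi gi; exact: integrableB fi gi. Qed.

Lemma itgZ k f : itg f -> itg (fun x => k * f x).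
Proof.
move=> fi; have := integrableZl measurableT k fi.
by apply: eq_integrable => // x _; rewrite /= EFinM.
Qed.

Lemma itgN f : itg f -> itg (fun x => - f x).
Proof. by move=> /(itgZ (-1)); under eq_fun do rewrite mulN1r. Qed.

Lemma itg0 : itg (fun=> 0).
Proof. exact: integrable0. Qed.

Lemma itg_norm f : itg f -> itg (fun x => `|f x|).
Proof. by move=> fi; exact: integrable_norm. Qed.

Lemma ItgD f g : itg f -> itg g -> Itg (fun x => f x + g x) = Itg f + Itg g.
Proof. by move=> fi gi; exact: RintegralD. Qed.

Lemma ItgB f g : itg f -> itg g -> Itg (fun x => f x - g x) = Itg f - Itg g.
Proof. by move=> fi gi; exact: RintegralB. Qed.

Lemma ItgZ k f : itg f -> Itg (fun x => k * f x) = k * Itg f.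
Proof. by move=> fi; exact: RintegralZl. Qed.

Lemma ItgN f : itg f -> Itg (fun x => - f x) = - Itg f.
Proof.
move=> fi; rewrite -mulN1r -ItgZ//; congr Itg; apply/funext => x.
by rewrite mulN1r.
Qed.

Lemma Itg0 : Itg (fun=> 0) = 0.
Proof. by rewrite /Itg /Rintegral integral0. Qed.

Lemma eq_Itg f g : (forall x, f x = g x) -> Itg f = Itg g.
Proof. by move=> fg; congr Itg; exact/funext. Qed.

Lemma eq_itg f g : (forall x, f x = g x) -> itg f -> itg g.
Proof. by move=> /funext ->. Qed.

Lemma Itg_ae f g : measurable_fun setT f -> measurable_fun setT g ->
  {ae mu, forall x, f x = g x} -> Itg f = Itg g.
Proof.
move=> mf mg fg; congr fine; apply: ae_eq_integral => //.
- exact/measurable_EFinP.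
- exact/measurable_EFinP.
- by apply: (ae_imp fg) => x /= -> _.
Qed.

Lemma Itg_ge0 f : (forall x, 0 <= f x) -> 0 <= Itg f.
Proof. by move=> f0; exact: Rintegral_ge0. Qed.

Lemma le_Itg f g : itg f -> itg g -> (forall x, f x <= g x) -> Itg f <= Itg g.
Proof. by move=> fi gi fg; exact: le_Rintegral. Qed.

Lemma le_Itg_ae f g : itg f -> itg g -> {ae mu, forall x, f x <= g x} ->
  Itg f <= Itg g.
Proof.
move=> fi gi fg; have mf := itg_measurable fi; have mg := itg_measurable gi.
have mh : measurable_fun setT (fun x => Num.min (f x) (g x)).
  exact: measurable_minr.
have fh : {ae mu, forall x, Num.min (f x) (g x) = f x}.
  by apply: (ae_imp fg) => x {}fg; exact/min_idPl.
rewrite -(Itg_ae mh mf fh); apply: le_Itg => //.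
  exact: (itg_ae mh fi fh).
by move=> x; rewrite ge_min lexx orbT.
Qed.

Lemma le_norm_Itg f : itg f -> `|Itg f| <= Itg (fun x => `|f x|).
Proof. by move=> fi; exact: le_normr_Rintegral. Qed.

Lemma EFin_Itg f : itg f -> (Itg f)%:E = (\int[mu]_x (f x)%:E)%E.
Proof. by move=> fi; rewrite fineK//; exact: integrable_fin_num. Qed.

Lemma Itg_affine a c f : a != 0 -> measurable_fun setT f ->
  Itg f = `|a| * Itg (fun x => f (a * x + c)).
Proof.
move=> a0 mf.
have a1 : 0 < `|a| by rewrite normr_gt0.
have mE : measurable_fun setT (EFin \o f) by exact/measurable_EFinP.
rewrite /Itg /Rintegral integralE [in RHS]integralE.
rewrite (ge0_integral_affine c a0 (measurable_funepos mE))//.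
rewrite (ge0_integral_affine c a0 (measurable_funeneg mE))//=.
set p := (\int[mu]_x _)%E; set n := (\int[mu]_x _)%E.
rewrite (_ : (\int[mu]_x ((fun x0 => (f (a * x0 + c))%:E)^\+)%E x)%E = p)%E; last first.
  by apply: eq_integral => x _; rewrite !funeposE.
rewrite (_ : (\int[mu]_x ((fun x0 => (f (a * x0 + c))%:E)^\-)%E x)%E = n)%E; last first.
  by apply: eq_integral => x _; rewrite !funenegE.
have p0 : (0 <= p)%E by exact: integral_ge0.
have n0 : (0 <= n)%E by exact: integral_ge0.
(* The factor |a| > 0 preserves infinite parts, in which case both sides take the default value 0 of
   [fine]. *)
move: p p0 n n0 => [p| |] p0 [n| |] n0 //=; rewrite ?gt0_muley ?lte_fin//= ?mulr0//.
by rewrite mulrBr.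
Qed.

Lemma itg_affine a c f : a != 0 -> itg f -> itg (fun x => f (a * x + c)).
Proof.
move=> a0 /integrableP[mf fy]; apply/integrableP; split.
  apply/measurable_EFinP; apply: measurableT_comp; first exact/measurable_EFinP.
  by apply: measurable_funD => //; exact: measurable_funM.
have mf' : measurable_fun setT (fun x => `|(EFin \o f) x|%E).
  exact: measurableT_comp.
move: fy; rewrite (ge0_integral_affine c a0 mf')//.
case: (\int[mu]_x _)%E => [r _|H|_]; rewrite ?ltry ?ltNyr//.
by move: H; rewrite gt0_muley// lte_fin normr_gt0.
Qed.

End integrals.

Section square_integrable.
Context {R : realType}.
Local Notation mu := (@lebesgue_measure R).
Local Notation L2 := (@L2 R).
Implicit Types (f g h w : R -> R) (k M : R).

Lemma L2P f : L2 f <-> measurable_fun setT f /\ itg (fun x => f x ^+ 2).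
Proof.
split=> [fL|[mf fi]].
  split; last exact: Lfun2_integrable_sqr.
  by move: fL; rewrite /Defs.L2 inE => /andP[]; rewrite inE.
rewrite /Defs.L2 inE; apply/andP; split; rewrite inE//= /finite_norm unlock.
rewrite poweR_lty//.
have -> : (\int[mu]_x `|(f x)%:E| `^ 2 = \int[mu]_x (f x ^+ 2)%:E)%E.
  apply: eq_integral => x _; rewrite abse_EFin poweR_EFin; congr EFin.
  by rewrite powR_mulrn// real_normK// num_real.
exact: integrable_lty.
Qed.

Lemma L2_measurable f : L2 f -> measurable_fun setT f.
Proof. by case/L2P. Qed.

Lemma L2_sqr f : L2 f -> itg (fun x => f x ^+ 2).
Proof. by case/L2P. Qed.

Lemma itgM f g : L2 f -> L2 g -> itg (fun x => f x * g x).
Proof.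
move=> /L2P[mf fi] /L2P[mg gi]; apply: (@itg_le _ _ (fun x => f x ^+ 2 + g x ^+ 2)).
- exact: measurable_funM.
- exact: itgD.
- move=> x; rewrite normrM -(real_normK (num_real (f x))) -(real_normK (num_real (g x))).
  have := sqr_ge0 (`|f x| - `|g x|); have := normr_ge0 (f x).
  have := normr_ge0 (g x); nra.
Qed.

Lemma L2D f g : L2 f -> L2 g -> L2 (fun x => f x + g x).
Proof.
move=> fL gL; have [mf fi] := (L2P f).1 fL; have [mg gi] := (L2P g).1 gL.
apply/L2P; split; first exact: measurable_funD.
apply: (@eq_itg _ (fun x => f x ^+ 2 + (2 * (f x * g x) + g x ^+ 2))).
  by move=> x; ring.
by apply: itgD => //; apply: itgD => //; apply: itgZ; exact: itgM.
Qed.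

Lemma L2Z k f : L2 f -> L2 (fun x => k * f x).
Proof.
move=> /L2P[mf fi]; apply/L2P; split; first exact: measurable_funM.
by apply: (@eq_itg _ (fun x => k ^+ 2 * f x ^+ 2)) => [x|]; [ring|exact: itgZ].
Qed.

Lemma eq_L2 f g : (forall x, f x = g x) -> L2 f -> L2 g.
Proof. by move=> /funext ->. Qed.

Lemma L2N f : L2 f -> L2 (fun x => - f x).
Proof. by move=> /(L2Z (-1)); apply: eq_L2 => x; rewrite mulN1r. Qed.

Lemma L2B f g : L2 f -> L2 g -> L2 (fun x => f x - g x).
Proof. by move=> fL /L2N; exact: L2D. Qed.

Lemma L2_0 : L2 (fun=> 0).
Proof.
by apply/L2P; split => //; apply: eq_itg itg0 => x; rewrite expr0n.
Qed.

Lemma L2_le_ae f g : measurable_fun setT f -> L2 g ->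
  {ae mu, forall x, `|f x| <= `|g x|} -> L2 f.
Proof.
move=> mf /L2P[mg gi] fg; apply/L2P; split => //.
apply: (itg_le_ae _ gi); first exact: measurable_funX.
apply: (ae_imp fg) => x {}fg; rewrite normrX -(real_normK (num_real (g x))).
by rewrite lerXn2r// nnegrE.
Qed.

Lemma L2M_ae w f M : measurable_fun setT w -> {ae mu, forall x, `|w x| <= M} ->
  L2 f -> L2 (fun x => w x * f x).
Proof.
move=> mw wM fL; apply: (@L2_le_ae _ (fun x => M * f x)).
- by apply: measurable_funM => //; exact: L2_measurable.
- exact: L2Z.
- apply: (ae_imp wM) => x {}wM; rewrite !normrM ler_wpM2r//.
  by rewrite (le_trans wM)// ler_norm.
Qed.

Lemma L2M w f M : measurable_fun setT w -> (forall x, `|w x| <= M) ->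
  L2 f -> L2 (fun x => w x * f x).
Proof. by move=> mw wM; apply: L2M_ae => //; exact: aeW. Qed.

Lemma L2_affine a c f : a != 0 -> L2 f -> L2 (fun x => f (a * x + c)).
Proof.
move=> a0 /L2P[mf fi]; apply/L2P; split; last exact: (itg_affine c a0 fi).
apply: measurableT_comp => //.
by apply: measurable_funD => //; exact: measurable_funM.
Qed.

Definition ip f g := Itg (fun x => f x * g x).
Definition nrm f := Num.sqrt (ip f f).

Lemma ipC f g : ip f g = ip g f.
Proof. by apply: eq_Itg => x; rewrite mulrC. Qed.

Lemma ipDl f g h : L2 f -> L2 g -> L2 h ->
  ip (fun x => f x + g x) h = ip f h + ip g h.
Proof.
move=> fL gL hL; rewrite /ip -ItgD; [|exact: itgM..].
by apply: eq_Itg => x; rewrite mulrDl.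
Qed.

Lemma ipBl f g h : L2 f -> L2 g -> L2 h ->
  ip (fun x => f x - g x) h = ip f h - ip g h.
Proof.
move=> fL gL hL; rewrite /ip -ItgB; [|exact: itgM..].
by apply: eq_Itg => x; rewrite mulrBl.
Qed.

Lemma ipZl k f h : L2 f -> L2 h -> ip (fun x => k * f x) h = k * ip f h.
Proof.
move=> fL hL; rewrite /ip -ItgZ; last exact: itgM.
by apply: eq_Itg => x; rewrite mulrA.
Qed.

Lemma ipDr f g h : L2 f -> L2 g -> L2 h ->
  ip h (fun x => f x + g x) = ip h f + ip h g.
Proof. by move=> ? ? ?; rewrite ipC ipDl// !(ipC h). Qed.

Lemma ipBr f g h : L2 f -> L2 g -> L2 h ->
  ip h (fun x => f x - g x) = ip h f - ip h g.
Proof. by move=> ? ? ?; rewrite ipC ipBl// !(ipC h). Qed.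

Lemma ipZr k f h : L2 f -> L2 h -> ip h (fun x => k * f x) = k * ip h f.
Proof. by move=> ? ?; rewrite ipC ipZl// (ipC h). Qed.

Lemma ip_ge0 f : 0 <= ip f f.
Proof. by apply: Itg_ge0 => x; rewrite -expr2 sqr_ge0. Qed.

Lemma nrm_ge0 f : 0 <= nrm f.
Proof. exact: sqrtr_ge0. Qed.

Lemma nrm_sqr f : nrm f ^+ 2 = ip f f.
Proof. by rewrite sqr_sqrtr// ip_ge0. Qed.

Lemma nrm_sqrE f : nrm f ^+ 2 = Itg (fun x => f x ^+ 2).
Proof. by rewrite nrm_sqr; apply: eq_Itg => x; rewrite expr2. Qed.

Lemma ip_CS f g : L2 f -> L2 g -> `|ip f g| <= nrm f * nrm g.
Proof.
move=> fL gL.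
have H (t : R) : 0 <= t ^+ 2 * ip f f - 2 * t * ip f g + ip g g.
  have := ip_ge0 (fun x => t * f x - g x).
  rewrite ipBl//; [|exact: L2Z|by apply: L2B => //; exact: L2Z].
  rewrite ipZl//; last by apply: L2B => //; exact: L2Z.
  rewrite !ipBr//; [|exact: L2Z..].
  rewrite !ipZr// (ipC g f); lra.
rewrite -ler_sqr ?nnegrE ?mulr_ge0 ?nrm_ge0// exprMn !nrm_sqr real_normK ?num_real//.
have := ip_ge0 f; have := ip_ge0 g.
have [f0|f0] := eqVneq (ip f f) 0.
  move=> g0 _; rewrite f0 mul0r.
  have [->|fg0] := eqVneq (ip f g) 0; first by rewrite expr0n.
  (* When [ip f f = 0] the quadratic in t is affine, and at this t it equals -1. *)
  have := H ((ip g g + 1) / (2 * ip f g)).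
  rewrite f0 mulr0 add0r.
  have -> : 2 * ((ip g g + 1) / (2 * ip f g)) * ip f g = ip g g + 1 by field.
  lra.
move=> g0 f1; have f2 : 0 < ip f f by rewrite lt_neqAle eq_sym f0.
have := H (ip f g / ip f f).
rewrite (_ : _ - _ + _ = (ip f f * ip g g - ip f g ^+ 2) / ip f f); last by field.
by rewrite pmulr_lge0 ?invr_gt0// subr_ge0.
Qed.

Lemma le_ip_nrm f g : L2 f -> L2 g -> ip f g <= nrm f * nrm g.
Proof. by move=> fL gL; apply: le_trans (ip_CS fL gL); exact: ler_norm. Qed.

Lemma nrmD f g : L2 f -> L2 g -> nrm (fun x => f x + g x) <= nrm f + nrm g.
Proof.
move=> fL gL; rewrite -ler_sqr ?nnegrE ?addr_ge0 ?nrm_ge0//.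
rewrite sqrrD !nrm_sqr ipDl ?ipDr//; last exact: L2D.
have := le_ip_nrm fL gL; rewrite (ipC g f) mulr2n; lra.
Qed.

Lemma nrmZ k f : L2 f -> nrm (fun x => k * f x) = `|k| * nrm f.
Proof.
move=> fL; rewrite /nrm ipZl ?ipZr//; last exact: L2Z.
by rewrite mulrA -expr2 sqrtrM ?sqr_ge0// sqrtr_sqr.
Qed.

Lemma nrmN f : L2 f -> nrm (fun x => - f x) = nrm f.
Proof.
move=> fL; rewrite -[RHS]mul1r -(normr1 R) -normrN -nrmZ//.
by congr nrm; apply/funext => x; rewrite mulN1r.
Qed.

Lemma nrmB f g : L2 f -> L2 g -> nrm (fun x => f x - g x) <= nrm f + nrm g.
Proof.
by move=> fL gL; rewrite -(nrmN gL); apply: nrmD => //; exact: L2N.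
Qed.

Lemma nrm_dist f g : L2 f -> L2 g -> `|nrm f - nrm g| <= nrm (fun x => f x - g x).
Proof.
move=> fL gL; have fgL := L2B fL gL.
have h1 : nrm f <= nrm (fun x => f x - g x) + nrm g.
  apply: le_trans (nrmD fgL gL).
  by rewrite le_eqVlt; apply/orP; left; apply/eqP; congr nrm; apply/funext => x; rewrite subrK.
have h2 : nrm g <= nrm (fun x => f x - g x) + nrm f.
  rewrite addrC; apply: le_trans (nrmB fL fgL).
  by rewrite le_eqVlt; apply/orP; left; apply/eqP; congr nrm; apply/funext => x; ring.
by rewrite ler_norml; apply/andP; split; lra.
Qed.

Lemma le_nrm f g : L2 f -> L2 g -> {ae mu, forall x, `|f x| <= `|g x|} ->
  nrm f <= nrm g.
Proof.
move=> fL gL fg; rewrite -ler_sqr ?nnegrE ?nrm_ge0// !nrm_sqrE.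
apply: le_Itg_ae; [exact: L2_sqr..|apply: (ae_imp fg) => x {}fg].
by rewrite -(real_normK (num_real (f x))) -(real_normK (num_real (g x))) lerXn2r// nnegrE.
Qed.

Lemma nrmM w f M : measurable_fun setT w -> {ae mu, forall x, `|w x| <= M} ->
  L2 f -> nrm (fun x => w x * f x) <= `|M| * nrm f.
Proof.
move=> mw wM fL; rewrite -nrmZ//; apply: le_nrm; [exact: L2M_ae wM fL|exact: L2Z|].
apply: (ae_imp wM) => x {}wM; rewrite !normrM ler_wpM2r//.
by rewrite (le_trans wM)// ler_norm.
Qed.

Lemma nrm0_ae f : L2 f -> nrm f = 0 -> {ae mu, forall x, f x = 0}.
Proof.
move=> fL f0; have : Itg (fun x => f x ^+ 2) = 0 by rewrite -nrm_sqrE f0 expr0n.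
have fi := L2_sqr fL; move=> /(f_equal (@EFin R)); rewrite EFin_Itg//.
have mf2 : measurable_fun setT (fun x => (f x ^+ 2)%:E).
  by apply/measurable_EFinP; exact: itg_measurable.
move=> H; have /(ae_eq_integral_abs mu measurableT mf2) :
    (\int[mu]_x `|(f x ^+ 2)%:E|)%E = 0%E.
  by rewrite -[RHS]H; apply: eq_integral => x _; rewrite gee0_abs// lee_fin sqr_ge0.
move=> H1; apply: (ae_imp H1) => x /= /(_ I)[/eqP]; rewrite sqrf_eq0 => /eqP //.
Qed.

Lemma nrm_ae f g : L2 f -> L2 g -> {ae mu, forall x, f x = g x} -> nrm f = nrm g.
Proof.
move=> fL gL fg; apply/eqP; rewrite eq_le; apply/andP; split; apply: le_nrm => //;
by apply: (ae_imp fg) => x ->.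
Qed.

Lemma ip_ae f g h : L2 f -> L2 g -> L2 h -> {ae mu, forall x, f x = g x} ->
  ip f h = ip g h.
Proof.
move=> fL gL hL fg; apply: Itg_ae.
- by apply: measurable_funM; exact: L2_measurable.
- by apply: measurable_funM; exact: L2_measurable.
- by apply: (ae_imp fg) => x ->.
Qed.

Lemma nrm_shift c f : L2 f -> nrm (fun x => f (x + c)) = nrm f.
Proof.
move=> fL; congr Num.sqrt; rewrite [RHS](@Itg_affine _ 1 c)//.
  by rewrite normr1 mul1r; apply: eq_Itg => x; rewrite mul1r.
by apply: measurable_funM; exact: L2_measurable.
Qed.

Lemma L2_shift c f : L2 f -> L2 (fun x => f (x + c)).
Proof.
move=> /(L2_affine c (oner_neq0 _)); by apply: eq_L2 => x; rewrite mul1r.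
Qed.

Lemma Itg_shift c f : measurable_fun setT f -> Itg (fun x => f (x + c)) = Itg f.
Proof.
move=> mf; rewrite [RHS](@Itg_affine _ 1 c)// normr1 mul1r.
by apply: eq_Itg => x; rewrite mul1r.
Qed.

Lemma itg_shift c f : itg f -> itg (fun x => f (x + c)).
Proof.
by move=> /(itg_affine c (oner_neq0 _)); apply: eq_itg => x; rewrite mul1r.
Qed.

End square_integrable.

(** * Averaging kernels *)

Section averaging.
Context {R : realType}.
Local Notation mu := (@lebesgue_measure R).
Local Notation L2 := (@L2 R).
Implicit Types (f g k : R -> R) (s M : R).

Definition averaging_kernel k := [/\ measurable_fun setT k, forall z, 0 <= k z,
  exists M, forall z, k z <= M, itg k & Itg k = 1].

(** For s > 0 this is convolution with the kernel rescaled to width s. Keeping z unscaled allows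
    negative s, so that one definition covers mollifiers, both one-sided exponential averages, and
    increments written as averages of the derivative. *)
Definition avg k s f (x : R) := Itg (fun z => k z * f (x - s * z)).

Lemma kernel_bound k : averaging_kernel k -> exists2 M, 0 <= M & forall z, `|k z| <= M.
Proof.
move=> [_ k0 [M kM] _ _]; exists M; first by rewrite (le_trans (k0 0)).
by move=> z; rewrite ger0_norm.
Qed.

Lemma L2_reflect f s x : s != 0 -> L2 f -> L2 (fun z => f (x - s * z)).
Proof.
move=> s0 fL; have s1 : - s != 0 by rewrite oppr_eq0.
by apply: eq_L2 (L2_affine x s1 fL) => z; congr f; ring.
Qed.

Lemma kernel_L2 k : averaging_kernel k -> L2 k.
Proof.
move=> kk; have [M M0 kM] := kernel_bound kk; have [mk k0 _ ki _] := kk.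
apply/L2P; split => //; apply: (@itg_le _ _ (fun z => M * k z)).
- exact: measurable_funX.
- exact: itgZ.
- by move=> z; rewrite normrX expr2 (ger0_norm (k0 z)) ler_wpM2r// -(ger0_norm (k0 z)).
Qed.

Lemma itg_avg k s f x : averaging_kernel k -> s != 0 -> L2 f ->
  itg (fun z => k z * f (x - s * z)).
Proof.
by move=> kk s0 fL; apply: itgM; [exact: kernel_L2|exact: L2_reflect].
Qed.

Lemma itg_avg_sqr k s f x : averaging_kernel k -> s != 0 -> L2 f ->
  itg (fun z => k z * f (x - s * z) ^+ 2).
Proof.
move=> kk s0 fL; have [M M0 kM] := kernel_bound kk; have [mk k0 _ ki _] := kk.
have fL' := L2_reflect x s0 fL.
apply: (@itg_le _ _ (fun z => M * f (x - s * z) ^+ 2)).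
- by apply: measurable_funM => //; apply: measurable_funX; exact: L2_measurable.
- by apply: itgZ; exact: L2_sqr.
- by move=> z; rewrite normrM normrX -[in leRHS]real_normK ?num_real// ler_wpM2r.
Qed.

(** The variance of z -> f (x - s z) under the probability density [k] is nonnegative. *)
Lemma avg_jensen k s f x : averaging_kernel k -> s != 0 -> L2 f ->
  avg k s f x ^+ 2 <= Itg (fun z => k z * f (x - s * z) ^+ 2).
Proof.
move=> kk s0 fL; have [mk k0 _ ki k1] := kk.
set m := avg k s f x.
have i1 := itg_avg x kk s0 fL; have i2 := itg_avg_sqr x kk s0 fL.
have : 0 <= Itg (fun z => k z * (f (x - s * z) - m) ^+ 2).
  by apply: Itg_ge0 => z; rewrite mulr_ge0// sqr_ge0.
rewrite (@eq_Itg _ _ (fun z => k z * f (x - s * z) ^+ 2 -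
   (2 * m * (k z * f (x - s * z)) - m ^+ 2 * k z))); last by move=> z; ring.
rewrite !ItgB//; [|exact: itgZ|exact: itgZ|by apply: itgB; exact: itgZ].
rewrite !ItgZ// k1 -/(avg k s f x) -/m.
by rewrite (_ : _ - _ = Itg (fun z => k z * f (x - s * z) ^+ 2) - m ^+ 2);
  [rewrite subr_ge0|ring].
Qed.

Lemma measurable_reflect f s : measurable_fun setT f ->
  measurable_fun setT (fun p : R * R => f (p.1 - s * p.2)).
Proof.
move=> mf; apply: (@measurableT_comp _ _ _ _ _ _ f) => //.
apply: measurable_funB => //; apply: measurable_funM => //.
Qed.

Lemma measurable_avg_integrand k s f : measurable_fun setT k ->
  measurable_fun setT f ->
  measurable_fun setT (fun p : R * R => k p.2 * f (p.1 - s * p.2)).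
Proof.
move=> mk mf; apply: measurable_funM; last exact: measurable_reflect.
exact: measurableT_comp.
Qed.

Lemma measurable_Itg (G : R * R -> R) : measurable_fun setT G ->
  (forall p, 0 <= G p) -> measurable_fun setT (fun x => Itg (fun z => G (x, z))).
Proof.
move=> mG G0; apply: (@measurableT_comp _ _ _ _ _ _ (@fine R)) => //.
apply: (@measurable_fun_fubini_tonelli_F _ _ (measurableTypeR R) (measurableTypeR R)
  R mu (EFin \o G)).
- exact/measurable_EFinP.
- by move=> p; rewrite lee_fin.
Qed.

(** Tonelli gives measurability of parameter integrals of nonnegative functions, hence the splitting
    of [f] into positive and negative parts. *)
Lemma measurable_avg k s f : averaging_kernel k -> s != 0 -> L2 f ->
  measurable_fun setT (avg k s f).
Proof.
move=> kk s0 fL; have [mk k0 _ ki _] := kk; have mf := L2_measurable fL.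
pose fp x := Num.max (f x) 0; pose fn x := Num.max (- f x) 0.
have mfp : measurable_fun setT fp by exact: measurable_maxr.
have mfn : measurable_fun setT fn.
  by apply: measurable_maxr => //; exact: measurableT_comp.
have fpL : L2 fp.
  apply: (L2_le_ae mfp fL); apply: aeW => x; rewrite /fp.
  by case: (leP (f x) 0) => h; rewrite ?normr0 ?normr_ge0.
have fnL : L2 fn.
  apply: (L2_le_ae mfn fL); apply: aeW => x; rewrite /fn.
  by case: (leP (- f x) 0) => h; rewrite ?normr0 ?normr_ge0 ?normrN.
have -> : avg k s f = fun x => avg k s fp x - avg k s fn x.
  apply/funext => x; rewrite /avg -ItgB; [|exact: itg_avg..].
  apply: eq_Itg => z; rewrite -mulrBr; congr (_ * _); rewrite /fp /fn.
  set y := f _; case: (leP y 0) => h1; case: (leP (- y) 0) => h2; lra.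
apply: measurable_funB.
- apply: (@measurable_Itg (fun p => k p.2 * fp (p.1 - s * p.2))).
    exact: measurable_avg_integrand.
  by move=> p; rewrite mulr_ge0// /fp le_max lexx orbT.
- apply: (@measurable_Itg (fun p => k p.2 * fn (p.1 - s * p.2))).
    exact: measurable_avg_integrand.
  by move=> p; rewrite mulr_ge0// /fn le_max lexx orbT.
Qed.

Lemma avg_tonelli k s f : averaging_kernel k -> s != 0 -> L2 f ->
  (\int[mu]_x \int[mu]_z (k z * f (x - s * z) ^+ 2)%:E =
   (nrm f ^+ 2)%:E)%E.
Proof.
move=> kk s0 fL; have [mk k0 _ ki k1] := kk.
have mf2 : measurable_fun setT (fun x => f x ^+ 2).
  by apply: measurable_funX; exact: L2_measurable.
have := @fubini_tonelli _ _ _ _ R mu mu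
  (fun p : R * R => (k p.2 * f (p.1 - s * p.2) ^+ 2)%:E).
move=> ->; last 2 first.
- by apply/measurable_EFinP; exact: (measurable_avg_integrand s mk mf2).
- by move=> p; rewrite lee_fin mulr_ge0// sqr_ge0.
rewrite -[X in X%:E]mul1r -k1 mulrC -ItgZ// EFin_Itg; last exact: itgZ.
apply: eq_integral => z _ /=.
have fi := itg_shift (- (s * z)) (L2_sqr fL).
rewrite -EFin_Itg ?ItgZ//; last exact: itgZ.
by rewrite (Itg_shift (- (s * z)) mf2) -nrm_sqrE mulrC.
Qed.

(** Jensen at each x, then Tonelli: the unit mass of [k] makes averaging a contraction of L^2. Every
    bound on [A] below rests on this. *)
Lemma L2_avg_nrm k s f : averaging_kernel k -> s != 0 -> L2 f ->
  L2 (avg k s f) /\ nrm (avg k s f) <= nrm f.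
Proof.
move=> kk s0 fL; have mA := measurable_avg kk s0 fL.
have H : (\int[mu]_x (avg k s f x ^+ 2)%:E <= (nrm f ^+ 2)%:E)%E.
  rewrite -(avg_tonelli kk s0 fL); apply: ge0_le_integral => //.
  - by move=> x _; rewrite lee_fin sqr_ge0.
  - by apply/measurable_EFinP; exact: measurable_funX.
  - apply: (@measurable_fun_fubini_tonelli_F _ _ (measurableTypeR R) (measurableTypeR R)
      R mu (fun p : R * R => (k p.2 * f (p.1 - s * p.2) ^+ 2)%:E)).
      apply/measurable_EFinP.
      have [mk _ _ _ _] := kk.
      apply: (measurable_avg_integrand s mk (f := fun x => f x ^+ 2)).
      by apply: measurable_funX; exact: L2_measurable.
    by have [_ k0 _ _ _] := kk; move=> p; rewrite lee_fin mulr_ge0// sqr_ge0.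
  - move=> x _; rewrite -EFin_Itg; last exact: itg_avg_sqr.
    by rewrite lee_fin; exact: avg_jensen.
have i : itg (fun x => avg k s f x ^+ 2).
  apply/integrableP; split; first by apply/measurable_EFinP; exact: measurable_funX.
  apply: le_lt_trans (ltry (nrm f ^+ 2)); apply: le_trans H.
  rewrite le_eqVlt; apply/orP; left; apply/eqP; apply: eq_integral => x _ /=.
  by rewrite ger0_norm// sqr_ge0.
split; first by apply/L2P.
rewrite -ler_sqr ?nnegrE ?nrm_ge0//.
by rewrite [leLHS]nrm_sqrE -lee_fin EFin_Itg.
Qed.

(** Cauchy-Schwarz in x at fixed z bounds the double integrand by k(z) |f| |g|, which is integrable
    in z, so Fubini applies. *)
Lemma avg_fubini k s f g : averaging_kernel k -> s != 0 -> L2 f -> L2 g ->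
  ip (avg k s f) g = Itg (fun z => k z * ip (fun x => f (x - s * z)) g).
Proof.
move=> kk s0 fL gL; have [mk k0 _ ki k1] := kk.
have mf := L2_measurable fL; have mg := L2_measurable gL.
pose H (p : R * R) := k p.2 * f (p.1 - s * p.2) * g p.1.
have mH : measurable_fun setT (EFin \o H).
  apply/measurable_EFinP; apply: measurable_funM.
    exact: measurable_avg_integrand.
  exact: measurableT_comp.
have fgi z : itg (fun x => f (x - s * z) * g x).
  by apply: itgM => //; exact: (L2_shift (- (s * z))).
have Hz z : itg (fun x => H (x, z)).
  apply: eq_itg (itgZ (k z) (fgi z)) => x; rewrite /H/=; ring.
have iH : (mu \x mu)%E.-integrable setT (EFin \o H).
  apply/integrable21ltyP => //.
  apply: (@le_lt_trans _ _ (\int[mu]_z (k z * (nrm f * nrm g))%:E)%E).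
    apply: ge0_le_integral => //.
    - by move=> z _; exact: integral_ge0.
    - apply: (@measurable_fun_fubini_tonelli_G _ _ (measurableTypeR R) (measurableTypeR R)
        R mu (fun p => `|(EFin \o H) p|%E)) => //.
      exact: measurableT_comp.
    - by apply/measurable_EFinP; exact: measurable_funM.
    - move=> z _ /=.
      rewrite -(EFin_Itg (itg_norm (Hz z))) lee_fin.
      rewrite (@eq_Itg _ _ (fun x => k z * (`|f (x - s * z)| * `|g x|))); last first.
        by move=> x; rewrite /H !normrM (ger0_norm (k0 z)) mulrA.
      have nf : L2 (fun x => `|f (x - s * z)|).
        have sL := L2_shift (- (s * z)) fL.
        apply: (L2_le_ae _ sL); last by apply: aeW => x; rewrite normr_id.
        by apply: measurableT_comp => //; exact: L2_measurable.
      have ng : L2 (fun x => `|g x|).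
        apply: (L2_le_ae _ gL); last by apply: aeW => x; rewrite normr_id.
        exact: measurableT_comp.
      rewrite ItgZ; last exact: itgM.
      rewrite ler_wpM2l//; apply: le_trans (le_ip_nrm nf ng) _.
      have <- : nrm (fun x => f (x - s * z)) = nrm f by exact: nrm_shift.
      apply: ler_pM; rewrite ?nrm_ge0//; apply: le_nrm => //; try
        by apply: aeW => x; rewrite normr_id.
      exact: (L2_shift (- (s * z))).
  have i : itg (fun z => k z * (nrm f * nrm g)).
    by apply: eq_itg (itgZ (nrm f * nrm g) ki) => z; rewrite mulrC.
  by rewrite -EFin_Itg// ltry.
have := Fubini iH.
rewrite /ip /Itg /Rintegral => HF.
transitivity (fine (\int[mu]_x \int[mu]_z (EFin \o H) (x, z))%E).
  congr fine; apply: eq_integral => x _.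
  rewrite /avg -[LHS]/((Itg (fun z => k z * f (x - s * z)) * g x)%:E).
  rewrite mulrC -ItgZ; last exact: itg_avg.
  rewrite EFin_Itg; last by apply: itgZ; exact: itg_avg.
  by apply: eq_integral => z _; congr EFin; rewrite /H/=; ring.
rewrite HF; congr fine; apply: eq_integral => z _.
rewrite -(EFin_Itg (Hz z)) -[RHS]/((k z * Itg (fun x => f (x - s * z) * g x))%:E).
by rewrite -ItgZ//; congr EFin; apply: eq_Itg => x; rewrite /H/=; ring.
Qed.

Lemma avg_adjoint k s f g : averaging_kernel k -> s != 0 -> L2 f -> L2 g ->
  ip (avg k s f) g = ip f (avg k (- s) g).
Proof.
move=> kk s0 fL gL; have s1 : - s != 0 by rewrite oppr_eq0.
rewrite (ipC f) (avg_fubini kk s0 fL gL) (avg_fubini kk s1 gL fL).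
apply: eq_Itg => z; congr (_ * _).
have mfg : measurable_fun setT (fun x : R => f (x - s * z) * g x).
  by apply: measurable_funM; [exact: (L2_measurable (L2_shift (- (s * z)) fL))|exact: L2_measurable].
rewrite /ip -(Itg_shift (s * z) mfg); apply: eq_Itg => x.
by rewrite addrK mulrC; congr (g _ * _); ring.
Qed.

Lemma avgD k s f g x : averaging_kernel k -> s != 0 -> L2 f -> L2 g ->
  avg k s (fun x => f x + g x) x = avg k s f x + avg k s g x.
Proof.
move=> kk s0 fL gL; rewrite /avg -ItgD; [|exact: itg_avg..].
by apply: eq_Itg => z; rewrite mulrDr.
Qed.

Lemma avgZ k s f c x : averaging_kernel k -> s != 0 -> L2 f ->
  avg k s (fun x => c * f x) x = c * avg k s f x.
Proof.
move=> kk s0 fL; rewrite /avg -ItgZ; last exact: itg_avg.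
by apply: eq_Itg => z; ring.
Qed.

End averaging.

(** * Strong convergence in L^2 and Lebesgue points *)

Section strong_convergence.
Context {R : realType}.
Local Notation mu := (@lebesgue_measure R).
Local Notation L2 := (@L2 R).
Implicit Types (f g k : R -> R) (s M : R).

Lemma limn_einf_near (u : (\bar R)^nat) (a : \bar R) : (a < limn_einf u)%E ->
  \forall n \near \oo, (a < u n)%E.
Proof.
rewrite limn_einf_lim => al.
have /cvg_lim := @cvg_einfs_sup _ u; move=> E.
rewrite E// in al.
have [_ [n _ <-] an] := ereal_sup_gt al.
exists n => // m /= nm; apply: lt_le_trans an _.
by apply: ereal_inf_lbound; exists m.
Qed.

(* By Fatou, liminf |g_n + g| >= 2 |g|, and the parallelogram identity then
   forces |g_n - g| -> 0. *)
Lemma L2_strong_cvg (g_ : (R -> R)^nat) g :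
  (forall n, L2 (g_ n)) -> L2 g -> (forall n, nrm (g_ n) <= nrm g) ->
  {ae mu, forall x, g_ n x @[n --> \oo] --> g x} ->
  nrm (fun x => g_ n x - g x) @[n --> \oo] --> 0.
Proof.
move=> gnL gL gn cvg_g.
pose N n := nrm (fun x => g_ n x + g x) ^+ 2.
have dL n : L2 (fun x => g_ n x + g x) by exact: L2D.
have bL n : L2 (fun x => g_ n x - g x) by exact: L2B.
have par n : N n + nrm (fun x => g_ n x - g x) ^+ 2 =
    2 * nrm (g_ n) ^+ 2 + 2 * nrm g ^+ 2.
  rewrite /N !nrm_sqr (ipBl _ gL) // !(ipBr _ gL)// (ipDl _ gL)// !(ipDr _ gL)// (ipC g); ring.
have fat : ((4 * nrm g ^+ 2)%:E <= limn_einf (fun n => (N n)%:E))%E.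
  have := @fatou _ _ R mu setT measurableT
    (fun n x => ((g_ n x + g x) ^+ 2)%:E).
  have mgn n : measurable_fun setT (fun x => ((g_ n x + g x) ^+ 2)%:E).
    by apply/measurable_EFinP; apply: measurable_funX; exact: L2_measurable.
  move=> /(_ mgn) F;
  have F0 : forall n x, setT x -> (0 <= ((g_ n x + g x) ^+ 2)%:E)%E.
    by move=> n x _; rewrite lee_fin sqr_ge0.
  have {}F := F F0.
  have -> : (fun n => (N n)%:E) = (fun n => \int[mu]_x ((g_ n x + g x) ^+ 2)%:E)%E.
    by apply/funext => n; rewrite /N nrm_sqrE EFin_Itg//; exact: L2_sqr.
  apply: le_trans F.
  have i4 : itg (fun x => 4 * g x ^+ 2) by apply: itgZ; exact: L2_sqr.
  rewrite nrm_sqrE -ItgZ; last exact: L2_sqr.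
  rewrite EFin_Itg// le_eqVlt; apply/orP; left; apply/eqP.
  apply: ae_eq_integral => //.
  - by apply/measurable_EFinP; exact: itg_measurable.
  - rewrite (_ : (fun x => _) = fun x => limn (einfs (fun n => ((g_ n x + g x) ^+ 2)%:E))); last first.
      by apply/funext => x; rewrite limn_einf_lim.
    apply: (emeasurable_fun_cvg (fun n x => einfs (fun n => ((g_ n x + g x) ^+ 2)%:E) n)).
      by move=> n; exact: measurable_fun_einfs.
    by move=> x _; exact: is_cvg_einfs.
  - apply: (ae_imp cvg_g) => x cx _.
    have c2 : ((g_ n x + g x) ^+ 2)%:E @[n --> \oo] --> (4 * g x ^+ 2)%:E.
      apply: cvg_EFin; first exact: nearW.
      rewrite (_ : 4 * g x ^+ 2 = (g x + g x) * (g x + g x)); last by ring.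
      rewrite (_ : fine \o _ = fun n => (g_ n x + g x) * (g_ n x + g x)); last first.
        by apply/funext => n /=; rewrite expr2.
      by apply: cvgM; apply: cvgD => //; exact: cvg_cst.
    rewrite is_cvg_limn_einfE; first by apply/esym/cvg_lim.
    by apply/cvg_ex; eexists; exact: c2.
apply/cvgrPdist_lt => e e0.
have e2 : 0 < e ^+ 2 by rewrite exprn_gt0.
have lt1 : ((4 * nrm g ^+ 2 - e ^+ 2)%:E < limn_einf (fun n => (N n)%:E))%E.
  by apply: lt_le_trans fat; rewrite lte_fin; lra.
have := limn_einf_near lt1; apply: filterS => n; rewrite lte_fin => H.
rewrite sub0r normrN (ger0_norm (nrm_ge0 _)) -ltr_sqr ?nnegrE ?nrm_ge0 ?(ltW e0)//.
have h1 : nrm (g_ n) ^+ 2 <= nrm g ^+ 2 by rewrite ler_sqr ?nnegrE ?nrm_ge0.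
have := par n; lra.
Qed.

Lemma itg_indic (A : set R) : measurable A -> (mu A < +oo)%E -> itg (\1_A : R -> R).
Proof.
move=> mA Ay; apply/integrableP; split.
  exact/measurable_EFinP.
rewrite (_ : (\int[mu]_x _ = \int[mu]_x (\1_A x)%:E)%E); last first.
  by apply: eq_integral => x _ /=; rewrite ger0_norm.
by rewrite integral_indic// setIT.
Qed.

Lemma L2_indic (A : set R) : measurable A -> (mu A < +oo)%E -> L2 (\1_A : R -> R).
Proof.
move=> mA Ay; apply/L2P; split => //.
apply: eq_itg (itg_indic mA Ay) => x.
by rewrite indicE; case: (x \in A); rewrite ?expr1n// expr0n.
Qed.

Lemma L2_locally_integrable f : L2 f -> locally_integrable setT f.
Proof.
move=> fL; split; [exact: L2_measurable|exact: openT|move=> K _ cK].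
have mK := compact_measurable cK.
have Ky : (mu K < +oo)%E by exact: compact_finite_measure.
have KL := L2_indic mK Ky.
have i : itg (fun x => \1_K x * `|f x|).
  apply: itgM => //; apply: (L2_le_ae _ fL); last by apply: aeW => x; rewrite normr_id.
  by apply: measurableT_comp => //; exact: L2_measurable.
rewrite (_ : (\int[mu]_(x in K) _)%E = (\int[mu]_x (\1_K x * `|f x|)%:E)%E).
  by rewrite -EFin_Itg// ltry.
rewrite integral_mkcond; apply: eq_integral => x _.
rewrite patchE indicE; case: (x \in K); by rewrite ?mul1r ?mul0r.
Qed.

(** With [k] bounded by M and supported in |z| < 1, the error at x is at most 2 M times the mean of
    |f - f x| over the ball of radius 1/(n+1), which vanishes in the limit at a Lebesgue point. *)
Lemma avg_lebesgue_pt k f x : averaging_kernel k -> (forall z, 1 <= `|z| -> k z = 0) ->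
  L2 f -> lebesgue_pt f x -> avg k n.+1%:R^-1 f x @[n --> \oo] --> f x.
Proof.
move=> kk ksupp fL fx; have [M M0 kM] := kernel_bound kk.
have [mk k0 _ ki k1] := kk.
have mf := L2_measurable fL.
pose A r : set R := ball x r.
have AE r : A r = `]x - r, x + r[%classic by rewrite /A ball_itv.
have mA r : measurable (A r) by rewrite AE; exact: measurable_itv.
have Amu r : 0 < r -> mu (A r) = (r *+ 2)%:E.
  move=> r0; rewrite AE lebesgue_measure_itv/= lte_fin ifT.
    by rewrite -EFinB; congr EFin; rewrite mulr2n; ring.
  by rewrite ltrD2l gt0_cp.
have Ay r : 0 < r -> (mu (A r) < +oo)%E by move=> r0; rewrite Amu// ltry.
have gi r : 0 < r -> itg (fun y => \1_(A r) y * `|f y - f x|).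
  move=> r0; have IL := L2_indic (mA r) (Ay r r0).
  apply: (@itg_le _ _ (fun y => `|\1_(A r) y * f y| + `|f x| * \1_(A r) y)).
  - by apply: measurable_funM => //; apply: measurableT_comp => //; exact: measurable_funB.
  - apply: itgD; first by apply: itg_norm; exact: itgM.
    by apply: itgZ; exact: (itg_indic (mA r) (Ay r r0)).
  - move=> y; rewrite normrM normr_id normrM [in leRHS](mulrC `|f x|).
    rewrite -[X in _ + X * _](ger0_norm (_ : 0 <= \1_(A r) y)).
      by rewrite -mulrDr ler_wpM2l// ler_normB.
    by rewrite indicE; case: (_ \in _).
have davgE r : 0 < r -> davg f x r =
    ((r *+ 2)^-1 * Itg (fun y => \1_(A r) y * `|f y - f x|))%:E.
  move=> r0; rewrite /davg /iavg Amu// inver mulrn_eq0/= gt_eqF// EFinM EFin_Itg; last exact: gi.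
  congr (_ * _)%E; rewrite integral_mkcond; apply: eq_integral => y _.
  by rewrite patchE indicE /=; case: (y \in _); rewrite ?mul1r ?mul0r.
have bound n : `|avg k n.+1%:R^-1 f x - f x| <= 2 * M * fine (davg f x n.+1%:R^-1).
  set s := n.+1%:R^-1; have s0 : 0 < s by rewrite invr_gt0.
  have sn : s != 0 by rewrite gt_eqF.
  have ik := itg_avg x kk sn fL.
  have -> : avg k s f x - f x = Itg (fun z => k z * f (x - s * z) - f x * k z).
    by rewrite ItgB//; [rewrite ItgZ// k1 mulr1|exact: itgZ].
  apply: le_trans (le_norm_Itg _) _; first by apply: itgB => //; exact: itgZ.
  rewrite davgE//= mulrA.
  rewrite [X in _ <= _ * X](@Itg_affine _ (- s) x); last 2 first.
    by rewrite oppr_eq0.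
    exact: itg_measurable (gi _ s0).
  rewrite normrN (gtr0_norm s0) mulrA.
  have -> : 2 * M / (s *+ 2) * s = M by rewrite -mulr_natl; field.
  have gi' := itg_affine x (_ : - s != 0) (gi _ s0).
  rewrite -ItgZ; last by apply: gi'; rewrite oppr_eq0.
  apply: le_Itg.
  - by apply: itg_norm; apply: itgB => //; exact: itgZ.
  - by apply: itgZ; apply: gi'; rewrite oppr_eq0.
  - move=> z; rewrite [f x * k z]mulrC -mulrBr normrM indicE.
    rewrite (_ : - s * z + x = x - s * z); last by ring.
    have [z1|z1] := leP 1 `|z|.
      by rewrite ksupp// normr0 mul0r mulr_ge0// mulr_ge0//; case: (_ \in _).
    rewrite (_ : (x - s * z \in A s)); first by rewrite mul1r ler_wpM2r.
    rewrite inE /A /ball/= opprB addrCA subrr addr0 normrM (gtr0_norm s0).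
    by rewrite gtr_pMr.
apply/cvgrPdist_lt => e e0.
have h0 : fine (davg f x n.+1%:R^-1) @[n --> \oo] --> (0 : R).
  have /fine_cvgP[_ fx'] := fx.
  have inv0 : (n.+1%:R^-1 : R) @[n --> \oo] --> (0 : R)^'+.
    move=> P [d /= d0 dP]; have := @cvg_harmonic R => /cvgrPdist_lt/(_ _ d0).
    by apply: filterS => n nd; apply: dP => //=; rewrite invr_gt0.
  exact: (cvg_comp _ _ inv0 fx').
move/cvgrPdist_lt : h0 => /(_ (e / (2 * M + 1))).
have M1 : 0 < 2 * M + 1 by rewrite ltr_wpDl// mulr_ge0.
rewrite divr_gt0// => /(_ isT); apply: filterS => n.
rewrite sub0r normrN distrC => H; apply: le_lt_trans (bound n) _.
have d0 : 0 <= fine (davg f x n.+1%:R^-1) by rewrite fine_ge0// davg_ge0.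
rewrite ger0_norm// ltr_pdivlMr// in H.
apply: le_lt_trans H; rewrite mulrC ler_wpM2l//; lra.
Qed.

End strong_convergence.

(** * Test functions and mollification *)

Section test_functions_real.
Context {R : realType}.
Local Notation mu := (@lebesgue_measure R).
Local Notation L2 := (@L2 R).
Implicit Types (f g h k phi : R -> R) (r s : R).

Definition csupp f := exists r, forall x, r <= `|x| -> f x = 0.

Lemma csupp_pos f : csupp f -> exists2 r, 0 < r & forall x, r <= `|x| -> f x = 0.
Proof.
move=> [r fr]; exists (`|r| + 1); first by rewrite ltr_wpDl.
move=> x rx; apply: fr; apply: le_trans rx; have := ler_norm r; lra.
Qed.

Lemma test_csupp phi : test_function phi -> csupp phi.
Proof.
move=> [_ /compact_bounded[M [_ HM]]]; exists (`|M| + 2) => x Mx.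
apply/eqP/negP => /negP px.
have /= := HM (`|M| + 1) (le_lt_trans (ler_norm M) (_ : `|M| < `|M| + 1)).
rewrite ltrDl ltr01 => /(_ isT x) H.
have : `|x| <= `|M| + 1 by apply: H; apply: subset_closure.
lra.
Qed.

Lemma csupp_test phi : smooth phi -> csupp phi -> test_function phi.
Proof.
move=> sphi [r fr]; split => //.
apply: (@subclosed_compact _ _ `[- r, r]).
- exact: closed_closure.
- exact: segment_compact.
- have <- : closure `[- r, r]%classic = `[- r, r]%classic.
    by apply/esym/closure_id; exact: interval_closed.
  apply: closure_subset => x /= px; rewrite in_itv/= -ler_norml leNgt.
  by apply/negP => rx; move: px; rewrite fr ?eqxx// ltW.
Qed.

Lemma test_smooth phi : test_function phi -> smooth phi.
Proof. by case. Qed.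

Lemma csupp_derive1 f : csupp f -> csupp f^`()%classic.
Proof.
move=> [r fr]; exists (r + 1) => x rx.
rewrite derive1E (@near_eq_derive _ _ _ f (cst 0)) ?derive_cst//.
have d : 0 < `|x| - r by lra.
near=> y; rewrite /= fr//.
have : `|x - y| < `|x| - r by near: y; exact: cvgr_dist_lt.
have := ler_distD y x 0; rewrite !subr0; lra.
Unshelve. all: end_near. Qed.

Lemma test_derive1 phi : test_function phi -> test_function phi^`()%classic.
Proof.
move=> tphi; apply: csupp_test; first exact/smooth_derive1/test_smooth.
exact/csupp_derive1/test_csupp.
Qed.

Lemma test_affine phi (a c : R) : a != 0 -> test_function phi ->
  test_function (fun x : R => phi (a * x + c)).
Proof.
move=> a0 tphi; apply: csupp_test; first exact/smooth_affine/test_smooth.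
have [r r0 pr] := csupp_pos (test_csupp tphi).
exists ((r + `|c|) / `|a|) => x; rewrite ler_pdivrMr ?normr_gt0// => H.
apply: pr; rewrite mulrC -normrM in H.
have := ler_normB (a * x + c) c; rewrite addrK; lra.
Qed.

Lemma testM phi f : test_function phi -> smooth f -> test_function (phi * f).
Proof.
move=> tphi sf; apply: csupp_test; first by apply: smoothM => //; exact: test_smooth.
have [r pr] := test_csupp tphi; exists r => x /pr.
by rewrite -[(phi * f) x]/(phi x * f x) => ->; rewrite mul0r.
Qed.

Lemma testZ c phi : test_function phi -> test_function (c *: phi).
Proof.
move=> tphi; apply: csupp_test; first by apply: smoothZ => //; exact: test_smooth.
have [r pr] := test_csupp tphi; exists r => x /pr.
by rewrite -[(c *: phi) x]/(c * phi x) => ->; rewrite mulr0.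
Qed.

Lemma csupp_bounded f : continuous f -> csupp f -> exists M, forall x, `|f x| <= M.
Proof.
move=> cf /csupp_pos[r r0 fr].
have cnf : {within `[- r, r], continuous (fun x => `|f x|)}.
  apply: continuous_subspaceT => x; apply: (@continuous_comp _ _ _ f (fun z => `|z|)).
    exact: cf.
  exact: norm_continuous.
have rr : - r <= r by lra.
have [c _ Hc] := EVT_max rr cnf.
exists `|f c| => x; have [xr|xr] := leP `|x| r.
  by apply: Hc; rewrite in_itv/= -ler_norml.
by rewrite fr ?normr0// ltW.
Qed.

Lemma continuous_measurable f : continuous f -> measurable_fun setT f.
Proof. exact: continuous_measurable_fun. Qed.

Lemma csupp_L2 f : continuous f -> csupp f -> L2 f.
Proof.
move=> cf sf; have [M fM] := csupp_bounded cf sf.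
have [r r0 fr] := csupp_pos sf.
have iL : L2 (\1_(`[- r, r]) : R -> R).
  by apply: L2_indic => //; rewrite lebesgue_measure_itv/=; case: ifP => _; rewrite -?EFinB ltry.
apply: (@L2_le_ae _ _ (fun x => M * \1_(`[- r, r]) x)).
- exact: continuous_measurable.
- exact: L2Z.
- apply: aeW => x; rewrite indicE mem_setE in_itv/= -ler_norml.
  have [xr|xr] := leP `|x| r; last by rewrite fr ?normr0// ltW.
  by rewrite mulr1; apply: le_trans (ler_norm M).
Qed.

Lemma csupp_itg f : continuous f -> csupp f -> itg f.
Proof.
move=> cf sf; have fL := csupp_L2 cf sf; have [r r0 fr] := csupp_pos sf.
have iL : L2 (\1_(`[- r, r]) : R -> R).
  by apply: L2_indic => //; rewrite lebesgue_measure_itv/=; case: ifP => _; rewrite -?EFinB ltry.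
apply: eq_itg (itgM fL iL) => x; rewrite indicE mem_setE in_itv/= -ler_norml.
by have [xr|xr] := leP `|x| r; [rewrite mulr1|rewrite mulr0 fr// ltW].
Qed.

Lemma test_L2 phi : test_function phi -> L2 phi.
Proof.
move=> tphi; apply: csupp_L2; last exact: test_csupp.
exact/smooth_continuous/test_smooth.
Qed.

Lemma test_L2' phi : test_function phi -> L2 phi^`()%classic.
Proof. by move=> /test_derive1/test_L2. Qed.

Lemma test_bounded phi : test_function phi -> exists M, forall x, `|phi x| <= M.
Proof.
move=> tphi; apply: csupp_bounded; last exact: test_csupp.
exact/smooth_continuous/test_smooth.
Qed.

Lemma ftc (F f : R -> R) (x y : R) : x <= y -> continuous f ->
  (forall z : R, is_derive z (1 : R) F (f z)) ->
  \int[mu]_(z in `[x, y]) f z = F y - F x.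
Proof.
rewrite le_eqVlt => /predU1P[<-|xy] cf dF.
  by rewrite set_itv1 Rintegral_set1 subrr.
have dFz z : derivable F z 1 by have [] := dF z.
have cF : continuous F.
  by move=> z; apply: differentiable_continuous; exact/derivable1_diffP.
rewrite /Rintegral (@continuous_FTC2 _ f F)//.
- exact: continuous_subspaceT.
- split; [by move=> z _|exact: cvg_at_right_filter (cF x)|exact: cvg_at_left_filter (cF y)].
- by move=> z _; rewrite derive1E; have [_] := dF z.
Qed.

Lemma Itg_set (A : set R) f : \int[mu]_(z in A) f z = Itg (fun z => \1_A z * f z).
Proof.
rewrite Rintegral_mkcond; apply: eq_Itg => x.
by rewrite patchE indicE; case: (x \in A); rewrite ?mul1r ?mul0r.
Qed.

Lemma Itg_derive_csupp (F f : R -> R) : continuous f -> csupp F -> csupp f ->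
  (forall z : R, is_derive z (1 : R) F (f z)) -> Itg f = 0.
Proof.
move=> cf /csupp_pos[r1 r10 Fr] /csupp_pos[r2 r20 fr] dF.
set r := Num.max r1 r2; have r0 : 0 < r by rewrite lt_max r10.
have h1 : r1 <= r by rewrite le_max lexx.
have h2 : r2 <= r by rewrite le_max lexx orbT.
have := ftc (_ : - r <= r) cf dF; rewrite lerNl (le_trans _ (ltW r0)) ?oppr_le0 ?(ltW r0)//.
move=> /(_ isT); rewrite !Fr ?normrN ?(gtr0_norm r0)// subrr Itg_set => <-.
apply: eq_Itg => x; rewrite indicE mem_setE in_itv/= -ler_norml.
by have [xr|xr] := leP `|x| r; [rewrite mul1r|rewrite mul0r fr// (le_trans h2)// ltW].
Qed.

End test_functions_real.

Section mollifier.
Context {R : realType}.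
Local Notation mu := (@lebesgue_measure R).
Local Notation L2 := (@L2 R).
Implicit Types (f g h k phi : R -> R) (r s : R).

Lemma bump0_test : test_function (@bump0 R).
Proof.
apply: csupp_test; first exact: bump0_smooth.
by exists 1 => x; exact: bump0_out.
Qed.

Lemma bump0_itg : itg (@bump0 R).
Proof.
apply: csupp_itg; first exact/smooth_continuous/bump0_smooth.
exact: test_csupp bump0_test.
Qed.

Lemma Itg_bump0 : 0 < Itg (@bump0 R).
Proof.
rewrite lt_neqAle Itg_ge0 ?andbT; last exact: bump0_ge0.
apply/eqP => I0.
(* The square root turns the integral into an L^2 norm. Its vanishing would make [bump0] zero almost
   everywhere, whereas it is positive on an interval of length 2. *)
have : nrm (fun x => Num.sqrt (@bump0 R x)) = 0.
  rewrite /nrm (_ : ip _ _ = 0) ?sqrtr0//.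
  by rewrite [RHS]I0; apply: eq_Itg => x; rewrite -expr2 sqr_sqrtr// bump0_ge0.
have sL : L2 (fun x => Num.sqrt (@bump0 R x)).
  have cs : continuous (fun x => Num.sqrt (@bump0 R x)).
    move=> x; apply: (@continuous_comp _ _ _ (@bump0 R) Num.sqrt).
      exact/smooth_continuous/bump0_smooth.
    exact: sqrt_continuous.
  apply: csupp_L2 => //.
  by exists 1 => x /bump0_out ->; rewrite sqrtr0.
move=> /(nrm0_ae sL)[N [mN N0 NS]].
pose J : set R := `](-1), 1[%classic.
have : (mu J <= mu N)%E.
  apply: le_measure; rewrite ?inE//; first exact: measurable_itv.
  move=> x; rewrite /J/= in_itv/= -ltr_norml => x1; apply: NS => /= /eqP.
  by rewrite sqrtr_eq0 leNgt bump0_gt0.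
rewrite N0 /J lebesgue_measure_itv/= lte_fin ifT; last by lra.
by rewrite -EFinB lee_fin; lra.
Qed.

(** [rho] has unit mass and serves as averaging kernel; [zeta] has value 1 at 0 and serves, once
    dilated, as a cutoff at infinity. *)
Definition rho : R -> R := (Itg (@bump0 R))^-1 *: (@bump0 R).
Definition zeta : R -> R := (bump0 (0 : R))^-1 *: (@bump0 R).

Lemma rho_test : test_function rho.
Proof. exact/testZ/bump0_test. Qed.

Lemma zeta_test : test_function zeta.
Proof. exact/testZ/bump0_test. Qed.

Lemma rho_out z : 1 <= `|z| -> rho z = 0.
Proof.
by move=> z1; rewrite -[rho z]/((Itg (@bump0 R))^-1 * bump0 z) bump0_out// mulr0.
Qed.

Lemma rho_kernel : averaging_kernel rho.
Proof.
split.
- exact: L2_measurable (test_L2 rho_test).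
- move=> z; rewrite -[rho z]/((Itg (@bump0 R))^-1 * bump0 z).
  by rewrite mulr_ge0 ?bump0_ge0// invr_ge0 ltW// Itg_bump0.
- by have [M HM] := test_bounded rho_test; exists M => z; rewrite (le_trans _ (HM z))// ler_norm.
- exact: itgZ bump0_itg.
- rewrite -[LHS]/(Itg (fun z => (Itg (@bump0 R))^-1 * bump0 z)).
  by rewrite (ItgZ _ bump0_itg) mulVf// gt_eqF// Itg_bump0.
Qed.

Lemma zeta0 : zeta 0 = 1.
Proof.
rewrite -[zeta 0]/((bump0 (0 : R))^-1 * bump0 0) mulVf// gt_eqF// bump0_gt0//.
by rewrite normr0.
Qed.

(** On ]-1, 1[ the exponent is - (1/(1+x) + 1/(1-x)). The tangent line bound 1/p >= 2 - p shows that
    the sum is at least 2, its value at 0. *)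
Lemma bump0_max x : bump0 x <= bump0 (0 : R).
Proof.
have [x1|x1] := leP 1 `|x|; first by rewrite bump0_out// bump0_ge0.
have /andP[h1 h2] : (-1 < x) && (x < 1) by rewrite -ltr_norml.
rewrite /bump0 /flat !mulr0 !add0r ltr01 !ifT; [|lra..].
have e1 z : (1 : {poly R}).[z] = 1 by rewrite hornerE.
rewrite !e1 !mul1r invr1 -!expRD ler_expR.
have inv_ge (p : R) : 0 < p -> 2 - p <= p^-1.
  move=> p0; rewrite -[p^-1]mul1r ler_pdivlMr//.
  have := sqr_ge0 (p - 1); nra.
have := inv_ge (x + 1); have := inv_ge (-1 * x + 1).
have -> : 0 < x + 1 by lra.
have -> : 0 < -1 * x + 1 by lra.
move=> /(_ isT) i1 /(_ isT) i2; lra.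
Qed.

Lemma zeta_le1 x : `|zeta x| <= 1.
Proof.
have b0 : 0 < bump0 (0 : R) by rewrite bump0_gt0// normr0.
rewrite -[zeta x]/((bump0 (0 : R))^-1 * bump0 x) ger0_norm.
  by rewrite ler_pdivrMl// mulr1 bump0_max.
by rewrite mulr_ge0 ?bump0_ge0// invr_ge0 ltW.
Qed.

Lemma avg_conv k s f x : s != 0 -> measurable_fun setT k -> measurable_fun setT f ->
  avg k s f x = `|s|^-1 * Itg (fun y => k (s^-1 * (x - y)) * f y).
Proof.
move=> s0 mk mf.
have s1 : - s != 0 by rewrite oppr_eq0.
rewrite (@Itg_affine _ (- s) x) //.
  rewrite normrN mulrA mulVf ?normr_eq0// mul1r; apply: eq_Itg => z.
  by congr (k _ * f _); field.
apply: measurable_funM => //; apply: measurableT_comp => //.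
by apply: measurable_funM => //; exact: measurable_funB.
Qed.

Lemma test_conv k s x : s != 0 -> test_function k ->
  test_function (fun y : R => k (s^-1 * (x - y))).
Proof.
move=> s0 tk; have := @test_affine _ k (- s^-1) (s^-1 * x) (_ : - s^-1 != 0) tk.
rewrite oppr_eq0 invr_eq0 => /(_ s0).
by congr test_function; apply/funext => y; congr k; ring.
Qed.

Lemma avg_derive k s f (x : R) : test_function k -> s != 0 -> L2 f ->
  is_derive x (1 : R) (avg k s f) (s^-1 * avg k^`()%classic s f x).
Proof.
move=> tk s0 fL; have tk' := test_derive1 tk.
have mf := L2_measurable fL.
have mk := L2_measurable (test_L2 tk); have mk' := L2_measurable (test_L2 tk').
pose g (x y : R) := k (s^-1 * (x - y)) * f y.
have gi x' : itg (g x') by apply: itgM => //; exact/test_L2/test_conv.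
have dg x' y : is_derive (x' : R) (1 : R) (fun z => g z y) (s^-1 * (k^`()%classic (s^-1 * (x' - y)) * f y)).
  have d1 : is_derive (x' : R) (1 : R) (fun z : R => k (s^-1 * (z - y)))
      (s^-1 * k^`()%classic (s^-1 * (x' - y))).
    have E : (fun z : R => k (s^-1 * (z - y))) = (fun z : R => k (s^-1 * z + - (s^-1 * y))).
      by apply/funext => z; congr k; ring.
    have sm := smooth_affine s^-1 (- (s^-1 * y)) (test_smooth tk).
    rewrite E; apply: (is_derive_eq (smooth_is_derive _ sm)).
    rewrite derive1_affine; last by move=> z; exact/smooth_derivable/test_smooth.
    by congr (_ * k^`()%classic _); ring.
  have := is_deriveM d1 (is_derive_cst (f y) x' (1 : R)) => H.
  apply: (is_derive_eq H); rewrite /GRing.scale/= mulr0 add0r; ring.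
have [M HM] := test_bounded tk'.
have [r r0 kr] := csupp_pos (test_csupp tk').
(* [B] contains every y at which k' ((x' - y)/s) is nonzero for some x' within 1 of x, so the
   dominating function [G] is uniform in x'. *)
pose B : set R := `[x - 1 - `|s| * r, x + 1 + `|s| * r]%classic.
have BL : L2 (\1_B : R -> R).
  apply: L2_indic; first exact: measurable_itv.
  rewrite /B lebesgue_measure_itv/=; case: ifP => _;
  by rewrite -?EFinB ltry.
pose G y := `|s|^-1 * M * (\1_B y * `|f y|).
have fnL : L2 (fun y => `|f y|).
  apply: (L2_le_ae _ fL); last by apply: aeW => z; rewrite normr_id.
  exact: measurableT_comp.
have Gi : itg G by apply: itgZ; exact: itgM.
have M0 : 0 <= M by apply: le_trans (HM 0).
have Ix : `](x - 1), (x + 1)[%classic x by rewrite /= in_itv/=; lra.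
have G0 y : 0 <= G y.
  by rewrite !mulr_ge0// ?invr_ge0// indicE; case: (_ \in _).
have dbl x' y : `](x - 1), (x + 1)[%classic x' -> setT y ->
    `|partial1of2 g x' y| <= G y.
  move=> /=; rewrite in_itv/= => /andP[h1 h2] _.
  rewrite partial1of2E; have [_ ->] := dg x' y.
  rewrite !normrM normfV /G -mulrA ler_wpM2l ?invr_ge0//.
  rewrite mulrA ler_wpM2r//.
  rewrite indicE; have [yB|] := boolP (y \in B); first by rewrite mulr1.
  move=> yB; rewrite mulr0 kr ?normr0//.
  rewrite normrM normfV ler_pdivlMl ?normr_gt0// leNgt; apply/negP.
  rewrite ltr_distlC => /andP[h3 h4]; move/negP: yB; apply.
  by rewrite mem_setE in_itv/=; apply/andP; split; lra.
have H := @cvg_differentiation_under_integral _ _ _ mu g setT measurableT x (x - 1) (x + 1)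
  Ix (fun z _ => gi z) (fun z y _ _ => proj1 (let: DeriveDef p q := dg z y in conj p q))
  G G0 Gi dbl.
have avgE : avg k s f = fun z => `|s|^-1 * Itg (g z).
  by apply/funext => z; rewrite avg_conv.
have dF : is_derive x (1 : R) (fun z => Itg (g z)) (Itg (fun y => s^-1 * (k^`()%classic (s^-1 * (x - y)) * f y))).
  have E : \int[mu]_(y in setT) partial1of2 g x y =
      Itg (fun y => s^-1 * (k^`()%classic (s^-1 * (x - y)) * f y)).
    by apply: eq_Itg => y; rewrite partial1of2E; have [_ ->] := dg x y.
  rewrite E in H.
  have H' : h^-1 *: (Itg (g (h *: (1 : R) + x)) - Itg (g x)) @[h --> 0^'] -->
      Itg (fun y => s^-1 * (k^`()%classic (s^-1 * (x - y)) * f y)).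
    by under eq_fun do rewrite /GRing.scale/= mulr1; exact: H.
  apply: DeriveDef; first by apply/cvg_ex; eexists; exact: H'.
  exact/cvg_lim.
rewrite avgE; apply: (is_derive_eq (is_deriveZ _ dF)).
rewrite /GRing.scale/= avg_conv// ItgZ; first by ring.
by apply: itgM => //; exact/test_L2/test_conv.
Qed.

Lemma avg_smooth k s f : test_function k -> s != 0 -> L2 f -> smooth (avg k s f).
Proof.
move=> tk s0 fL.
apply: (@smooth_family1 _ (fun g => exists c k, test_function k /\ g = c *: avg k s f)).
- move=> _ [c [k' [tk' ->]]] x; apply: derivableZ.
  by have [] := avg_derive x tk' s0 fL.
- move=> _ [c [k' [tk' ->]]]; exists (c * s^-1), (k'^`()%classic).
  split; first exact: test_derive1.
  apply/funext => x; have [d1 d2] := avg_derive x tk' s0 fL.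
  by rewrite derive1E deriveZ// d2 /GRing.scale/= mulrA.
- by exists 1, k; rewrite scale1r.
Qed.

End mollifier.

Section L2_convergence.
Context {R : realType}.
Local Notation mu := (@lebesgue_measure R).
Local Notation L2 := (@L2 R).
Implicit Types (f g h : R -> R) (u v : (R -> R)^nat) (c M : R).

Lemma ae_all (P : R -> Prop) : (forall x, P x) -> {ae mu, forall x, P x}.
Proof. by move=> aP; apply: aeW. Qed.

Definition cvgL2 u f := nrm (fun x => u n x - f x) @[n --> \oo] --> 0.

Lemma cvgL2_ip u v f g : (forall n, L2 (u n)) -> (forall n, L2 (v n)) ->
  L2 f -> L2 g -> cvgL2 u f -> cvgL2 v g ->
  ip (u n) (v n) @[n --> \oo] --> ip f g.
Proof.
move=> uL vL fL gL uf vg.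
pose a n := nrm (fun x => u n x - f x); pose d n := nrm (fun x => v n x - g x).
have h : (a n * d n + (a n * nrm g + nrm f * d n)) @[n --> \oo] --> 0.
  rewrite (_ : 0 = 0 * 0 + (0 * nrm g + nrm f * 0)); last by rewrite !mul0r mulr0 !addr0.
  apply: cvgD; first exact: cvgM.
  by apply: cvgD; apply: cvgM => //; exact: cvg_cst.
apply/cvgrPdist_lt => e e0; move/cvgrPdist_lt : h => /(_ e e0).
apply: filterS => n; rewrite sub0r normrN; apply: le_lt_trans.
have ufL : L2 (fun x => u n x - f x) by exact: L2B.
have vgL : L2 (fun x => v n x - g x) by exact: L2B.
have -> : ip f g - ip (u n) (v n) = - (ip (fun x => u n x - f x) (fun x => v n x - g x)
    + (ip (fun x => u n x - f x) g + ip f (fun x => v n x - g x))).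
  rewrite (ipBl (uL n) fL vgL) (ipBl (uL n) fL gL).
  by rewrite (ipBr (vL n) gL (uL n)) (ipBr (vL n) gL fL); ring.
rewrite normrN; apply: le_trans (ler_normD _ _) _.
have h0 : 0 <= a n * d n + (a n * nrm g + nrm f * d n).
  by rewrite !addr_ge0// mulr_ge0// nrm_ge0.
rewrite (ger0_norm h0) lerD ?ip_CS//.
by apply: le_trans (ler_normD _ _) _; rewrite lerD// ip_CS.
Qed.

Lemma cvgL2_cst f : cvgL2 (fun=> f) f.
Proof.
rewrite /cvgL2 (_ : (fun=> _) = fun=> 0); first exact: cvg_cst.
apply/funext => n; rewrite /nrm (_ : ip _ _ = 0) ?sqrtr0//.
by rewrite -[RHS](@Itg0 R); apply: eq_Itg => x; rewrite subrr mul0r.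
Qed.

Lemma cvgL2D u v f g : (forall n, L2 (u n)) -> (forall n, L2 (v n)) ->
  L2 f -> L2 g -> cvgL2 u f -> cvgL2 v g ->
  cvgL2 (fun n x => u n x + v n x) (fun x => f x + g x).
Proof.
move=> uL vL fL gL uf vg.
apply: (@squeeze_cvgr _ _ _ _ (fun=> 0)
  (fun n => nrm (fun x => u n x - f x) + nrm (fun x => v n x - g x))).
- apply: nearW => n; rewrite nrm_ge0/=.
  apply: le_trans (nrmD (L2B (uL n) fL) (L2B (vL n) gL)).
  rewrite le_eqVlt; apply/orP; left; apply/eqP; congr nrm.
  by apply/funext => x; ring.
- exact: cvg_cst.
- by rewrite -[X in _ --> X](addr0 0); exact: cvgD.
Qed.

Lemma cvgL2M (w : R -> R) M u f : measurable_fun setT w -> (forall x, `|w x| <= M) ->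
  (forall n, L2 (u n)) -> L2 f -> cvgL2 u f ->
  cvgL2 (fun n x => w x * u n x) (fun x => w x * f x).
Proof.
move=> mw wM uL fL uf.
apply: (@squeeze_cvgr _ _ _ _ (fun=> 0) (fun n => `|M| * nrm (fun x => u n x - f x))).
- apply: nearW => n; rewrite nrm_ge0/=.
  have := nrmM mw (ae_all wM) (L2B (uL n) fL); congr (_ <= _); congr nrm.
  by apply/funext => x; ring.
- exact: cvg_cst.
- by rewrite -[X in _ --> X](mulr0 `|M|); apply: cvgM => //; exact: cvg_cst.
Qed.

Lemma harmonicM c : n.+1%:R^-1 * c @[n --> \oo] --> (0 : R).
Proof.
rewrite -[X in _ --> X](mul0r c); apply: cvgM; last exact: cvg_cst.
exact: cvg_harmonic.
Qed.

(** Absorbs the terms in which a derivative falls on the dilated cutoff; each such derivative costs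
    a factor 1/(n+1). *)
Lemma cvgL2_small u v f c : (forall n, L2 (u n)) -> (forall n, L2 (v n)) ->
  L2 f -> cvgL2 u f -> (forall n, nrm (v n) <= c) ->
  cvgL2 (fun n x => u n x + n.+1%:R^-1 * v n x) f.
Proof.
move=> uL vL fL uf vc.
apply: (@squeeze_cvgr _ _ _ _ (fun=> 0)
  (fun n => nrm (fun x => u n x - f x) + n.+1%:R^-1 * c)).
- apply: nearW => n; rewrite nrm_ge0/=.
  apply: (@le_trans _ _ (nrm (fun x => u n x - f x) + nrm (fun x => n.+1%:R^-1 * v n x))).
    apply: le_trans (nrmD (L2B (uL n) fL) (L2Z _ (vL n))).
    rewrite le_eqVlt; apply/orP; left; apply/eqP; congr nrm.
    by apply/funext => x; ring.
  by rewrite nrmZ// ger0_norm ?invr_ge0// lerD2l ler_wpM2l// invr_ge0.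
- exact: cvg_cst.
- rewrite -[X in _ --> X](addr0 0); apply: cvgD => //; exact: harmonicM.
Qed.

Lemma eq_cvgL2 u v f : (forall n x, u n x = v n x) -> cvgL2 u f -> cvgL2 v f.
Proof.
by move=> uv; rewrite (_ : u = v)//; apply/funext => n; apply/funext => x.
Qed.

Lemma cvgL2_nrm u f : (forall n, L2 (u n)) -> L2 f -> cvgL2 u f ->
  nrm (u n) @[n --> \oo] --> nrm f.
Proof.
move=> uL fL uf; apply/cvgrPdist_lt => e e0.
move/cvgrPdist_lt : uf => /(_ e e0); apply: filterS => n.
rewrite sub0r normrN (ger0_norm (nrm_ge0 _)); apply: le_lt_trans.
by rewrite distrC; exact: nrm_dist.
Qed.

End L2_convergence.

(** * Weak derivatives *)

Section weak_derivative.
Context {R : realType}.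
Local Notation mu := (@lebesgue_measure R).
Local Notation L2 := (@L2 R).
Local Notation wd := is_weak_derivative.
Implicit Types (f g h k phi : R -> R) (n : nat) (s c : R).

Lemma wdP f g : wd f g <->
  forall phi, test_function phi -> ip f phi^`()%classic = - ip g phi.
Proof. by []. Qed.

Lemma wdD f f' g g' : L2 f -> L2 f' -> L2 g -> L2 g' -> wd f f' -> wd g g' ->
  wd (fun x => f x + g x) (fun x => f' x + g' x).
Proof.
move=> fL f'L gL g'L ff' gg'; apply/wdP => phi tp.
have pL := test_L2 tp; have p'L := test_L2' tp.
by rewrite ipDl// ipDl// ((wdP _ _).1 ff')// ((wdP _ _).1 gg')// opprD.
Qed.

Lemma wdZ c f f' : L2 f -> L2 f' -> wd f f' ->
  wd (fun x => c * f x) (fun x => c * f' x).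
Proof.
move=> fL f'L ff'; apply/wdP => phi tp.
have pL := test_L2 tp; have p'L := test_L2' tp.
by rewrite ipZl// ipZl// ((wdP _ _).1 ff')// mulrN.
Qed.

Lemma eq_wd f f' g g' : (forall x, f x = g x) -> (forall x, f' x = g' x) ->
  wd f f' -> wd g g'.
Proof. by move=> /funext -> /funext ->. Qed.

Lemma wdB f f' g g' : L2 f -> L2 f' -> L2 g -> L2 g' -> wd f f' -> wd g g' ->
  wd (fun x => f x - g x) (fun x => f' x - g' x).
Proof.
move=> fL f'L gL g'L ff' gg'.
have H := wdD fL f'L (L2Z (-1) gL) (L2Z (-1) g'L) ff' (wdZ (-1) gL g'L gg').
by apply: eq_wd H => x; rewrite mulN1r.
Qed.

Lemma smooth_test_parts f phi : smooth f -> test_function phi ->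
  Itg (fun x => f x * phi^`()%classic x) = - Itg (fun x => f^`()%classic x * phi x).
Proof.
move=> sf tp; have sp := test_smooth tp.
have tp' := test_derive1 tp; have sf' := smooth_derive1 sf.
have i1 : itg (fun x => f x * phi^`()%classic x).
  have := testM tp' sf => t.
  have H : itg (phi^`()%classic * f).
    by apply: csupp_itg; [exact/smooth_continuous/test_smooth|exact: test_csupp].
  by apply: eq_itg H => x; rewrite mulrC.
have i2 : itg (fun x => f^`()%classic x * phi x).
  have := testM tp sf' => t.
  have H : itg (phi * f^`()%classic).
    by apply: csupp_itg; [exact/smooth_continuous/test_smooth|exact: test_csupp].
  by apply: eq_itg H => x; rewrite mulrC.
apply/eqP; rewrite -subr_eq0 opprK -ItgD//; apply/eqP.
have t := testM tp sf.
have E : (phi * f)^`()%classic = (fun x => f x * phi^`()%classic x + f^`()%classic x * phi x).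
  apply/funext => x; rewrite derive1E.
  have [_ ->] := is_deriveM (smooth_is_derive x sp) (smooth_is_derive x sf).
  by rewrite /GRing.scale/=; ring.
have st := test_smooth t.
apply: (@Itg_derive_csupp _ (phi * f)).
- by rewrite -E; exact/smooth_continuous/smooth_derive1.
- exact: test_csupp.
- by rewrite -E; exact/csupp_derive1/test_csupp.
- by move=> z; rewrite -[f z * _ + _]/((fun x => f x * phi^`()%classic x + f^`()%classic x * phi x) z) -E; exact: smooth_is_derive.
Qed.

Lemma smooth_wd f : smooth f -> wd f f^`()%classic.
Proof. by move=> sf; apply/wdP => phi tp; exact: smooth_test_parts. Qed.

(** For fixed x the function y -> k ((x - y)/s) is a test function, so the weak derivative moves the
    differentiation from the kernel to [f]. *)
Lemma avg_wd k s f g (x : R) : test_function k -> s != 0 -> L2 f -> L2 g ->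
  wd f g -> s^-1 * avg k^`()%classic s f x = avg k s g x.
Proof.
move=> tk s0 fL gL fg; have tk' := test_derive1 tk.
rewrite !avg_conv//; try exact: L2_measurable (test_L2 _); try exact: L2_measurable.
rewrite mulrCA; congr (_ * _).
have tc := test_conv x s0 tk.
have tc' := test_conv x s0 tk'.
have E : (fun y : R => k (s^-1 * (x - y)))^`()%classic =
    fun y => - (s^-1 * k^`()%classic (s^-1 * (x - y))).
  apply/funext => y.
  rewrite (_ : (fun y : R => k (s^-1 * (x - y))) = (fun y : R => k (- s^-1 * y + s^-1 * x))); last first.
    by apply/funext => z; congr k; ring.
  rewrite derive1_affine; last by move=> z; exact/smooth_derivable/test_smooth.
  by rewrite mulNr; congr (- (_ * k^`()%classic _)); ring.
have := (wdP f g).1 fg _ tc; rewrite E => H.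
rewrite -ItgZ; last by apply: itgM => //; exact: test_L2.
apply: (@oppr_inj R); rewrite (_ : - Itg (fun y => k _ * g y) = - ip g (fun y => k (s^-1 * (x - y)))); last first.
  by congr (- _); apply: eq_Itg => y; rewrite mulrC.
rewrite -H -ItgN; last by apply: itgZ; apply: itgM => //; exact: test_L2.
by apply: eq_Itg => y; ring.
Qed.

(** Mollification at scale 1/(n+1), then a cutoff at scale n+1. The cutoff profile is a parameter
    because differentiation replaces [zeta] by its derivatives. *)
Definition smoothing (z : R -> R) n f : R -> R :=
  (fun x : R => z (n.+1%:R^-1 * x + 0)) * avg rho n.+1%:R^-1 f.

Let sn n : n.+1%:R^-1 != 0 :> R.
Proof. by rewrite invr_eq0. Qed.

Lemma smoothing_test z n f : test_function z -> L2 f -> test_function (smoothing z n f).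
Proof.
move=> tz fL; apply: testM; first exact: test_affine.
by apply: avg_smooth => //; exact: rho_test.
Qed.

Lemma smoothing_nrm z n f M : test_function z -> (forall x, `|z x| <= M) -> L2 f ->
  nrm (smoothing z n f) <= M * nrm f.
Proof.
move=> tz zM fL; have [aL an] := L2_avg_nrm rho_kernel (sn n) fL.
have M0 : 0 <= M by apply: le_trans (zM 0).
have mz : measurable_fun setT (fun x : R => z (n.+1%:R^-1 * x + 0)).
  by apply: L2_measurable; apply: test_L2; exact: test_affine.
apply: le_trans (nrmM mz (ae_all (fun x => zM _)) aL) _.
by rewrite ger0_norm// ler_wpM2l.
Qed.

Lemma smoothing_derive z n f g x : test_function z -> L2 f -> L2 g -> wd f g ->
  (smoothing z n f)^`()%classic x =
  smoothing z n g x + n.+1%:R^-1 * smoothing z^`()%classic n f x.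
Proof.
move=> tz fL gL fg; have st := smooth_affine n.+1%:R^-1 0 (test_smooth tz).
have := is_deriveM (smooth_is_derive x st) (avg_derive x rho_test (sn n) fL).
move=> -[_ E].
rewrite derive1E (E : 'D_1 (smoothing z n f) x = _) (avg_wd x rho_test (sn n) fL gL fg) derive1_affine; last first.
  by move=> y; exact/smooth_derivable/test_smooth.
rewrite /GRing.scale/= /smoothing -![(_ * _) x]/(_ x * _ x)/=; ring.
Qed.

Definition moll n f := smoothing zeta n f.

Lemma moll_test n f : L2 f -> test_function (moll n f).
Proof. by apply: smoothing_test; exact: zeta_test. Qed.

Lemma moll_L2 n f : L2 f -> L2 (moll n f).
Proof. by move=> fL; exact/test_L2/moll_test. Qed.

Lemma moll_nrm n f : L2 f -> nrm (moll n f) <= nrm f.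
Proof.
by move=> fL; rewrite -[leRHS]mul1r; apply: smoothing_nrm => //;
  [exact: zeta_test|exact: zeta_le1].
Qed.

Lemma moll_lebesgue_pt f x : L2 f -> lebesgue_pt f x ->
  moll n f x @[n --> \oo] --> f x.
Proof.
move=> fL fx; rewrite -[f x]mul1r; apply: cvgM; last first.
  exact: (avg_lebesgue_pt rho_kernel (@rho_out R) fL fx).
have H : zeta (n.+1%:R^-1 * x + 0) @[n --> \oo] --> zeta (0 : R).
  apply: continuous_cvg.
    exact/smooth_continuous/test_smooth/zeta_test.
  rewrite -[X in _ --> X](addr0 0); apply: cvgD; last exact: cvg_cst.
  exact: harmonicM.
by rewrite zeta0 in H.
Qed.

Lemma moll_ae f : L2 f -> {ae mu, forall x, moll n f x @[n --> \oo] --> f x}.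
Proof.
move=> fL; have := lebesgue_differentiation (L2_locally_integrable fL).
by move=> /ae_imp; apply => x; exact: moll_lebesgue_pt.
Qed.

Lemma moll_cvg f : L2 f -> cvgL2 (fun n => moll n f) f.
Proof.
move=> fL; apply: L2_strong_cvg => //.
- by move=> n; exact: moll_L2.
- by move=> n; exact: moll_nrm.
- exact: moll_ae.
Qed.

Lemma moll_cvg1 f g : L2 f -> L2 g -> wd f g ->
  cvgL2 (fun n => (moll n f)^`()%classic) g.
Proof.
move=> fL gL fg; have tz' := test_derive1 (@zeta_test R).
have [M HM] := test_bounded tz'.
have H := @cvgL2_small _ (fun n => moll n g) (fun n => smoothing (@zeta R)^`()%classic n f) g (M * nrm f).
have {}H := H (fun n => moll_L2 n gL) (fun n => test_L2 (smoothing_test n tz' fL)) gL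
  (moll_cvg gL) (fun n => smoothing_nrm n tz' HM fL).
apply: eq_cvgL2 H => n x.
by rewrite /moll (smoothing_derive n x (@zeta_test R) fL gL fg).
Qed.

Lemma moll_cvg2 f g h : L2 f -> L2 g -> L2 h -> wd f g -> wd g h ->
  cvgL2 (fun n => (moll n f)^`()%classic^`()%classic) h.
Proof.
move=> fL gL hL fg gh; have tz := @zeta_test R.
have tz' := test_derive1 tz; have tz'' := test_derive1 tz'.
have [M HM] := test_bounded tz'; have [M' HM'] := test_bounded tz''.
have M'0 : 0 <= M' by apply: le_trans (HM' 0).
(* These are the terms with at least one derivative on the cutoff, after one factor 1/(n+1) is taken
   out. The coefficient 2 comes from the Leibniz rule. *)
pose v n x := 2 * smoothing (@zeta R)^`()%classic n g x +
  n.+1%:R^-1 * smoothing (@zeta R)^`()%classic^`()%classic n f x.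
have vL n : L2 (v n).
  by apply: L2D; apply: L2Z; apply: test_L2; exact: smoothing_test.
have vb n : nrm (v n) <= 2 * (M * nrm g) + M' * nrm f.
  apply: le_trans (nrmD _ _) _.
  - by apply: L2Z; apply: test_L2; exact: smoothing_test.
  - by apply: L2Z; apply: test_L2; exact: smoothing_test.
  rewrite nrmZ; last by apply: test_L2; exact: smoothing_test.
  rewrite nrmZ; last by apply: test_L2; exact: smoothing_test.
  rewrite (ger0_norm (ler0n _ _)) lerD//.
    by rewrite ler_wpM2l// smoothing_nrm.
  have := smoothing_nrm n tz'' HM' fL.
  rewrite ger0_norm ?invr_ge0// => H; apply: le_trans H.
  by rewrite ler_piMl ?nrm_ge0// invf_le1// ler1n.
have H := @cvgL2_small _ (fun n => moll n h) v h _ (fun n => moll_L2 n hL) vL hL (moll_cvg hL) vb.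
apply: eq_cvgL2 H => n x.
rewrite /moll.
have -> : (smoothing zeta n f)^`()%classic =
    smoothing zeta n g + n.+1%:R^-1 *: smoothing zeta^`()%classic n f.
  by apply/funext => y; rewrite (smoothing_derive n y tz fL gL fg).
have d1 := smooth_is_derive x (test_smooth (smoothing_test n tz gL)).
have d2 := smooth_is_derive x (test_smooth (smoothing_test n tz' fL)).
rewrite [RHS]derive1E; have [_ ->] := is_deriveD d1 (is_deriveZ n.+1%:R^-1 d2).
rewrite (smoothing_derive n x tz gL hL gh) (smoothing_derive n x tz' fL gL fg).
rewrite /v /GRing.scale/=; ring.
Qed.

End weak_derivative.

Section weak_derivative_calculus.
Context {R : realType}.
Local Notation mu := (@lebesgue_measure R).
Local Notation L2 := (@L2 R).
Local Notation wd := is_weak_derivative.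
Implicit Types (f g h k phi : R -> R) (n : nat) (s c : R).

Lemma contD f g : continuous f -> continuous g -> continuous (fun x => f x + g x).
Proof. by move=> cf cg x; apply: cvgD; [exact: cf|exact: cg]. Qed.

Lemma contM f g : continuous f -> continuous g -> continuous (fun x => f x * g x).
Proof. by move=> cf cg x; apply: cvgM; [exact: cf|exact: cg]. Qed.

Lemma cont_cst c : continuous (fun _ : R => c).
Proof. by move=> x; exact: cvg_cst. Qed.

Lemma L2_orthogonal f : L2 f -> (forall phi, test_function phi -> ip f phi = 0) ->
  nrm f = 0.
Proof.
move=> fL f0.
have H := cvgL2_ip (fun=> fL) (fun n => moll_L2 n fL) fL fL (cvgL2_cst f) (moll_cvg fL).
have : ip f f = 0.
  apply: (@cvg_unique _ (@Rhausdorff R)) H _.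
  rewrite (_ : (fun n => _) = fun=> 0); first exact: cvg_cst.
  by apply/funext => n; apply: f0; exact: moll_test.
by rewrite /nrm => ->; rewrite sqrtr0.
Qed.

Lemma wd_unique f g h : L2 g -> L2 h -> wd f g -> wd f h ->
  {ae mu, forall x, g x = h x}.
Proof.
move=> gL hL fg fh; have ghL := L2B gL hL.
have : nrm (fun x => g x - h x) = 0.
  apply: L2_orthogonal => // phi tp; rewrite ipBl//; last exact: test_L2.
  apply: (@oppr_inj R); rewrite opprB oppr0 -[ip h phi]opprK -((wdP _ _).1 fh)//.
  by rewrite -[ip g phi]opprK -((wdP _ _).1 fg)// opprK addNr.
move=> /(nrm0_ae ghL) H; apply: (ae_imp H) => x /eqP.
by rewrite subr_eq0 => /eqP.
Qed.

(* The weight [w] multiplies, so that no smoothness beyond C^1 is needed. *)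
Lemma wd_parts (w w' f f' g g' : R -> R) (M : R) :
  (forall x : R, is_derive x (1 : R) w (w' x)) -> continuous w' ->
  (forall x, `|w x| <= M) -> (forall x, `|w' x| <= M) ->
  L2 f -> L2 f' -> L2 g -> L2 g' -> wd f f' -> wd g g' ->
  Itg (fun x => w x * (f' x * g x + f x * g' x)) =
  - Itg (fun x => w' x * (f x * g x)).
Proof.
move=> dw cw' wM w'M fL f'L gL g'L ff' gg'.
have cw : continuous w.
  by move=> x; apply: differentiable_continuous; apply/derivable1_diffP; have [] := dw x.
have mw := continuous_measurable cw; have mw' := continuous_measurable cw'.
(* For test functions this is the vanishing integral of the derivative of a compactly supported
   product. The general case follows by mollifying both factors, every pairing being continuous in
   L^2. *)
have test_case phi psi : test_function phi -> test_function psi ->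
    ip (fun x => w x * phi^`()%classic x) psi + ip (fun x => w x * phi x) psi^`()%classic +
    ip (fun x => w' x * phi x) psi = 0.
  move=> tp tq; have sp := test_smooth tp; have sq := test_smooth tq.
  have pL := test_L2 tp; have p'L := test_L2' tp.
  have qL := test_L2 tq; have q'L := test_L2' tq.
  have w1 := L2M mw wM p'L; have w2 := L2M mw wM pL; have w3 := L2M mw' w'M pL.
  have i1 := itgM w1 qL; have i2 := itgM w2 q'L; have i3 := itgM w3 qL.
  rewrite /ip -ItgD// -ItgD//; last exact: itgD.
  apply: (@Itg_derive_csupp _ (fun x => w x * (phi x * psi x))).
  - have cp := smooth_continuous sp; have cq := smooth_continuous sq.
    have cp' := smooth_continuous (smooth_derive1 sp).
    have cq' := smooth_continuous (smooth_derive1 sq).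
    exact: (contD (contD (contM (contM cw cp') cq) (contM (contM cw cp) cq'))
      (contM (contM cw' cp) cq)).
  - have [r pr] := test_csupp tp; exists r => x /pr ->; by rewrite mul0r mulr0.
  - have [r pr] := test_csupp tp; have [r' pr'] := test_csupp tq.
    have [r2 pr2] := csupp_derive1 (test_csupp tp).
    exists (Num.max r (Num.max r' r2)) => x; rewrite !ge_max => /and3P[h1 h2 h3].
    by rewrite pr// pr'// pr2// !(mulr0, mul0r, addr0).
  - move=> x; have d1 := smooth_is_derive x sp; have d2 := smooth_is_derive x sq.
    have := is_deriveM (dw x) (is_deriveM d1 d2) => H.
    by apply: (is_derive_eq H); rewrite /GRing.scale/= -![(_ * _) x]/(_ x * _ x); ring.
have pn n := moll_test n fL; have qn n := moll_test n gL.
have pL n := test_L2 (pn n); have p'L n := test_L2' (pn n).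
have qL n := test_L2 (qn n); have q'L n := test_L2' (qn n).
have c1 := cvgL2_ip (fun n => L2M mw wM (p'L n)) qL (L2M mw wM f'L) gL
  (cvgL2M mw wM p'L f'L (moll_cvg1 fL f'L ff')) (moll_cvg gL).
have c2 := cvgL2_ip (fun n => L2M mw wM (pL n)) q'L (L2M mw wM fL) g'L
  (cvgL2M mw wM pL fL (moll_cvg fL)) (moll_cvg1 gL g'L gg').
have c3 := cvgL2_ip (fun n => L2M mw' w'M (pL n)) qL (L2M mw' w'M fL) gL
  (cvgL2M mw' w'M pL fL (moll_cvg fL)) (moll_cvg gL).
have H : ip (fun x => w x * (moll n f)^`()%classic x) (moll n g) +
    ip (fun x => w x * moll n f x) (moll n g)^`()%classic +
    ip (fun x => w' x * moll n f x) (moll n g) @[n --> \oo] -->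
    ip (fun x => w x * f' x) g + ip (fun x => w x * f x) g' + ip (fun x => w' x * f x) g.
  by apply: cvgD => //; apply: cvgD.
have : ip (fun x => w x * f' x) g + ip (fun x => w x * f x) g' + ip (fun x => w' x * f x) g = 0.
  apply: (@cvg_unique _ (@Rhausdorff R)) H _.
  rewrite (_ : (fun n => _) = fun=> 0); first exact: cvg_cst.
  by apply/funext => n /=; apply: test_case.
move=> /eqP; rewrite addr_eq0 => /eqP E.
transitivity (- ip (fun x => w' x * f x) g); last first.
  by congr (- _); apply: eq_Itg => x; ring.
rewrite -E /ip -ItgD; last 2 first.
- by apply: itgM => //; exact: L2M mw wM f'L.
- by apply: itgM => //; exact: L2M mw wM fL.
by apply: eq_Itg => x; ring.
Qed.

(** phi^2 at x is the integral of 2 phi phi' from a point to the left of the support, and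
    Cauchy-Schwarz concludes. This is Agmon's inequality on the line. *)
Lemma sup_test phi x : test_function phi ->
  phi x ^+ 2 <= 2 * (nrm phi * nrm phi^`()%classic).
Proof.
move=> tp; have sp := test_smooth tp.
have [r r0 pr] := csupp_pos (test_csupp tp).
have cp := smooth_continuous sp; have cp' := smooth_continuous (smooth_derive1 sp).
have pL := test_L2 tp; have p'L := test_L2' tp.
pose y := - (`|x| + r).
have yx : y <= x by have := ler_norm (- x); rewrite normrN /y; lra.
have dF (z : R) : is_derive z (1 : R) (fun z => phi z * phi z) (2 * (phi z * phi^`()%classic z)).
  have d1 := smooth_is_derive z sp.
  by apply: (is_derive_eq (is_deriveM d1 d1)); rewrite /GRing.scale/=; ring.
have := ftc yx _ dF.
have cF : continuous (fun z => 2 * (phi z * phi^`()%classic z)).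
  move=> z; apply: cvgM; [exact: cvg_cst|apply: cvgM; [exact: cp|exact: cp']].
move=> /(_ cF); rewrite (pr y); last first.
  rewrite /y normrN ger0_norm; have := normr_ge0 x; lra.
rewrite mul0r subr0 expr2 => <-.
have i := itgM pL p'L.
rewrite Itg_set.
have iA : itg (fun z => \1_(`[y, x]) z * (2 * (phi z * phi^`()%classic z))).
  apply: (@itg_le _ _ (fun z => 2 * `|phi z * phi^`()%classic z|)).
  - by apply: measurable_funM => //; exact: continuous_measurable.
  - by apply: itgZ; exact: itg_norm.
  - move=> z; rewrite normrM [X in _ * X]normrM (ger0_norm (ler0n _ 2)) ler_piMl//.
    by rewrite indicE; case: (_ \in _); rewrite ?normr1 ?normr0.
apply: (@le_trans _ _ (Itg (fun z => 2 * `|phi z * phi^`()%classic z|))).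
  apply: le_Itg => //; first by apply: itgZ; exact: itg_norm.
  move=> z; apply: le_trans (ler_norm _) _.
  rewrite normrM [X in _ * X]normrM (ger0_norm (ler0n _ 2)) ler_piMl//.
  by rewrite indicE; case: (_ \in _); rewrite ?normr1 ?normr0.
rewrite ItgZ; last exact: itg_norm.
rewrite ler_wpM2l//.
have nL (q : R -> R) : L2 q -> L2 (fun x => `|q x|) /\ nrm (fun x => `|q x|) = nrm q.
  move=> qL.
  have qnL : L2 (fun x => `|q x|).
    apply: (L2_le_ae _ qL); last by apply: aeW => z; rewrite normr_id.
    by apply: measurableT_comp => //; exact: L2_measurable.
  split => //; apply/eqP; rewrite eq_le; apply/andP; split;
  by apply: le_nrm => //; apply: aeW => z; rewrite normr_id.
have [n1 n1E] := nL _ pL; have [n2 n2E] := nL _ p'L.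
rewrite -n1E -n2E; apply: le_trans (le_ip_nrm n1 n2).
by rewrite le_eqVlt; apply/orP; left; apply/eqP; apply: eq_Itg => z; rewrite normrM.
Qed.

(** The bound for test functions passes to the limit at each point where the mollifications
    converge, hence almost everywhere. *)
Lemma wd_sup f f' : L2 f -> L2 f' -> wd f f' ->
  {ae mu, forall x, f x ^+ 2 <= 2 * (nrm f * nrm f')}.
Proof.
move=> fL f'L ff'; apply: (ae_imp (moll_ae fL)) => x fx.
have tn n := moll_test n fL.
have c1 := cvgL2_nrm (fun n => test_L2 (tn n)) fL (moll_cvg fL).
have c2 := cvgL2_nrm (fun n => test_L2' (tn n)) f'L (moll_cvg1 fL f'L ff').
have c3 : 2 * (nrm (moll n f) * nrm (moll n f)^`()%classic) @[n --> \oo] --> 2 * (nrm f * nrm f').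
  by apply: cvgM; [exact: cvg_cst|exact: cvgM].
have c4 : moll n f x ^+ 2 @[n --> \oo] --> f x ^+ 2.
  by rewrite expr2; under eq_fun do rewrite expr2; exact: cvgM.
by apply: ler_cvg_to c4 c3 _; apply: nearW => n; exact: sup_test.
Qed.

(** In the sup bound the factor |f'| is zero. *)
Lemma wd0 f : L2 f -> wd f (fun=> 0) -> {ae mu, forall x, f x = 0}.
Proof.
move=> fL f0; have := wd_sup fL (@L2_0 R) f0 => H; apply: (ae_imp H) => x.
rewrite (_ : nrm (fun=> 0) = 0) ?mulr0; last first.
  by rewrite /nrm (_ : ip _ _ = 0) ?sqrtr0// -[RHS](@Itg0 R); apply: eq_Itg => z; rewrite mul0r.
by move=> fx0; apply/eqP; rewrite -sqrf_eq0 eq_le fx0 sqr_ge0.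
Qed.

Lemma wd_shift c f f' : L2 f -> L2 f' -> wd f f' ->
  wd (fun x => f (x + c)) (fun x => f' (x + c)).
Proof.
move=> fL f'L ff'; apply/wdP => phi tp.
have tc : test_function (fun x : R => phi (x - c)).
  have := @test_affine _ phi 1 (- c) (oner_neq0 _) tp.
  by under eq_fun do rewrite mul1r.
have E : (fun x : R => phi (x - c))^`()%classic = fun x => phi^`()%classic (x - c).
  apply/funext => x; have := @derive1_affine _ phi 1 (- c) x
    (fun y => @smooth_derivable _ phi y (test_smooth tp)).
  by under eq_fun do rewrite mul1r; rewrite mul1r => ->; rewrite mul1r.
have := (wdP _ _).1 ff' _ tc; rewrite E /ip => H.
have m1 : measurable_fun setT (fun x : R => f x * phi^`()%classic (x - c)).
  apply: measurable_funM; first exact: L2_measurable.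
  by rewrite -E; exact: L2_measurable (test_L2' tc).
have m2 : measurable_fun setT (fun x : R => f' x * phi (x - c)).
  by apply: measurable_funM; [exact: L2_measurable|exact: L2_measurable (test_L2 tc)].
rewrite -(Itg_shift c m1) -(Itg_shift c m2) in H.
transitivity (Itg (fun x => f (x + c) * phi^`()%classic (x + c - c))).
  by apply: eq_Itg => x; rewrite addrK.
by rewrite H; congr (- _); apply: eq_Itg => x; rewrite addrK.
Qed.

End weak_derivative_calculus.

(** * The operator A = (1 - b d^2/dx^2)^-1 *)

Section resolvent.
Context {R : realType}.
Local Notation mu := (@lebesgue_measure R).
Local Notation L2 := (@L2 R).
Local Notation wd := is_weak_derivative.
Implicit Types (f g h phi : R -> R) (s b : R).

Let ek : R -> R := exponential_pdf 1.

Lemma exponential_kernel : averaging_kernel ek.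
Proof.
have i : itg ek by exact: integrable_exponential_pdf.
split => //.
- exact: itg_measurable.
- by move=> z; exact: exponential_pdf_ge0.
- exists 1 => z; have [z0|z0] := ltP z 0.
    by rewrite /ek lt0_exponential_pdf.
  rewrite /ek exponential_pdfE//= mul1r -[leRHS]expR0 ler_expR.
  by rewrite mulN1r oppr_le0.
- by apply: (@EFin_inj R); rewrite EFin_Itg// integral_exponential_pdf.
Qed.

(** This integrates d/dz (exp (- z) phi (x + s z)) over z >= 0. The half-line is cut at [N], beyond
    which phi and phi' vanish at x + s z. *)
Let avg_test_derive s phi (x : R) : s != 0 -> test_function phi ->
  avg ek (- s) phi^`()%classic x = s^-1 * (avg ek (- s) phi x - phi x).
Proof.
move=> s0 tp; have tp' := test_derive1 tp.
have pL := test_L2 tp; have p'L := test_L2 tp'.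
have s1 : - s != 0 by rewrite oppr_eq0.
have [r r0 pr] := csupp_pos (test_csupp tp); have [r' r'0 pr'] := csupp_pos (test_csupp tp').
have sp := test_smooth tp.
have cp := smooth_continuous sp; have cp' := smooth_continuous (test_smooth tp').
have caff : continuous (fun z : R => s * z + x).
  by apply: contD; [apply: contM; [exact: cont_cst|move=> z; exact: cvg_id]|exact: cont_cst].
pose N := (r + r' + `|x|) / `|s|.
have sg0 : 0 < `|s| by rewrite normr_gt0.
have N0 : 0 <= N by rewrite divr_ge0// !addr_ge0// ltW.
have big z : N <= z -> r <= `|s * z + x| /\ r' <= `|s * z + x|.
  move=> Nz; have z0 : 0 <= z by exact: le_trans N0 Nz.
  have : r + r' + `|x| <= `|s * z|.
    by rewrite normrM (ger0_norm z0) mulrC -ler_pdivrMr.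
  have := ler_normB (s * z + x) x; rewrite addrK => h1 h2; split; lra.
pose F z := expR (- z) * phi (s * z + x).
pose F' z := expR (- z) * (s * phi^`()%classic (s * z + x) - phi (s * z + x)).
have dF (z : R) : is_derive z (1 : R) F (F' z).
  have d1 : is_derive z (1 : R) (fun z => expR (- z)) (- expR (- z)).
    have dn : is_derive z (1 : R) (fun z : R => - z) (- 1).
      by have := @is_deriveN _ _ _ id z (1 : R) 1 (is_derive_id z (1 : R)).
    have := @is_derive1_comp _ (@expR R) (fun z : R => - z) z _ _ (is_derive_expR (- z)) dn.
    by move=> H; apply: (is_derive_eq H); rewrite mulrN1.
  have sm := smooth_affine s x sp.
  have d2 : is_derive z (1 : R) (fun z => phi (s * z + x)) (s * phi^`()%classic (s * z + x)).
    apply: (is_derive_eq (smooth_is_derive z sm)).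
    exact: (derive1_affine s x z (fun y => @smooth_derivable _ phi y sp)).
  apply: (is_derive_eq (is_deriveM d1 d2)); rewrite /F' /GRing.scale/=; ring.
have cF' : continuous F'.
  apply: contM.
    move=> z; apply: (@continuous_comp _ _ _ (fun z : R => - z) (@expR R)).
      exact: opp_continuous.
    exact: continuous_expR.
  have c1 : continuous (fun z => phi (s * z + x)).
    by move=> z; apply: (@continuous_comp _ _ _ (fun z => s * z + x) phi); [exact: caff|exact: cp].
  have c2 : continuous (fun z => phi^`()%classic (s * z + x)).
    by move=> z; apply: (@continuous_comp _ _ _ (fun z => s * z + x) phi^`()%classic); [exact: caff|exact: cp'].
  apply: (contD (contM (@cont_cst _ s) c2)).
  by move=> z; apply: cvgN; exact: c1.
have := ftc N0 cF' dF; rewrite {1}/F.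
have [h1 h2] := big N (lexx N).
rewrite (pr (s * N + x))// mulr0 {1}/F oppr0 expR0 mul1r mulr0 sub0r add0r Itg_set => H.
have i1 := itg_avg x exponential_kernel s1 pL.
have i2 := itg_avg x exponential_kernel s1 p'L.
have E : Itg (fun z => s * (ek z * phi^`()%classic (x - - s * z)) - ek z * phi (x - - s * z)) = - phi x.
  rewrite -H; apply: eq_Itg => z.
  rewrite (_ : x - - s * z = s * z + x); last by ring.
  rewrite indicE mem_setE in_itv/=.
  have [z0|z0] := ltP z 0; first by rewrite /ek lt0_exponential_pdf//= !mul0r mulr0 subr0.
  rewrite /ek exponential_pdfE//= mul1r mulN1r /F'.
  have [zN|zN] := leP z N; first by rewrite mul1r; ring.
  have [h3 h4] := big z (ltW zN).
  by rewrite pr// pr'// !mulr0 subr0 mul0r.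
rewrite ItgB// in E; last exact: itgZ.
rewrite ItgZ// in E.
rewrite -[Itg _]/(avg ek (- s) phi^`()%classic x) in E.
rewrite -[X in _ - X = _]/(avg ek (- s) phi x) in E.
have -> : avg ek (- s) phi x - phi x = s * avg ek (- s) phi^`()%classic x.
  by rewrite -E; ring.
by rewrite mulrA mulVf// mul1r.
Qed.

(** In other words [avg ek s] inverts 1 + s d/dx. The relation is computed for the adjoint on test
    functions and transferred by duality. *)
Lemma exponential_avg_wd s f : s != 0 -> L2 f ->
  wd (avg ek s f) (fun x => s^-1 * (f x - avg ek s f x)).
Proof.
move=> s0 fL; apply/wdP => phi tp.
have s1 : - s != 0 by rewrite oppr_eq0.
have pL := test_L2 tp; have p'L := test_L2' tp.
have [aL _] := L2_avg_nrm exponential_kernel s0 fL.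
have [bL _] := L2_avg_nrm exponential_kernel s1 pL.
rewrite (avg_adjoint exponential_kernel s0 fL p'L).
rewrite (_ : avg ek (- s) phi^`()%classic = fun x => s^-1 * (avg ek (- s) phi x - phi x)); last first.
  by apply/funext => x; exact: avg_test_derive.
rewrite (ipZr _ (L2B bL pL) fL) (ipBr bL pL fL).
rewrite -(avg_adjoint exponential_kernel s0 fL pL).
rewrite (ipZl _ (L2B fL aL) pL) (ipBl fL aL pL); ring.
Qed.

Lemma half_bound (x p q n : R) : x <= p + q -> p <= n -> q <= n -> 2^-1 * x <= n.
Proof. lra. Qed.

(* [Aop b] inverts [1 - b d^2/dx^2] on L^2 and [Kop b] is its derivative; the
   factorisation (1 - s d/dx)(1 + s d/dx), s^2 = b, reduces both to one-sided
   exponential averages. *)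
Definition Aop b f x := 2^-1 * (avg ek (Num.sqrt b) f x + avg ek (- Num.sqrt b) f x).
Definition Kop b f x :=
  (2 * Num.sqrt b)^-1 * (avg ek (- Num.sqrt b) f x - avg ek (Num.sqrt b) f x).

Section fixed_b.
Variables (b : R) (b0 : 0 < b).
Let s := Num.sqrt b.
Let s0 : 0 < s. Proof. by rewrite sqrtr_gt0. Qed.
Let sn : s != 0. Proof. by rewrite gt_eqF. Qed.
Let sN : - s != 0. Proof. by rewrite oppr_eq0. Qed.
Let ss : s ^+ 2 = b. Proof. by rewrite sqr_sqrtr// ltW. Qed.
Let ekk := exponential_kernel.

Let pL f : L2 f -> L2 (avg ek s f). Proof. by move=> /(L2_avg_nrm ekk sn)[]. Qed.
Let qL f : L2 f -> L2 (avg ek (- s) f). Proof. by move=> /(L2_avg_nrm ekk sN)[]. Qed.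

Lemma L2_Aop f : L2 f -> L2 (Aop b f).
Proof. by move=> fL; apply: L2Z; apply: L2D; [exact: pL|exact: qL]. Qed.

Lemma L2_Kop f : L2 f -> L2 (Kop b f).
Proof. by move=> fL; apply: L2Z; apply: L2B; [exact: qL|exact: pL]. Qed.

Lemma Aop_wd f : L2 f -> wd (Aop b f) (Kop b f).
Proof.
move=> fL; have h1 := exponential_avg_wd sn fL; have h2 := exponential_avg_wd sN fL.
have fpL := L2Z s^-1 (L2B fL (pL fL)); have fqL := L2Z (- s)^-1 (L2B fL (qL fL)).
have := wdZ 2^-1 (L2D (pL fL) (qL fL)) (L2D fpL fqL) (wdD (pL fL) fpL (qL fL) fqL h1 h2).
apply: eq_wd => // x; rewrite /Kop -/s; field; by rewrite sn.
Qed.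

Lemma Kop_wd f : L2 f -> wd (Kop b f) (fun x => b^-1 * (Aop b f x - f x)).
Proof.
move=> fL; have h1 := exponential_avg_wd sn fL; have h2 := exponential_avg_wd sN fL.
have fpL := L2Z s^-1 (L2B fL (pL fL)); have fqL := L2Z (- s)^-1 (L2B fL (qL fL)).
have := wdZ (2 * s)^-1 (L2B (qL fL) (pL fL)) (L2B fqL fpL) (wdB (qL fL) fqL (pL fL) fpL h2 h1).
apply: eq_wd => x; first by rewrite /Kop -/s.
have bE : b^-1 = (s ^+ 2)^-1 by rewrite ss.
rewrite bE /Aop -/s; field; by rewrite sn.
Qed.

Lemma Aop_nrm f : L2 f -> nrm (Aop b f) <= nrm f.
Proof.
move=> fL; rewrite (nrmZ _ (L2D (pL fL) (qL fL))) ger0_norm ?invr_ge0//.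
have := nrmD (pL fL) (qL fL).
have [_ h1] := L2_avg_nrm ekk sn fL; have [_ h2] := L2_avg_nrm ekk sN fL.
by move=> h; exact: half_bound h h1 h2.
Qed.

Lemma Kop_nrm f : L2 f -> nrm (Kop b f) <= s^-1 * nrm f.
Proof.
move=> fL; rewrite (nrmZ _ (L2B (qL fL) (pL fL))) ger0_norm; last first.
  by rewrite invr_ge0 mulr_ge0// ltW.
have := nrmB (qL fL) (pL fL).
have [_ h1] := L2_avg_nrm ekk sn fL; have [_ h2] := L2_avg_nrm ekk sN fL.
move=> h; rewrite -/s (_ : (2 * s)^-1 = s^-1 * 2^-1); last by rewrite invfM mulrC.
by rewrite -mulrA ler_wpM2l ?invr_ge0 ?(ltW s0)//; exact: half_bound h h2 h1.
Qed.

Lemma AopB f g x : L2 f -> L2 g -> Aop b (fun x => f x - g x) x = Aop b f x - Aop b g x.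
Proof.
move=> fL gL; have E : (fun x => f x - g x) = (fun x => f x + -1 * g x).
  by apply/funext => y; rewrite mulN1r.
rewrite E /Aop -/s (avgD x ekk sn fL (L2Z (-1) gL)) (avgD x ekk sN fL (L2Z (-1) gL))
  (avgZ (-1) x ekk sn gL) (avgZ (-1) x ekk sN gL); by rewrite !mulN1r addrACA -opprD mulrBr.
Qed.

Lemma KopB f g x : L2 f -> L2 g -> Kop b (fun x => f x - g x) x = Kop b f x - Kop b g x.
Proof.
move=> fL gL; have E : (fun x => f x - g x) = (fun x => f x + -1 * g x).
  by apply/funext => y; rewrite mulN1r.
rewrite E /Kop -/s (avgD x ekk sn fL (L2Z (-1) gL)) (avgD x ekk sN fL (L2Z (-1) gL))
  (avgZ (-1) x ekk sn gL) (avgZ (-1) x ekk sN gL); by rewrite !mulN1r opprD addrACA -opprD mulrBr.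
Qed.

(* Testing F - b F'' = f against w F. *)
Lemma Aop_weighted (w w' : R -> R) (M l : R) f :
  (forall x : R, is_derive x (1 : R) w (w' x)) -> continuous w' ->
  (forall x, 0 <= w x) -> (forall x, w x <= M) -> (forall x, `|w' x| <= l * w x) ->
  0 <= l -> l * s <= 4^-1 -> L2 f ->
  Itg (fun x => w x * (Aop b f x ^+ 2 + b * Kop b f x ^+ 2)) <=
  4 / 3 * Itg (fun x => w x * f x ^+ 2).
Proof.
move=> dw cw' w0 wM w'l l0 ls fL.
have AL := L2_Aop fL; have KL := L2_Kop fL.
have K'L : L2 (fun x => b^-1 * (Aop b f x - f x)) by exact: L2Z (L2B AL fL).
have M0 : 0 <= M by apply: le_trans (wM 0).
have cw : continuous w.
  by move=> x; apply: differentiable_continuous; apply/derivable1_diffP; have [] := dw x.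
have mw := continuous_measurable cw; have mw' := continuous_measurable cw'.
pose M' := Num.max M (l * M).
have wb x : `|w x| <= M' by rewrite ger0_norm// le_max wM.
have w'b x : `|w' x| <= M'.
  by rewrite le_max; apply/orP; right; apply: le_trans (w'l x) _; rewrite ler_wpM2l.
have parts := wd_parts dw cw' wb w'b AL KL KL K'L (Aop_wd fL) (Kop_wd fL).
have wi (g h : R -> R) : L2 g -> L2 h -> itg (fun x => w x * (g x * h x)).
  move=> gL hL; apply: eq_itg (itgM (L2M mw wb gL) hL) => x; ring.
have w'i (g h : R -> R) : L2 g -> L2 h -> itg (fun x => w' x * (g x * h x)).
  move=> gL hL; apply: eq_itg (itgM (L2M mw' w'b gL) hL) => x; ring.
set F := Aop b f in AL K'L parts *; set F1 := Kop b f in KL parts *.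
have iFF := wi _ _ AL AL; have i11 := wi _ _ KL KL; have iff_ := wi _ _ fL fL.
have ifF := wi _ _ fL AL; have i'1 := w'i _ _ AL KL.
(* The weighted identity of the test with w F: integrating by parts leaves the single error term
   containing w'. *)
have E : Itg (fun x => w x * (F x * F x)) + b * Itg (fun x => w x * (F1 x * F1 x)) =
    Itg (fun x => w x * (f x * F x)) - b * Itg (fun x => w' x * (F x * F1 x)).
  have -> : Itg (fun x => w' x * (F x * F1 x)) = - Itg (fun x => w x * (F1 x * F1 x + F x * (b^-1 * (F x - f x)))).
    by rewrite parts opprK.
  have i3 : itg (fun x => w x * (F1 x * F1 x + F x * (b^-1 * (F x - f x)))).
    apply: eq_itg (itgD i11 (itgZ b^-1 (itgB iFF ifF))) => x; ring.
  have bi3 := itgZ b i3; have bi1 := itgZ b i11.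
  rewrite mulrN opprK -!ItgZ// -!ItgD//.
  by apply: eq_Itg => x; field; rewrite gt_eqF.
(* |w'| <= l w together with l s <= 1/4, s = sqrt b, and then |F| (s |F1|) <= (F^2 + s^2 F1^2) / 2,
   give the factor 1/8. *)
have B1 : - (b * Itg (fun x => w' x * (F x * F1 x))) <=
    8^-1 * (Itg (fun x => w x * (F x * F x)) + b * Itg (fun x => w x * (F1 x * F1 x))).
  rewrite -mulrN -ItgN// -!ItgZ//; last exact: itgN.
  rewrite -ItgD//; last exact: itgZ.
  rewrite -ItgZ; last by apply: itgD => //; exact: itgZ.
  apply: le_Itg.
  - by apply: itgZ; exact: itgN.
  - by apply: itgZ; apply: itgD => //; exact: itgZ.
  move=> x; apply: le_trans (_ : s ^+ 2 * (l * w x * (`|F x| * `|F1 x|)) <= _).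
    rewrite -ss ler_wpM2l ?sqr_ge0//; apply: le_trans (ler_norm _) _.
    by rewrite normrN !normrM ler_wpM2r// mulr_ge0.
  rewrite -ss.
  apply: le_trans (_ : 4^-1 * (w x * (`|F x| * (s * `|F1 x|))) <= _).
    rewrite (_ : s ^+ 2 * _ = l * s * (w x * (`|F x| * (s * `|F1 x|)))); last by ring.
    by rewrite ler_wpM2r// !mulr_ge0// ltW.
  have := sqr_ge0 (`|F x| - s * `|F1 x|) => h.
  have -> : 8^-1 * (w x * (F x * F x) + s ^+ 2 * (w x * (F1 x * F1 x))) =
     4^-1 * (w x * (2^-1 * (`|F x| ^+ 2 + (s * `|F1 x|) ^+ 2))).
    by rewrite exprMn !real_normK ?num_real//; field.
  rewrite ler_wpM2l ?invr_ge0// ler_wpM2l//; lra.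
have B2 : Itg (fun x => w x * (f x * F x)) <=
    2^-1 * Itg (fun x => w x * (f x * f x)) + 2^-1 * Itg (fun x => w x * (F x * F x)).
  rewrite -!ItgZ// -ItgD; [|exact: itgZ..].
  apply: le_Itg => //; first by apply: itgD; exact: itgZ.
  move=> x; rewrite (_ : _ + _ = w x * (2^-1 * (f x ^+ 2 + F x ^+ 2))); last by ring.
  rewrite ler_wpM2l//; have := sqr_ge0 (f x - F x); lra.
have P1 : 0 <= Itg (fun x => w x * (F x * F x)).
  by apply: Itg_ge0 => x; rewrite mulr_ge0// -expr2 sqr_ge0.
have P2 : 0 <= b * Itg (fun x => w x * (F1 x * F1 x)).
  by rewrite mulr_ge0 ?(ltW b0)//; apply: Itg_ge0 => x; rewrite mulr_ge0// -expr2 sqr_ge0.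
have -> : Itg (fun x => w x * (F x ^+ 2 + b * F1 x ^+ 2)) =
    Itg (fun x => w x * (F x * F x)) + b * Itg (fun x => w x * (F1 x * F1 x)).
  rewrite -ItgZ// -ItgD//; last exact: itgZ.
  by apply: eq_Itg => x; ring.
have -> : Itg (fun x => w x * f x ^+ 2) = Itg (fun x => w x * (f x * f x)).
  by apply: eq_Itg => x; ring.
(* With X the left side and Y the weighted integral of f^2, the bounds give X <= Y/2 + X/2 + X/8,
   hence the constant (1/2) / (3/8) = 4/3. *)
lra.
Qed.

End fixed_b.

End resolvent.

(** * Translations in L^2 *)

Section translation.
Context {R : realType}.
Local Notation mu := (@lebesgue_measure R).
Local Notation L2 := (@L2 R).
Local Notation wd := is_weak_derivative.
Implicit Types (f g phi : R -> R) (h c : R).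

Let unit_kernel : averaging_kernel (\1_(`[0%R, 1%R]) : R -> R).
Proof.
have mJ : mu `[0%R, 1%R]%classic = 1%E.
  by rewrite lebesgue_measure_itv/= lte_fin ltr01 -EFinB subr0.
have i : itg (\1_(`[0%R, 1%R]) : R -> R).
  by apply: itg_indic => //; rewrite mJ ltry.
split => //.
- by exists 1 => z; rewrite indicE; case: (_ \in _).
- by apply: (@EFin_inj R); rewrite EFin_Itg// integral_indic// setIT.
Qed.

(** The increment is h times the mean of phi' over the segment from x to x + h. The indicator of
    [0, 1] is an averaging kernel, so this mean is a contraction of L^2. *)
Let translation_test h phi : test_function phi ->
  nrm (fun x => phi (x + h) - phi x) <= `|h| * nrm phi^`()%classic.
Proof.
move=> tp; have p'L := test_L2' tp; have sp := test_smooth tp.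
have [->|h0] := eqVneq h 0.
  rewrite normr0 mul0r (_ : (fun x => _) = fun=> 0).
    by rewrite /nrm (_ : ip _ _ = 0) ?sqrtr0// -[RHS](@Itg0 R); apply: eq_Itg => z; rewrite mul0r.
  by apply/funext => x; rewrite addr0 subrr.
have h1 : - h != 0 by rewrite oppr_eq0.
have [aL an] := L2_avg_nrm unit_kernel h1 p'L.
have E : (fun x => phi (x + h) - phi x) = fun x => h * avg (\1_(`[0%R, 1%R])) (- h) phi^`()%classic x.
  apply/funext => x.
  have sm := smooth_affine h x sp.
  have dF (z : R) : is_derive z (1 : R) (fun z : R => phi (h * z + x)) (h * phi^`()%classic (h * z + x)).
    apply: (is_derive_eq (smooth_is_derive z sm)).
    exact: (derive1_affine h x z (fun y => @smooth_derivable _ phi y sp)).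
  have cF : continuous (fun z : R => h * phi^`()%classic (h * z + x)).
    apply: contM; first exact: cont_cst.
    have := smooth_continuous (smooth_affine h x (smooth_derive1 sp)); exact.
  have E1 := ftc (@ler01 R) cF dF; rewrite mulr1 mulr0 add0r in E1.
  rewrite (addrC x h) -E1 Itg_set /avg -ItgZ; last exact: (itg_avg x unit_kernel h1 p'L).
  apply: eq_Itg => z; rewrite mulrCA; congr (_ * (_ * phi^`()%classic _)); ring.
by rewrite E nrmZ// ler_wpM2l.
Qed.

Lemma translation_nrm h f f' : L2 f -> L2 f' -> wd f f' ->
  nrm (fun x => f (x + h) - f x) <= `|h| * nrm f'.
Proof.
move=> fL f'L ff'.
have tn n := moll_test n fL.
have mL n := test_L2 (tn n).
have c2 := cvgL2_nrm (fun n => test_L2' (tn n)) f'L (moll_cvg1 fL f'L ff').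
have c0 := moll_cvg fL.
have cs : cvgL2 (fun n x => moll n f (x + h)) (fun x => f (x + h)).
  rewrite /cvgL2; under eq_fun do rewrite (nrm_shift h (L2B (mL _) fL)).
  exact: c0.
have cd : cvgL2 (fun n x => moll n f (x + h) + -1 * moll n f x) (fun x => f (x + h) + -1 * f x).
  apply: cvgL2D => //.
  - by move=> n; exact: L2_shift.
  - by move=> n; exact: L2Z.
  - exact: L2_shift.
  - exact: L2Z.
  - apply: (@cvgL2M _ (fun=> -1) 1 _ _ _ _ mL fL c0) => // x.
    by rewrite normrN normr1.
have cN := cvgL2_nrm (fun n => L2D (L2_shift h (mL n)) (L2Z (-1) (mL n)))
  (L2D (L2_shift h fL) (L2Z (-1) fL)) cd.
have -> : (fun x => f (x + h) - f x) = (fun x => f (x + h) + -1 * f x).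
  by apply/funext => x; rewrite mulN1r.
have c3 : `|h| * nrm (moll n f)^`()%classic @[n --> \oo] --> `|h| * nrm f'.
  by apply: cvgM => //; exact: cvg_cst.
apply: ler_cvg_to cN c3 _; apply: nearW => n.
have := translation_test h (tn n); congr (_ <= _); congr nrm.
by apply/funext => x; rewrite mulN1r.
Qed.

End translation.

(** * From weak to classical derivatives in time *)

Section weak_time_derivative.
Context {R : realType}.
Local Notation mu := (@lebesgue_measure R).
Local Notation L2 := (@L2 R).
Local Notation wd := is_weak_derivative.
Implicit Types (f g phi : R -> R) (t : R).

(** Pairing the derivatives of the mollifications with the indicator of [x, y] gives the right side
    in the limit; continuity makes both endpoints Lebesgue points, which gives the left side. *)
Lemma continuous_wd_ftc f g (x y : R) : x <= y -> continuous f -> continuous g -> L2 f -> L2 g ->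
  wd f g -> f y - f x = \int[mu]_(z in `[x, y]) g z.
Proof.
move=> xy cf cg fL gL fg.
have leb z : lebesgue_pt f z.
  apply: (@continuous_lebesgue_pt _ f z setT); [|by []|exact: L2_measurable|exact: cf].
  by split => //; exact: openT.
have JL : L2 (\1_(`[x, y]) : R -> R).
  by apply: L2_indic => //; rewrite lebesgue_measure_itv/=; case: ifP => _; rewrite -?EFinB ltry.
have tn n := moll_test n fL.
have c1 := cvgL2_ip (fun=> JL) (fun n => test_L2' (tn n)) JL gL (cvgL2_cst _) (moll_cvg1 fL gL fg).
have c2 : moll n f y - moll n f x @[n --> \oo] --> f y - f x.
  by apply: cvgB; apply: moll_lebesgue_pt.
rewrite Itg_set; apply: (@cvg_unique _ (@Rhausdorff R)) c2 _.
rewrite (_ : (fun n => _) = fun n => ip (\1_(`[x, y])) (moll n f)^`()%classic)//.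
apply/funext => n; have sn := test_smooth (tn n).
rewrite -(ftc xy (smooth_continuous (smooth_derive1 sn)) (fun z => smooth_is_derive z sn)).
by rewrite Itg_set.
Qed.

Lemma continuous_wd_is_derive f g t : continuous f -> continuous g -> L2 f -> L2 g ->
  wd f g -> is_derive t (1 : R) f (g t).
Proof.
move=> cf cg fL gL fg.
have i : mu.-integrable `[t - 1, t + 1] (EFin \o g).
  apply: continuous_compact_integrable; first exact: segment_compact.
  exact: continuous_subspaceT.
have t1 : t < t + 1 by lra.
have t2 : t - 1 < t by lra.
have [d1 d2] := continuous_FTC1_closed t1 i t2 (cg t).
pose F (x : R) := \int[mu]_(z in `[t - 1, x]) g z.
have dF : is_derive t (1 : R) (fun x => f (t - 1) + F x) (g t).
  have dF0 : is_derive t (1 : R) F (g t).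
    exact: (DeriveDef d1 (etrans (esym (derive1E _ _)) d2)).
  have := is_deriveD (is_derive_cst (f (t - 1)) t (1 : R)) dF0 => H.
  by apply: (is_derive_eq H); rewrite add0r.
apply: near_eq_is_derive dF; near=> x.
have tx : t - 1 <= x by apply: ltW; near: x; exact: lt_nbhsr.
by rewrite /F -(continuous_wd_ftc tx cf cg fL gL fg) addrC subrK.
Unshelve. all: end_near. Qed.

(** A scalar function of time may fail to be square integrable. It is multiplied by a cutoff [z]
    with z t != 0, the product is differentiated classically, and [z] is divided out near t. *)
Lemma weak_derivative_is_derive (G B : R -> R) t : continuous G -> continuous B ->
  (forall theta, test_function theta ->
    Itg (fun t => theta^`()%classic t * G t + theta t * B t) = 0) ->
  is_derive t (1 : R) G (B t).
Proof.
move=> cG cB H.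
pose T := `|t| + 1; have T0 : 0 < T by rewrite ltr_wpDl.
pose z (x : R) := bump0 (T^-1 * x + 0).
have tz : test_function z by apply: test_affine; [rewrite invr_eq0 gt_eqF|exact: bump0_test].
have tz' := test_derive1 tz; have sz := test_smooth tz.
have cz := smooth_continuous sz; have cz' := smooth_continuous (test_smooth tz').
have zt : z t != 0.
  rewrite gt_eqF// bump0_gt0// addr0 mulrC normrM normfV (gtr0_norm T0).
  by rewrite ltr_pdivrMr// mul1r ltrDl.
pose f x := z x * G x; pose g x := z x * B x + z^`()%classic x * G x.
have [r r0 zr] := csupp_pos (test_csupp tz); have [r' _ zr'] := csupp_pos (test_csupp tz').
have cf : continuous f by exact: contM.
have cg : continuous g by apply: contD; exact: contM.
have fL : L2 f by apply: csupp_L2 => //; exists r => x /zr; rewrite /f => ->; rewrite mul0r.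
have gL : L2 g.
  apply: csupp_L2 => //; exists (Num.max r r') => x; rewrite ge_max => /andP[h1 h2].
  by rewrite /g zr// zr'// !mul0r addr0.
have fg : wd f g.
  apply/wdP => phi tp; have sp := test_smooth tp.
  have th := testM tz sp; have := H _ th.
  have E x : (z * phi)^`()%classic x = z x * phi^`()%classic x + z^`()%classic x * phi x.
    rewrite derive1E; have [_ ->] := is_deriveM (smooth_is_derive x sz) (smooth_is_derive x sp).
    by rewrite /GRing.scale/=; ring.
  have pL := test_L2 tp; have p'L := test_L2' tp.
  move=> E0; apply/eqP; rewrite -subr_eq0 opprK /ip -ItgD; [|exact: itgM..].
  rewrite -E0; apply/eqP; apply: eq_Itg => x; rewrite E /f /g -[(z * phi) x]/(z x * phi x); ring.
have df := continuous_wd_is_derive t cf cg fL gL fg.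
have dz := smooth_is_derive t sz.
have dzV : is_derive t (1 : R) (fun x => (z x)^-1) (- (z t) ^- 2 * z^`()%classic t).
  exact: is_deriveV.
have := is_deriveM df dzV => dG.
have : is_derive t (1 : R) (f * (fun x => (z x)^-1)) (B t).
  apply: (is_derive_eq dG); rewrite /GRing.scale/= /f /g; field; exact: zt.
apply: near_eq_is_derive.
have : \forall x \near t, z x != 0.
  have : z x @[x --> t] --> z t by exact: cz.
  by move/cvgr_neq0; apply.
apply: filterS => x zx; rewrite -[(f * _) x]/(f x * (z x)^-1) /f; field; exact: zx.
Qed.

End weak_time_derivative.

(** * Calculus of L^2-valued functions of time *)

Section L2_calculus.
Context {R : realType}.
Local Notation mu := (@lebesgue_measure R).
Local Notation L2 := (@L2 R).
Local Notation wd := is_weak_derivative.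
Implicit Types (f g : R -> R -> R) (F G w : R -> R) (t : R).

Definition contL2 f t := forall e : R, 0 < e ->
  \forall h \near (0 : R), nrm (fun x => f (t + h) x - f t x) <= e.

Definition diffL2 f t F := forall e : R, 0 < e ->
  \forall h \near (0 : R), nrm (fun x => f (t + h) x - f t x - h * F x) <= e * `|h|.

(** Continuity in L^oo, which the Leibniz rule in L^2 requires of one factor. *)
Definition contsup f t := forall e : R, 0 < e ->
  \forall h \near (0 : R), {ae mu, forall x, `|f (t + h) x - f t x| <= e}.

Lemma near0_norm (d : R) : 0 < d -> \forall h \near (0 : R), `|h| <= d.
Proof.
move=> d0; have := nbhsx_ballx (0 : R) d d0; apply: filterS => h.
by rewrite /ball/= sub0r normrN => /ltW.
Qed.

Lemma nrm_leD (H F G : R -> R) (p q : R) : L2 F -> L2 G -> (forall x, H x = F x + G x) ->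
  nrm F <= p -> nrm G <= q -> nrm H <= p + q.
Proof.
move=> FL GL /funext ->; have := nrmD FL GL; lra.
Qed.

Lemma is_derive_littleo (f : R -> R) t l :
  (forall e : R, 0 < e -> \forall h \near (0 : R), `|f (t + h) - f t - h * l| <= e * `|h|) ->
  is_derive t (1 : R) f l.
Proof.
move=> H; have C : h^-1 *: (f (h *: 1 + t) - f t) @[h --> (0:R)^'] --> l.
  apply/cvgrPdist_le => e e0.
  have := H e e0; rewrite -nbhs_nearE => H0.
  have : \forall h \near (0:R)^', `|f (t + h) - f t - h * l| <= e * `|h|.
    exact: nbhs_dnbhs.
  move=> H1; have h0 : \forall h \near (0:R)^', h != 0 by exact: nbhs_dnbhs_neq.
  apply: filterS2 h0 H1 => h h0.
  rewrite /GRing.scale/= mulr1 (addrC h).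
  rewrite -ler_pdivrMr ?normr_gt0// -normfV -normrM distrC.
  by rewrite (_ : h^-1 * _ - l = (f (t + h) - f t - h * l) / h)//; field.
have dv : derivable f t (1 : R) by apply/cvg_ex; exists l.
by apply: DeriveDef => //; apply/cvg_lim => //; exact: C.
Qed.

Lemma mvt_is_derive (f df : R -> R) (x y : R) :
  (forall z : R, is_derive z (1 : R) f (df z)) ->
  exists2 z, `|z - x| <= `|y - x| & f y - f x = (y - x) * df z.
Proof.
move=> d; have cf (z : R) : {for z, continuous f}.
  by apply: differentiable_continuous; apply/derivable1_diffP; have [] := d z.
have [xy|yx] := leP x y.
  have [|z /itvP zI ->] := @MVT_segment R f df x y xy (fun z _ => d z).
    by apply: continuous_subspaceT => z; exact: cf.
  exists z; last by rewrite mulrC.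
  by rewrite !ger0_norm ?subr_ge0 ?zI// lerD2r zI.
have [|z /itvP zI E] := @MVT_segment R f df y x (ltW yx) (fun z _ => d z).
  by apply: continuous_subspaceT => z; exact: cf.
exists z; last by apply: oppr_inj; rewrite opprB E; ring.
by rewrite !ler0_norm ?subr_le0 ?zI// ?(ltW yx)// lerN2 lerD2r zI.
Qed.

Lemma diffL2_contL2 f t F : (forall s, L2 (f s)) -> L2 F -> diffL2 f t F -> contL2 f t.
Proof.
move=> fL FL fF e e0; have n0 := nrm_ge0 F.
have d0 : 0 < e / (1 + nrm F) by rewrite divr_gt0// ltr_wpDr.
have H := fF 1 ltr01; have H1 := near0_norm d0.
apply: filterS2 H1 H => h hd hF.
have := nrm_leD (L2B (L2B (fL (t + h)) (fL t)) (L2Z h FL)) (L2Z h FL)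
  (_ : forall x, f (t + h) x - f t x = _) hF (lexx _).
move/(_ (fun x => ltac:(ring))) => /le_trans; apply.
rewrite nrmZ// mul1r -[X in X + _]mulr1 -mulrDr.
by move: hd; rewrite ler_pdivlMr// ltr_wpDr.
Qed.

Lemma contL2_nrm f t : (forall s, L2 (f s)) -> contL2 f t ->
  \forall h \near (0 : R), nrm (f (t + h)) <= nrm (f t) + 1.
Proof.
move=> fL cf; have := cf 1 ltr01; apply: filterS => h h1.
have := nrm_dist (fL (t + h)) (fL t); have := ler_norm (nrm (f (t + h)) - nrm (f t)); lra.
Qed.

Lemma ltr_scale_eps (e n : R) : 0 < e -> 0 <= n -> exists2 d, 0 < d & d * n <= e.
Proof.
move=> e0 n0; have n1 : 0 < n + 1 by lra.
exists (e / (n + 1)); first by rewrite divr_gt0.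
by rewrite mulrAC ler_pdivrMr// ler_pM2l//; lra.
Qed.

Lemma diffL2_ip f g t F G : (forall s, L2 (f s)) -> (forall s, L2 (g s)) ->
  L2 F -> L2 G -> diffL2 f t F -> diffL2 g t G ->
  is_derive t (1 : R) (fun s => ip (f s) (g s)) (ip F (g t) + ip (f t) G).
Proof.
move=> fL gL FL GL fF gG; apply: is_derive_littleo => e e0.
have cg := diffL2_contL2 gL GL gG.
have N0 : 0 <= nrm (g t) + 1 + nrm F + nrm (f t).
  by rewrite !addr_ge0 ?nrm_ge0.
have [d d0 dN] := ltr_scale_eps e0 N0.
have H1 := fF d d0; have H2 := gG d d0; have H3 := cg d d0; have H4 := contL2_nrm gL cg.
apply: filterS2 (filterI H1 H2) (filterI H3 H4) => h [h1 h2] [h3 h4].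
set f1 := f (t + h); set g1 := g (t + h).
have f1L : L2 f1 := fL _; have g1L : L2 g1 := gL _.
have fD := L2B f1L (fL t); have gD := L2B g1L (gL t).
have fR := L2B fD (L2Z h FL); have gR := L2B gD (L2Z h GL).
have E : ip f1 g1 - ip (f t) (g t) - h * (ip F (g t) + ip (f t) G) =
  ip (fun x => f1 x - f t x - h * F x) g1 + h * ip F (fun x => g1 x - g t x) +
  ip (f t) (fun x => g1 x - g t x - h * G x).
  rewrite (ipBl fD (L2Z h FL) g1L) (ipBl f1L (fL t) g1L) (ipZl h FL g1L).
  rewrite (ipBr gD (L2Z h GL) (fL t)) (ipBr g1L (gL t) (fL t)) (ipZr h GL (fL t)).
  by rewrite (ipBr g1L (gL t) FL); ring.
rewrite E; clear E.
have b1 : `|ip (fun x => f1 x - f t x - h * F x) g1| <= d * `|h| * (nrm (g t) + 1).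
  apply: (le_trans (ip_CS fR g1L)); apply: ler_pM => //; exact: nrm_ge0.
have b2 : `|h * ip F (fun x => g1 x - g t x)| <= `|h| * (nrm F * d).
  rewrite normrM ler_wpM2l//; apply: (le_trans (ip_CS FL gD)).
  by rewrite ler_wpM2l// nrm_ge0.
have b3 : `|ip (f t) (fun x => g1 x - g t x - h * G x)| <= nrm (f t) * (d * `|h|).
  by apply: (le_trans (ip_CS (fL t) gR)); rewrite ler_wpM2l// nrm_ge0.
apply: (le_trans (ler_normD _ _)); apply: (le_trans (lerD (le_trans (ler_normD _ _) (lerD b1 b2)) b3)).
rewrite (_ : _ + _ = d * (nrm (g t) + 1 + nrm F + nrm (f t)) * `|h|); last by ring.
by rewrite ler_wpM2r.
Qed.

Lemma contL2_ip f g t : (forall s, L2 (f s)) -> (forall s, L2 (g s)) ->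
  contL2 f t -> contL2 g t -> {for t, continuous (fun s => ip (f s) (g s))}.
Proof.
move=> fL gL cf cg; apply/cvgrPdist_le => e e0.
have N0 : 0 <= nrm (g t) + 1 + nrm (f t) by rewrite !addr_ge0 ?nrm_ge0.
have [d d0 dN] := ltr_scale_eps e0 N0.
have H1 := cf d d0; have H2 := cg d d0; have H3 := contL2_nrm gL cg.
have H : \forall h \near (0 : R), `|ip (f t) (g t) - ip (f (t + h)) (g (t + h))| <= e.
  apply: filterS2 (filterI H1 H2) H3 => h [h1 h2] h3.
  set f1 := f (t + h); set g1 := g (t + h).
  have f1L : L2 f1 := fL _; have g1L : L2 g1 := gL _.
  have fD := L2B f1L (fL t); have gD := L2B g1L (gL t).
  have E : ip f1 g1 - ip (f t) (g t) =
    ip (fun x => f1 x - f t x) g1 + ip (f t) (fun x => g1 x - g t x).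
    by rewrite (ipBl f1L (fL t) g1L) (ipBr g1L (gL t) (fL t)); ring.
  rewrite distrC E; apply: (le_trans (ler_normD _ _)); apply: le_trans dN; rewrite mulrDr.
  apply: lerD; first (apply: (le_trans (ip_CS fD g1L)); apply: ler_pM => //; exact: nrm_ge0).
  apply: (le_trans (ip_CS (fL t) gD)); rewrite mulrC; apply: ler_wpM2r => //; exact: nrm_ge0.
suff : \forall s \near nbhs t, `|ip (f t) (g t) - ip (f s) (g s)| <= e by [].
move/nbhs_ballP: H => [d1 /= d10 hd]; apply/nbhs_ballP; exists d1 => //= s.
have := hd (s - t); rewrite /ball/= sub0r normrN distrC (addrC t (s - t)) subrK; apply.
Qed.

Lemma contL2D f g t : (forall s, L2 (f s)) -> (forall s, L2 (g s)) ->
  contL2 f t -> contL2 g t -> contL2 (fun s x => f s x + g s x) t.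
Proof.
move=> fL gL cf cg e e0; have e2 : 0 < e / 2 by lra.
have H1 := cf _ e2; have H2 := cg _ e2; apply: filterS2 H1 H2 => h h1 h2.
have := nrm_leD (L2B (fL (t + h)) (fL t)) (L2B (gL (t + h)) (gL t))
  (_ : forall x, (f (t + h) x + g (t + h) x) - (f t x + g t x) = _) h1 h2.
by move/(_ (fun x => ltac:(ring))) => /le_trans; apply; rewrite -splitr.
Qed.

Lemma contL2Z c f t : (forall s, L2 (f s)) -> contL2 f t -> contL2 (fun s x => c * f s x) t.
Proof.
move=> fL cf e e0; have [d d0 dN] := ltr_scale_eps e0 (normr_ge0 c).
have := cf _ d0; apply: filterS => h h1.
rewrite (_ : (fun x => _) = (fun x => c * (f (t + h) x - f t x))); last first.
  by apply/funext => x; ring.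
by rewrite nrmZ; [rewrite mulrC; apply: le_trans dN; rewrite ler_wpM2r|exact: L2B].
Qed.

Lemma contL2_cst F t : contL2 (fun=> F) t.
Proof.
move=> e e0; apply: (filterS _ (near0_norm ltr01)) => h _; rewrite (_ : nrm _ = 0) ?ltW//.
by rewrite /nrm (_ : ip _ _ = 0) ?sqrtr0// -[RHS](@Itg0 R); apply: eq_Itg => x; ring.
Qed.

Lemma contL2_le f g t c : (forall s, L2 (f s)) -> 
  (forall s, nrm (fun x => g s x - g t x) <= c * nrm (fun x => f s x - f t x)) ->
  contL2 f t -> contL2 g t.
Proof.
move=> fL fg cf e e0; have [d d0 dN] := ltr_scale_eps e0 (normr_ge0 c).
have := cf _ d0; apply: filterS => h h1; apply: (le_trans (fg _)); apply: le_trans dN.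
rewrite mulrC; apply: (@le_trans _ _ (nrm (fun x => f (t + h) x - f t x) * `|c|)).
  by rewrite ler_wpM2l ?nrm_ge0// ler_norm.
by rewrite ler_wpM2r.
Qed.

Lemma contL2_frame c f f' t : (forall s, L2 (f s)) -> (forall s, L2 (f' s)) ->
  (forall s, wd (f s) (f' s)) -> contL2 f t -> contL2 (fun s x => f s (x + c * s)) t.
Proof.
move=> fL f'L ff' cf e e0; have e2 : 0 < e / 2 by lra.
have N0 : 0 <= `|c| * nrm (f' t) by rewrite mulr_ge0// nrm_ge0.
have [d d0 dN] := ltr_scale_eps e2 N0.
have H1 := cf _ e2; have H2 := near0_norm d0.
apply: filterS2 H1 H2 => h h1 h2; set ch := c * (t + h).
have fD := L2B (fL (t + h)) (fL t); have fS := L2B (L2_shift (c * h) (fL t)) (fL t).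
have h3 := translation_nrm (c * h) (fL t) (f'L t) (ff' t).
rewrite -(nrm_shift ch fD) in h1; rewrite -(nrm_shift (c * t) fS) in h3.
have := nrm_leD (L2_shift ch fD) (L2_shift (c * t) fS)
  (_ : forall x, f (t + h) (x + ch) - f t (x + c * t) = _) h1 h3.
have E x : f (t + h) (x + ch) - f t (x + c * t) =
  (f (t + h) (x + ch) - f t (x + ch)) + (f t (x + c * t + c * h) - f t (x + c * t)).
  by rewrite /ch (_ : x + c * (t + h) = x + c * t + c * h); [ring|ring].
move/(_ E) => /le_trans; apply; rewrite [leRHS]splitr lerD2l normrM.
apply: le_trans dN; rewrite (mulrC `|c|) -mulrA.
by apply: ler_wpM2r.
Qed.

Lemma wd_contsup f f' t : (forall s, L2 (f s)) -> (forall s, L2 (f' s)) ->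
  (forall s, wd (f s) (f' s)) -> contL2 f t -> contL2 f' t -> contsup f t.
Proof.
move=> fL f'L ff' cf cf' e e0; have e2 : 0 < e / 2 by lra.
have H1 := cf _ e2; have H2 := cf' _ e2; apply: filterS2 H1 H2 => h h1 h2.
have fD := L2B (fL (t + h)) (fL t); have f'D := L2B (f'L (t + h)) (f'L t).
apply: (ae_imp (wd_sup fD f'D (wdB (fL _) (f'L _) (fL _) (f'L _) (ff' _) (ff' _)))) => x Hx.
rewrite -ler_sqr ?nnegrE// ?(ltW e0)// real_normK ?num_real//.
apply: (le_trans Hx).
have := ler_pM (nrm_ge0 _) (nrm_ge0 _) h1 h2; move: (_ * _) => p; nra.
Qed.

Lemma contL2M f g t M N : (forall s, L2 (f s)) -> (forall s, L2 (g s)) ->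
  {ae mu, forall x, `|f t x| <= M} -> (\forall h \near (0 : R), {ae mu, forall x, `|g (t + h) x| <= N}) ->
  contL2 f t -> contL2 g t -> contL2 (fun s x => f s x * g s x) t.
Proof.
move=> fL gL fM gN cf cg e e0.
have [d d0 dN] := ltr_scale_eps e0 (addr_ge0 (normr_ge0 M) (normr_ge0 N)).
apply: filterS2 gN (filterI (cf _ d0) (cg _ d0)) => h gN [h1 h2].
have fD := L2B (fL (t + h)) (fL t); have gD := L2B (gL (t + h)) (gL t).
have b1 := nrmM (L2_measurable (gL _)) gN fD.
have b2 := nrmM (L2_measurable (fL _)) fM gD.
have := nrm_leD (L2M_ae (L2_measurable (fL _)) fM gD) (L2M_ae (L2_measurable (gL _)) gN fD)
  (_ : forall x, f (t + h) x * g (t + h) x - f t x * g t x = _) b2 b1.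
move/(_ (fun x => ltac:(ring))) => /le_trans; apply; apply: le_trans dN; rewrite mulrDr.
by rewrite !(mulrC d); apply: lerD; rewrite ler_wpM2l.
Qed.

Lemma contsup_bounded g t N : {ae mu, forall x, `|g t x| <= N} -> contsup g t ->
  \forall h \near (0 : R), {ae mu, forall x, `|g (t + h) x| <= N + 1}.
Proof.
move=> gN cg; have := cg 1 ltr01; apply: filterS => h h1.
apply: (ae_imp (ae_and gN h1)) => x [p q].
have := ler_normD (g t x) (g (t + h) x - g t x); rewrite addrC subrK; lra.
Qed.

(** With df, dg the increments, the remainder is (df - h F) g(t+h) + f(t) (dg - h G) + h F dg. As
    [F] is only in L^2, the last term calls for continuity of [g] in the sup norm. *)
Lemma diffL2M f g t F G M N : (forall s, L2 (f s)) -> (forall s, L2 (g s)) ->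
  L2 F -> L2 G ->
  {ae mu, forall x, `|f t x| <= M} -> {ae mu, forall x, `|g t x| <= N} ->
  contsup g t -> diffL2 f t F -> diffL2 g t G ->
  diffL2 (fun s x => f s x * g s x) t (fun x => F x * g t x + f t x * G x).
Proof.
move=> fL gL FL GL fM gN cg fF gG e e0.
have gN1 := contsup_bounded gN cg.
have N0 : 0 <= `|N + 1| + `|M| + nrm F by rewrite !addr_ge0 ?nrm_ge0.
have [d d0 dN] := ltr_scale_eps e0 N0.
apply: filterS2 (filterI gN1 (cg _ d0)) (filterI (fF _ d0) (gG _ d0)) => h [gN' gd] [h1 h2].
have fR := L2B (L2B (fL (t + h)) (fL t)) (L2Z h FL).
have gD := L2B (gL (t + h)) (gL t); have gR := L2B gD (L2Z h GL).
have mg := L2_measurable (gL (t + h)); have mf := L2_measurable (fL t).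
have mD := L2_measurable gD.
have b1 := le_trans (nrmM mg gN' fR) (ler_wpM2l (normr_ge0 _) h1).
have b2 := le_trans (nrmM mf fM gR) (ler_wpM2l (normr_ge0 _) h2).
have b3 := nrmM mD gd (L2Z h FL); rewrite (gtr0_norm d0) nrmZ// in b3.
have l1 := L2M_ae mg gN' fR; have l2 := L2M_ae mf fM gR; have l3 := L2M_ae mD gd (L2Z h FL).
have := nrm_leD (L2D l1 l2) l3 (_ : forall x, f (t + h) x * g (t + h) x - f t x * g t x -
  h * (F x * g t x + f t x * G x) = _) (nrm_leD l1 l2 (fun=> erefl _) b1 b2) b3.
move/(_ (fun x => ltac:(ring))) => /le_trans; apply.
rewrite (_ : _ + _ = d * (`|N + 1| + `|M| + nrm F) * `|h|); last by ring.
by rewrite ler_wpM2r.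
Qed.

(** The operator 1 - b d^2/dx^2 on test functions. It preserves compact support, which its inverse
    does not. *)
Definition Rho b (chi : R -> R) : R -> R :=
  fun x => chi x - b * chi^`()%classic^`()%classic x.

Lemma L2_Rho b chi : test_function chi -> L2 (Rho b chi).
Proof.
move=> tc; apply: L2B; first exact: test_L2.
by apply/L2Z/test_L2; do 2 apply: test_derive1.
Qed.

(** Density of the functions [Rho b chi] in L^2: two derivatives of the mollified A F converge, and
    A F - b (A F)'' is F. *)
Lemma Rho_cvg b F : 0 < b -> L2 F -> cvgL2 (fun n => Rho b (moll n (Aop b F))) F.
Proof.
move=> b0 FL; have AL := L2_Aop b0 FL; have KL := L2_Kop b0 FL.
have BL := L2Z b^-1 (L2B AL FL).
have c1 := moll_cvg AL.
have c2 := moll_cvg2 AL KL BL (Aop_wd b0 FL) (Kop_wd b0 FL).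
have tn n := moll_test n AL.
have L2n n : L2 (moll n (Aop b F))^`()%classic^`()%classic.
  by apply: test_L2; do 2 apply: test_derive1.
have mc : measurable_fun setT (fun _ : R => - b) by exact: measurable_cst.
have bn x : `|(fun _ : R => - b) x| <= `|b| by rewrite normrN.
have c3 := cvgL2M mc bn L2n BL c2.
have := cvgL2D (fun n => test_L2 (tn n)) (fun n => L2Z (- b) (L2n n)) AL (L2Z (- b) BL) c1 c3.
rewrite (_ : (fun x => Aop b F x + _) = F); last first.
  by apply/funext => x; field; rewrite gt_eqF.
by apply: eq_cvgL2 => n x; rewrite /Rho mulNr.
Qed.

(* The mean value theorem for the pairings bounds the remainder tested against
   [Rho b chi], and these functions are dense in L^2. *)
Lemma weak_diffL2 b f g t : 0 < b -> (forall s, L2 (f s)) -> (forall s, L2 (g s)) ->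
  (forall chi, test_function chi -> forall s : R,
    is_derive s (1 : R) (fun s => ip (f s) (Rho b chi)) (ip (g s) (Rho b chi))) ->
  contL2 g t -> diffL2 f t (g t).
Proof.
move=> b0 fL gL fg cg e e0; have := cg e e0; move=> /nbhs_ballP[d /= d0 hd].
apply/nbhs_ballP; exists d => //= h; rewrite /ball/= sub0r normrN => hh.
set D := fun x => _.
have DL : L2 D by apply: L2B; [exact: L2B|exact: L2Z].
have H chi : test_function chi -> `|ip D (Rho b chi)| <= e * `|h| * nrm (Rho b chi).
  move=> tc; have rL := L2_Rho b tc.
  have [z zt zE] := @mvt_is_derive _ _ t (t + h) (fg _ tc).
  rewrite (_ : t + h - t = h) in zt zE; last by ring.
  have gD := L2B (gL z) (gL t).
  have -> : ip D (Rho b chi) = h * ip (fun x => g z x - g t x) (Rho b chi).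
    rewrite /D (ipBl (L2B (fL _) (fL t)) (L2Z h (gL t)) rL) (ipBl (fL _) (fL t) rL).
    by rewrite zE (ipZl h (gL t) rL) (ipBl (gL z) (gL t) rL); ring.
  rewrite normrM (mulrC e) -mulrA; apply: ler_wpM2l => //.
  apply: (le_trans (ip_CS gD rL)); apply: ler_wpM2r; first exact: nrm_ge0.
  have := hd (z - t); rewrite /ball/= sub0r normrN (addrC t) subrK; apply.
  exact: le_lt_trans zt hh.
(* [Rho b chi] now tends to the remainder [D] itself, so |D|^2 <= e |h| |D|, and one factor |D|
   cancels. *)
have AL := L2_Aop b0 DL.
have rL n := L2_Rho b (moll_test n AL).
have cv := Rho_cvg b0 DL.
have c1 := cvgL2_ip (fun=> DL) rL DL DL (cvgL2_cst D) cv.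
have c2 : e * `|h| * nrm (Rho b (moll n (Aop b D))) @[n --> \oo] --> e * `|h| * nrm D.
  by apply: cvgM; [exact: cvg_cst|exact: cvgL2_nrm].
have : ip D D <= e * `|h| * nrm D.
  rewrite -(cvg_lim _ c1)// -(cvg_lim _ c2)//.
  apply: ler_lim; [by apply/cvg_ex; eexists; exact: c1|by apply/cvg_ex; eexists; exact: c2|].
  by apply: nearW => n; apply: (le_trans (ler_norm _)); apply: H; exact: moll_test.
rewrite -nrm_sqr; have := nrm_ge0 D; rewrite le_eqVlt => /predU1P[<- _|n0].
  by rewrite mulr_ge0// ltW.
by rewrite expr2 ler_pM2r.
Qed.

Lemma is_derive_continuous w w' : (forall x : R, is_derive x (1 : R) w (w' x)) -> continuous w.
Proof.
move=> d x; apply: differentiable_continuous; apply/derivable1_diffP; by have [] := d x.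
Qed.

Lemma taylor2_bound w w' w'' M (x h : R) : (forall x : R, is_derive x (1 : R) w (w' x)) ->
  (forall x : R, is_derive x (1 : R) w' (w'' x)) -> (forall x, `|w'' x| <= M) ->
  `|w (x + h) - w x - h * w' x| <= M * `|h| ^+ 2.
Proof.
move=> d1 d2 wM; have [z zx zE] := @mvt_is_derive w w' x (x + h) d1.
have [y _ yE] := @mvt_is_derive w' w'' x z d2.
rewrite (_ : x + h - x = h) in zx zE; last by ring.
rewrite zE -mulrBr yE !normrM expr2 mulrA (mulrC M).
apply: ler_pM; rewrite ?mulr_ge0//.
by rewrite ler_wpM2l.
Qed.

Lemma measurable_weight w w' s : (forall x : R, is_derive x (1 : R) w (w' x)) ->
  measurable_fun setT (fun x : R => w (x - s)).
Proof.
move=> d; apply: continuous_measurable => x; apply: continuous_comp.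
  by apply: cvgB; [exact: cvg_id|exact: cvg_cst].
exact: (is_derive_continuous d).
Qed.

(** Three remainders, each given a third of the tolerance: that of [f] times the new weight, the
    change of weight (first order in h) times h F, and the second-order Taylor remainder of the
    weight times f t. *)
Lemma diffL2_weight w w' w'' M s f F t : (forall x : R, is_derive x (1 : R) w (w' x)) ->
  (forall x : R, is_derive x (1 : R) w' (w'' x)) ->
  (forall x, `|w x| <= M) -> (forall x, `|w' x| <= M) -> (forall x, `|w'' x| <= M) ->
  (forall s, L2 (f s)) -> L2 F -> diffL2 f t F ->
  diffL2 (fun r x => w (x - s * r) * f r x) t
    (fun x => w (x - s * t) * F x - s * (w' (x - s * t) * f t x)).
Proof.
move=> d1 d2 w0 w1 w2 fL FL fF e e0.
have M0 : 0 <= M by apply: le_trans (w0 0).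
have n0 := nrm_ge0 F; have n1 := nrm_ge0 (f t).
have e3 : 0 < e / 3 by rewrite divr_gt0.
have [d d0 dN] := ltr_scale_eps e3 M0.
have [k k0 kN] := ltr_scale_eps e3 (mulr_ge0 M0 (mulr_ge0 (normr_ge0 s) n0)).
have [l l0 lN] := ltr_scale_eps e3 (mulr_ge0 M0 (mulr_ge0 (sqr_ge0 `|s|) n1)).
apply: filterS2 (fF _ d0) (filterI (near0_norm k0) (near0_norm l0)) => h h1 [h2 h3].
have mw r := measurable_weight r d1; have mw' r := measurable_weight r d2.
have fR := L2B (L2B (fL (t + h)) (fL t)) (L2Z h FL).
have aw r : {ae mu, forall x, `|w (x - r)| <= M} by apply: ae_all => x.
pose st := s * t; pose sh := s * (t + h).
have aw2 : {ae mu, forall x, `|w (x - sh) - w (x - st)| <= M * (`|s| * `|h|)}.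
  apply: ae_all => x.
  have [z _ ->] := @mvt_is_derive w w' (x - st) (x - sh) d1.
  rewrite normrM mulrC; apply: ler_pM => //.
  by rewrite (_ : _ - _ = - (s * h)) ?normrN ?normrM///sh/st; ring.
have aw3 : {ae mu, forall x, `|w (x - sh) - w (x - st) + h * s * w' (x - st)| <=
    M * (`|s| * `|h|) ^+ 2}.
  apply: ae_all => x; have := @taylor2_bound w w' w'' M (x - st) (- (s * h)) d1 d2 w2.
  rewrite normrN normrM (_ : x - st - s * h = x - sh); last by rewrite /sh/st; ring.
  by rewrite (_ : _ - _ - _ = w (x - sh) - w (x - st) + h * s * w' (x - st))//; ring.
have m2 : measurable_fun setT (fun x : R => w (x - sh) - w (x - st)) by exact: measurable_funB.
have m3 : measurable_fun setT (fun x : R => w (x - sh) - w (x - st) + h * s * w' (x - st)).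
  by apply: measurable_funD => //; apply: measurable_funM => //; exact: measurable_cst.
have hF := L2Z h FL.
have b1 := le_trans (nrmM (mw sh) (aw sh) fR) (ler_wpM2l (normr_ge0 _) h1).
have b2 := nrmM m2 aw2 hF; have b3 := nrmM m3 aw3 (fL t).
have l1 := L2M_ae (mw sh) (aw sh) fR; have l2 := L2M_ae m2 aw2 hF.
have l3 := L2M_ae m3 aw3 (fL t).
have := nrm_leD (L2D l1 l2) l3 (_ : forall x, w (x - sh) * f (t + h) x - w (x - st) * f t x -
  h * (w (x - st) * F x - s * (w' (x - st) * f t x)) = _)
  (nrm_leD l1 l2 (fun=> erefl _) b1 b2) b3.
move/(_ (fun x => ltac:(ring))) => /le_trans; apply.
rewrite (nrmZ h FL) (ger0_norm M0) (ger0_norm (mulr_ge0 M0 (mulr_ge0 _ _)))//.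
rewrite (ger0_norm (mulr_ge0 M0 (sqr_ge0 _))).
move: (nrm F) (nrm (f t)) n0 n1 kN lN {b1 b2 b3} => nF nf n0 n1 kN lN.
have E : e * `|h| = e / 3 * `|h| + e / 3 * `|h| + e / 3 * `|h| by field.
rewrite E; apply: lerD; [apply: lerD|].
- by rewrite mulrCA mulrA ler_wpM2r.
- rewrite (_ : _ * _ = `|h| * (M * (`|s| * nF)) * `|h|); last by ring.
  apply: ler_wpM2r => //; apply: le_trans kN; apply: ler_wpM2r => //.
  by rewrite !mulr_ge0.
- rewrite (_ : _ * _ = `|h| * (M * (`|s| ^+ 2 * nf)) * `|h|); last by ring.
  apply: ler_wpM2r => //; apply: le_trans lN; apply: ler_wpM2r => //.
  by rewrite !mulr_ge0// sqr_ge0.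
Qed.

End L2_calculus.

(** * From the distributional system to ordinary derivatives of pairings *)

Section plane_test_functions.
Context {R : realType}.
Implicit Types (s k : R) (h theta chi : R -> R) (p v : R * R).

Let lin (al be : R) : R * R -> R := fun p => al * p.1 + be * p.2.

Let lin_derive al be v : 'D_v (lin al be) = cst (lin al be v).
Proof.
apply/funext => p; apply/cvg_lim => //; apply: cvg_near_cst.
near=> h; have h0 : h != 0 by near: h; exact: nbhs_dnbhs_neq.
rewrite -[(lin al be \o shift p) (h *: v)]/(al * (h * v.1 + p.1) + be * (h * v.2 + p.2)).
rewrite -[lin al be p]/(al * p.1 + be * p.2) -[cst _ p]/(al * v.1 + be * v.2).
rewrite -[h^-1 *: _]/(h^-1 * _); field; exact: h0.
Unshelve. all: by end_near. Qed.

Let fst_differentiable p : differentiable (fst : R * R -> R) p.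
Proof. by apply: linear_differentiable => q; exact: cvg_fst. Qed.

Let snd_differentiable p : differentiable (snd : R * R -> R) p.
Proof. by apply: linear_differentiable => q; exact: cvg_snd. Qed.

Let lin_differentiable al be p : differentiable (lin al be) p.
Proof.
by apply: differentiableD; apply: differentiableM.
Qed.

Let comp_derive h al be v p : smooth h ->
  'D_v (h \o lin al be) p = lin al be v * h^`()%classic (lin al be p).
Proof.
move=> sh; have dh := smooth_differentiable (lin al be p) sh.
rewrite (derive_comp1 _ (lin_differentiable al be p) dh) derive1E mulrC; congr (_ * _).
by have := congr1 (@^~ p) (lin_derive al be v).
Qed.

(** The function theta(t) chi(x - s t), a fixed profile in the frame of speed s. Compositions with
    linear forms put it in [smooth_algebra]. *)
Definition moving_test s theta chi : R * R -> R :=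
  (theta \o lin 1 0) * (chi \o lin (- s) 1).

Lemma moving_testE s theta chi t x :
  moving_test s theta chi (t, x) = theta t * chi (x - s * t).
Proof.
rewrite -[LHS]/(theta (1 * t + 0 * x) * chi (- s * t + 1 * x)).
by rewrite mul0r !mul1r addr0 mulNr addrC.
Qed.

Lemma moving_test_derive s theta chi v p : smooth theta -> smooth chi ->
  'D_v (moving_test s theta chi) p = v.1 * moving_test s theta^`()%classic chi p +
    (v.2 - s * v.1) * moving_test s theta chi^`()%classic p.
Proof.
move=> st sc.
have dt q : differentiable (theta \o lin 1 0) q.
  by apply: differentiable_comp => //; exact: smooth_differentiable.
have dc q : differentiable (chi \o lin (- s) 1) q.
  by apply: differentiable_comp => //; exact: smooth_differentiable.
rewrite deriveM; [|exact: diff_derivable..].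
rewrite (comp_derive _ _ _ _ st) (comp_derive _ _ _ _ sc) /moving_test.
rewrite -[((theta^`()%classic \o _) * _) p]/(theta^`()%classic (lin 1 0 p) * chi (lin (- s) 1 p)).
rewrite -[((theta \o _) * (chi^`()%classic \o _)) p]/(theta (lin 1 0 p) * chi^`()%classic (lin (- s) 1 p)).
rewrite -[(theta \o _) p]/(theta (lin 1 0 p)) -[(chi \o _) p]/(chi (lin (- s) 1 p)).
rewrite -[lin 1 0 v]/(1 * v.1 + 0 * v.2) -[lin (- s) 1 v]/(- s * v.1 + 1 * v.2).
rewrite /GRing.scale/=; ring.
Qed.

Lemma moving_test_smooth s theta chi : smooth theta -> smooth chi ->
  smooth (moving_test s theta chi).
Proof.
move=> st sc; apply: smooth_algebra_smooth; apply: smooth_algebraM.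
- by apply: smooth_algebra_comp => // v; exists (lin 1 0 v); rewrite lin_derive.
- by apply: smooth_algebra_comp => // v; exists (lin (- s) 1 v); rewrite lin_derive.
Qed.

Lemma moving_test_test s theta chi : test_function theta -> test_function chi ->
  test_function (moving_test s theta chi).
Proof.
move=> tt tc; split; first by apply: moving_test_smooth; exact: test_smooth.
have [r r0 tr] := csupp_pos (test_csupp tt); have [q q0 cq] := csupp_pos (test_csupp tc).
(* On the support |t| < r and |x - s t| < q, hence |x| <= q + |s| r. *)
pose l := q + `|s| * r.
pose I : set R := `[- r, r]%classic; pose J : set R := `[- l, l]%classic.
apply: (@subclosed_compact _ _ (I `*` J)).
- exact: closed_closure.
- by apply: compact_setX; exact: segment_compact.
- have cIJ : closed (I `*` J).
    have -> : I `*` J = (fst @^-1` I) `&` (snd @^-1` J) by [].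
    apply: closedI; apply: preimage_closed.
    + by move=> p _; exact: cvg_fst.
    + exact: interval_closed.
    + by move=> p _; exact: cvg_snd.
    + exact: interval_closed.
  rewrite ((closure_id _).1 cIJ); apply: closure_subset => -[t x] /=.
  rewrite moving_testE mulf_eq0 negb_or => /andP[h1 h2].
  have tI : `|t| < r by rewrite ltNge; apply/negP => /tr E; rewrite E eqxx in h1.
  have xI : `|x - s * t| < q by rewrite ltNge; apply/negP => /cq E; rewrite E eqxx in h2.
  split; rewrite /I /J /= in_itv/= -ler_norml; first exact: ltW.
  have := ler_normD (x - s * t) (s * t); rewrite subrK => /le_trans; apply.
  rewrite /l lerD ?(ltW xI)// normrM ler_wpM2l//; exact: ltW.
Qed.

Lemma moving_test_dx s theta chi p : smooth theta -> smooth chi ->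
  dx (moving_test s theta chi) p = moving_test s theta chi^`()%classic p.
Proof. by move=> st sc; rewrite /dx moving_test_derive//= mul0r add0r mulr0 subr0 mul1r. Qed.

Lemma moving_test_dt s theta chi p : smooth theta -> smooth chi ->
  dt (moving_test s theta chi) p = moving_test s theta^`()%classic chi p
    - s * moving_test s theta chi^`()%classic p.
Proof. by move=> st sc; rewrite /dt moving_test_derive//= mul1r sub0r mulr1 mulNr. Qed.

Lemma moving_test_dxx s theta chi p : smooth theta -> smooth chi ->
  dx (dx (moving_test s theta chi)) p = moving_test s theta chi^`()%classic^`()%classic p.
Proof.
move=> st sc; have -> : dx (moving_test s theta chi) = moving_test s theta chi^`()%classic.
  by apply/funext => q; exact: moving_test_dx.
by apply: moving_test_dx => //; exact: smooth_derive1.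
Qed.

Lemma moving_test_dxxx s theta chi p : smooth theta -> smooth chi ->
  dx (dx (dx (moving_test s theta chi))) p =
  moving_test s theta chi^`()%classic^`()%classic^`()%classic p.
Proof.
move=> st sc; have -> : dx (moving_test s theta chi) = moving_test s theta chi^`()%classic.
  by apply/funext => q; exact: moving_test_dx.
by apply: moving_test_dxx => //; exact: smooth_derive1.
Qed.

Lemma moving_test_dxxt s theta chi p : smooth theta -> smooth chi ->
  dx (dx (dt (moving_test s theta chi))) p =
  moving_test s theta^`()%classic chi^`()%classic^`()%classic p
    - s * moving_test s theta chi^`()%classic^`()%classic^`()%classic p.
Proof.
move=> st sc; have st' := smooth_derive1 st; have sc' := smooth_derive1 sc.
have dxL f g : (forall q, differentiable f q) -> (forall q, differentiable g q) ->
    dx (fun q : R * R => f q - s * g q) = fun q => dx f q - s * dx g q.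
  move=> df dg; apply/funext => q; rewrite /dx.
  have -> : (fun q : R * R => f q - s * g q) = f - s *: g by [].
  rewrite deriveB; [|exact: diff_derivable|by apply: derivableZ; exact: diff_derivable].
  by rewrite deriveZ//; exact: diff_derivable.
have df a b : smooth a -> smooth b -> forall q, differentiable (moving_test s a b) q.
  by move=> sa sb q; apply: smooth_differentiable; exact: moving_test_smooth.
have dxE a b : smooth a -> smooth b -> dx (moving_test s a b) = moving_test s a b^`()%classic.
  by move=> sa sb; apply/funext => q; exact: moving_test_dx.
have -> : dt (moving_test s theta chi) = fun q => moving_test s theta^`()%classic chi q
    - s * moving_test s theta chi^`()%classic q.
  by apply/funext => q; exact: moving_test_dt.
have sc2 := smooth_derive1 sc'.
rewrite (dxL _ _ (df _ _ st' sc) (df _ _ st sc')) !dxE//.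
by rewrite (dxL _ _ (df _ _ st' sc') (df _ _ st sc2)) !dxE.
Qed.

End plane_test_functions.

Section pairing.
Context {R : realType}.
Local Notation mu := (@lebesgue_measure R).
Local Notation L2 := (@L2 R).
Local Notation wd := is_weak_derivative.
Variables (b kappa : R) (b0 : 0 < b).
Implicit Types (f g q : R -> R -> R) (chi theta : R -> R).

Lemma eq_contL2 f g t : (forall s x, f s x = g s x) -> contL2 f t -> contL2 g t.
Proof. by move=> fg; rewrite (_ : f = g)//; apply/funext => s; exact/funext. Qed.

Lemma eq_diffL2 f g t F G : (forall s x, f s x = g s x) -> (forall x, F x = G x) ->
  diffL2 f t F -> diffL2 g t G.
Proof.
move=> fg FG; rewrite (_ : f = g); last by apply/funext => s; exact/funext.
by rewrite (_ : F = G)//; exact/funext.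
Qed.

Lemma Rho_test chi : test_function chi -> test_function (Rho b chi).
Proof.
move=> tc; have tc2 := test_derive1 (test_derive1 tc).
have := testZ (- b) tc2 => tb.
have [r r0 cr] := csupp_pos (test_csupp tc); have [r' r'0 cr'] := csupp_pos (test_csupp tc2).
apply: csupp_test.
  have -> : Rho b chi = chi + (- b) *: chi^`()%classic^`()%classic.
    by apply/funext => x; rewrite /Rho -mulNr.
  apply/smooth_algebra_smooth/smooth_algebraD; apply: smooth_smooth_algebra.
    exact: test_smooth.
  exact: test_smooth.
exists (Num.max r r') => x; rewrite ge_max => /andP[h1 h2].
by rewrite /Rho cr// cr'// mulr0 subrr.
Qed.

Lemma Rho_derive chi x : test_function chi -> (Rho b chi)^`()%classic x = Rho b chi^`()%classic x.
Proof.
move=> tc; have tc2 := test_derive1 (test_derive1 tc).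
rewrite derive1E.
have d1 := smooth_is_derive x (test_smooth tc).
have d2 := smooth_is_derive x (test_smooth tc2).
have d3 := is_deriveZ (- b) d2.
have -> : Rho b chi = chi + (- b) *: chi^`()%classic^`()%classic.
  by apply/funext => z; rewrite /Rho -mulNr.
have [_ ->] := is_deriveD d1 d3.
by rewrite /Rho -mulNr.
Qed.

Lemma wd_Rho (f f' : R -> R) chi : L2 f -> L2 f' -> wd f f' -> test_function chi ->
  ip f (Rho b chi^`()%classic) = - ip f' (Rho b chi).
Proof.
move=> fL f'L ff' tc; rewrite -(wdP f f').1//; last exact: Rho_test.
by apply: eq_Itg => x; rewrite Rho_derive.
Qed.

(** (1 - b d^2/dx^2) K = d/dx, so testing with [Rho b chi] makes the nonlocal term local. *)
Lemma Kop_Rho m c chi : L2 m -> test_function chi ->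
  ip (fun x => Kop b m (x + c)) (Rho b chi) = - ip (fun x => m (x + c)) chi^`()%classic.
Proof.
move=> mL tc; have AL := L2_Aop b0 mL; have KL := L2_Kop b0 mL.
have BL := L2Z b^-1 (L2B AL mL).
have h1 := (wdP _ _).1 (wd_shift c AL KL (Aop_wd b0 mL)) _ tc.
have tc1 := test_derive1 tc; have tc2 := test_derive1 tc1.
have h2 := (wdP _ _).1 (wd_shift c KL BL (Kop_wd b0 mL)) _ tc1.
have sA := L2_shift c AL; have sK := L2_shift c KL; have sm := L2_shift c mL.
have c0 := test_L2 tc; have c1 := test_L2 tc1; have c2 := test_L2 tc2.
rewrite /Rho (ipBr c0 (L2Z b c2) sK) (ipZr b c2 sK) h2.
rewrite (ipZl b^-1 (L2B sA sm) c1) (ipBl sA sm c1) h1.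
by field; rewrite gt_eqF.
Qed.

Lemma ip_shift F G c : L2 F -> L2 G ->
  ip (fun x => F (x + c)) G = ip F (fun x => G (x - c)).
Proof.
move=> FL GL; have mG := L2_measurable (L2_shift (- c) GL).
rewrite /ip -(Itg_shift c (measurable_funM (L2_measurable FL) mG)).
by apply: eq_Itg => x; rewrite -[RHS]/(F (x + c) * G (x + c - c)) addrK.
Qed.

(** Since a = c, both equations have this form, with (f, g, q) equal to (eta, u, u eta) and to (u,
    eta, u^2 / 2). *)
Definition weak_equation a f g q := forall phi : R * R -> R, test_function phi ->
  \int[mu]_t (\int[mu]_x
    (f t x * (dt phi (t, x) - b * dx (dx (dt phi)) (t, x))
     + a * g t x * dx (dx (dx phi)) (t, x) + (g t x + q t x) * dx phi (t, x))) = 0.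

(** With a = - kappa b one has a g_xx + g = kappa (g - b g_xx) + (1 - kappa) g. After inversion of 1
    - b d^2/dx^2 the first part is the local transport term kappa g_x; the rest, with [q], is
    smoothed by [A]. *)
Definition source g q t x := (1 - kappa) * g t x + q t x.

(** The value of f_t + s f_x, the time derivative seen in the frame moving at speed s. *)
Definition rhs s f' g' g q t x :=
  s * f' t x - kappa * g' t x - Kop b (source g q t) x.

Section fixed_equation.
Variables f g q f' g' : R -> R -> R.
Hypotheses (fL : forall t, L2 (f t)) (gL : forall t, L2 (g t)) (qL : forall t, L2 (q t)).
Hypotheses (f'L : forall t, L2 (f' t)) (g'L : forall t, L2 (g' t)).
Hypotheses (ff' : forall t, wd (f t) (f' t)) (gg' : forall t, wd (g t) (g' t)).

Lemma L2_source t : L2 (source g q t).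
Proof. by apply: L2D => //; exact: L2Z. Qed.

Lemma L2_rhs s t : L2 (rhs s f' g' g q t).
Proof.
apply: L2B; last exact/L2_Kop/L2_source.
by apply: L2B; exact: L2Z.
Qed.

Let pairing_arith (th' th s k p c x y x' y' : R) : x' = - x -> y' = - y ->
  th' * p + th * (s * x - k * y - - c) = th' * p + th * (- s * x' + k * y' + c).
Proof. by move=> -> ->; ring. Qed.

Let inner_sum c th' th s (F G M r r1 c1 : R -> R) :
  L2 F -> L2 G -> L2 M -> L2 r -> L2 r1 -> L2 c1 ->
  th' * ip (fun x => F (x + c)) r + th * (- s * ip (fun x => F (x + c)) r1 +
    kappa * ip (fun x => G (x + c)) r1 + ip (fun x => M (x + c)) c1) =
  Itg (fun x => th' * (F x * r (x - c)) + th * (- s * (F x * r1 (x - c)) +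
    kappa * (G x * r1 (x - c)) + M x * c1 (x - c))).
Proof.
move=> FL GL ML rL r1L c1L.
rewrite (ip_shift c FL rL) (ip_shift c FL r1L) (ip_shift c GL r1L) (ip_shift c ML c1L).
have rS := L2_shift (- c) rL; have r1S := L2_shift (- c) r1L; have c1S := L2_shift (- c) c1L.
have i1 := itgZ th' (itgM FL rS).
have i2 := itgZ (- s) (itgM FL r1S); have i3 := itgZ kappa (itgM GL r1S).
have i4 := itgM ML c1S.
by rewrite (ItgD i1 (itgZ _ (itgD (itgD i2 i3) i4))) (ItgZ th' (itgM FL rS))
  (ItgZ th (itgD (itgD i2 i3) i4)) (ItgD (itgD i2 i3) i4) (ItgD i2 i3)
  (ItgZ (- s) (itgM FL r1S)) (ItgZ kappa (itgM GL r1S)).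
Qed.

Let integrand_arith (th' th s F G Q k0 k1 k2 k3 d dxxt dxxx dx : R) :
  d = th' * k0 - s * (th * k1) -> dxxt = th' * k2 - s * (th * k3) ->
  dxxx = th * k3 -> dx = th * k1 ->
  th' * (F * (k0 - b * k2)) + th * (- s * (F * (k1 - b * k3)) +
    kappa * (G * (k1 - b * k3)) + ((1 - kappa) * G + Q) * k1) =
  F * (d - b * dxxt) + - (kappa * b) * G * dxxx + (G + Q) * dx.
Proof. by move=> -> -> -> ->; ring. Qed.

(** The distributional equation tested with [moving_test s theta chi]. For each t the factor 1 - b
    d^2/dx^2 falls on the profile and forms [Rho b chi]; weak derivatives then bring [f'] and [g']
    back. *)
Lemma weak_pairing s theta chi : weak_equation (- (kappa * b)) f g q ->
  test_function theta -> test_function chi ->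
  Itg (fun t => theta^`()%classic t * ip (fun x => f t (x + s * t)) (Rho b chi) +
    theta t * ip (fun x => rhs s f' g' g q t (x + s * t)) (Rho b chi)) = 0.
Proof.
move=> H tt tc; have := H _ (moving_test_test s tt tc) => H0.
rewrite -[RHS]H0; apply: eq_Itg => t; set c := s * t.
have st := test_smooth tt; have sc := test_smooth tc.
have tc1 := test_derive1 tc; have tc2 := test_derive1 tc1; have tc3 := test_derive1 tc2.
have c1L := test_L2 tc1.
have rL := L2_Rho b tc; have r1L := L2_Rho b tc1.
have mL := L2_source t.
have KL := L2_Kop b0 mL.
have fs := L2_shift c (fL t); have gs := L2_shift c (gL t); have ms := L2_shift c mL.
have f's := L2_shift c (f'L t); have g's := L2_shift c (g'L t); have Ks := L2_shift c KL.
rewrite /rhs (ipBl (L2B (L2Z s f's) (L2Z kappa g's)) Ks rL).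
rewrite (ipBl (L2Z s f's) (L2Z kappa g's) rL) (ipZl s f's rL) (ipZl kappa g's rL).
rewrite (Kop_Rho c mL tc).
have h1 := wd_Rho fs f's (wd_shift c (fL t) (f'L t) (ff' t)) tc.
have h2 := wd_Rho gs g's (wd_shift c (gL t) (g'L t) (gg' t)) tc.
transitivity (theta^`()%classic t * ip (fun x => f t (x + c)) (Rho b chi) + theta t *
  ((- s) * ip (fun x => f t (x + c)) (Rho b chi^`()%classic) +
   kappa * ip (fun x => g t (x + c)) (Rho b chi^`()%classic) +
   ip (fun x => source g q t (x + c)) chi^`()%classic)).
  exact: (pairing_arith _ _ s kappa _ _ h1 h2).
rewrite (inner_sum c _ _ s (fL t) (gL t) mL rL r1L c1L).
apply: eq_Itg => x.
have E1 := moving_test_dt s (t, x) st sc; have E2 := moving_test_dxxt s (t, x) st sc.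
have E3 := moving_test_dxxx s (t, x) st sc; have E4 := moving_test_dx s (t, x) st sc.
rewrite !moving_testE in E1 E2 E3 E4.
exact: (integrand_arith _ _ _ E1 E2 E3 E4).
Qed.

End fixed_equation.

(** Moving the shift to the fixed smooth factor [Rho b chi] shows that both pairings are continuous
    in time, so the weak derivative in t is classical. *)
Lemma pairing_derive f g q f' g' s chi t :
  (forall t, L2 (f t)) -> (forall t, L2 (g t)) -> (forall t, L2 (q t)) ->
  (forall t, L2 (f' t)) -> (forall t, L2 (g' t)) ->
  (forall t, wd (f t) (f' t)) -> (forall t, wd (g t) (g' t)) ->
  (forall t, contL2 f t) -> (forall t, contL2 (rhs s f' g' g q) t) ->
  weak_equation (- (kappa * b)) f g q -> test_function chi ->
  is_derive t (1 : R) (fun r => ip (fun x => f r (x + s * r)) (Rho b chi))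
    (ip (fun x => rhs s f' g' g q t (x + s * t)) (Rho b chi)).
Proof.
move=> fL gL qL f'L g'L ff' gg' cf cr H tc.
have rL := L2_Rho b tc; have r1L := test_L2 (test_derive1 (Rho_test tc)).
have FL := L2_rhs gL qL f'L g'L s.
have cm r : contL2 (fun p x => Rho b chi (x - s * p)) r.
  have := @contL2_frame _ (- s) (fun=> Rho b chi) (fun=> (Rho b chi)^`()%classic) r
    (fun=> rL) (fun=> r1L) (fun=> smooth_wd (test_smooth (Rho_test tc))) (contL2_cst _ _).
  by apply: eq_contL2 => p x; rewrite mulNr.
have cont F : (forall r, L2 (F r)) -> (forall r, contL2 F r) ->
    continuous (fun r => ip (fun x => F r (x + s * r)) (Rho b chi)).
  move=> FL' cF r; have -> : (fun r => ip (fun x => F r (x + s * r)) (Rho b chi)) =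
      fun r => ip (F r) (fun x => Rho b chi (x - s * r)).
    by apply/funext => p; exact: ip_shift.
  exact: (@contL2_ip _ F (fun p x => Rho b chi (x - s * p)) r FL'
    (fun p => L2_shift (- (s * p)) rL) (cF r) (cm r)).
apply: (weak_derivative_is_derive (B := fun t => ip (fun x => rhs s f' g' g q t (x + s * t)) (Rho b chi))).
- exact: cont.
- exact: cont.
- by move=> theta tt; exact: weak_pairing.
Qed.

End pairing.

(** * The energy identity *)

Section weighted_derive.
Context {R : realType}.
Local Notation L2 := (@L2 R).

Definition frame (c : R) (f : R -> R -> R) : R -> R -> R := fun t x => f t (x + c * t).

(** In the frame of speed c, where [f] and [g] are differentiable, the weight moves at speed s - c.
    By translation invariance of the integral the result is read back in the frame at rest. *)
Lemma weighted_derive (w w' w'' : R -> R) (M s c : R) (f g : R -> R -> R) (F G : R -> R) t :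
  (forall x : R, is_derive x (1 : R) w (w' x)) ->
  (forall x : R, is_derive x (1 : R) w' (w'' x)) ->
  (forall x, `|w x| <= M) -> (forall x, `|w' x| <= M) -> (forall x, `|w'' x| <= M) ->
  (forall t, L2 (f t)) -> (forall t, L2 (g t)) -> L2 F -> L2 G ->
  diffL2 (frame c f) t (fun x => F (x + c * t)) ->
  diffL2 (frame c g) t (fun x => G (x + c * t)) ->
  is_derive t (1 : R) (fun r => Itg (fun x => w (x - s * r) * (f r x * g r x)))
    (Itg (fun x => w (x - s * t) * (F x * g t x + f t x * G x)) -
     (s - c) * Itg (fun x => w' (x - s * t) * (f t x * g t x))).
Proof.
move=> d1 d2 w0 w1 w2 fL gL FL GL fF gG.
have fcL r : L2 (frame c f r) by exact: L2_shift.
have gcL r : L2 (frame c g r) by exact: L2_shift.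
have FcL := L2_shift (c * t) FL; have GcL := L2_shift (c * t) GL.
have dw := @diffL2_weight _ w w' w'' M (s - c) (frame c f) _ t d1 d2 w0 w1 w2 fcL FcL fF.
have mw r : measurable_fun setT (fun x : R => w (x - r)) := measurable_weight r d1.
have mw' r : measurable_fun setT (fun x : R => w' (x - r)) := measurable_weight r d2.
have wfL r : L2 (fun x => w (x - (s - c) * r) * frame c f r x) by apply: (L2M (mw _) _ (fcL r)).
have wF : L2 (fun x => w (x - (s - c) * t) * F (x + c * t)) by apply: (L2M (mw _) _ FcL).
have w'f : L2 (fun x => w' (x - (s - c) * t) * frame c f t x) by apply: (L2M (mw' _) _ (fcL t)).
have D := diffL2_ip wfL gcL (L2B wF (L2Z (s - c) w'f)) GcL dw gG.
have E (a b' : R -> R) (v : R -> R) r : measurable_fun setT (fun x : R => v (x - s * r)) -> L2 a -> L2 b' ->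
    Itg (fun x => v (x - (s - c) * r) * (a (x + c * r) * b' (x + c * r))) =
    Itg (fun x => v (x - s * r) * (a x * b' x)).
  move=> mv aL bL; rewrite -(Itg_shift (c * r) (measurable_funM mv (measurable_funM
    (L2_measurable aL) (L2_measurable bL)))); apply: eq_Itg => x.
  rewrite -[RHS]/(v (x + c * r - s * r) * (a (x + c * r) * b' (x + c * r))).
  by congr (v _ * _); ring.
have -> : (fun r => Itg (fun x => w (x - s * r) * (f r x * g r x))) =
    (fun r => ip (fun x => w (x - (s - c) * r) * frame c f r x) (frame c g r)).
  apply/funext => r; rewrite -(E _ _ w r (mw _) (fL r) (gL r)).
  by apply: eq_Itg => x; rewrite mulrA.
apply: (is_derive_eq D); clear D.
rewrite (ipBl wF (L2Z (s - c) w'f) (gcL t)) (ipZl _ w'f (gcL t)).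
have -> : ip (fun x => w' (x - (s - c) * t) * frame c f t x) (frame c g t) =
    Itg (fun x => w' (x - s * t) * (f t x * g t x)).
  rewrite -(E _ _ w' t (mw' _) (fL t) (gL t)).
  by apply: eq_Itg => x; rewrite mulrA.
have -> : ip (fun x => w (x - (s - c) * t) * F (x + c * t)) (frame c g t) =
    Itg (fun x => w (x - s * t) * (F x * g t x)).
  rewrite -(E _ _ w t (mw _) FL (gL t)).
  by apply: eq_Itg => x; rewrite mulrA.
have -> : ip (fun x => w (x - (s - c) * t) * frame c f t x) (fun x => G (x + c * t)) =
    Itg (fun x => w (x - s * t) * (f t x * G x)).
  rewrite -(E _ _ w t (mw _) (fL t) GL).
  by apply: eq_Itg => x; rewrite mulrA.
have i1 : itg (fun x => w (x - s * t) * (F x * g t x)).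
  have wFL : L2 (fun x => w (x - s * t) * F x) by apply: (L2M (mw _) _ FL).
  by have := itgM wFL (gL t); apply: eq_itg => x; rewrite mulrA.
have i2 : itg (fun x => w (x - s * t) * (f t x * G x)).
  have wfL' : L2 (fun x => w (x - s * t) * f t x) by apply: (L2M (mw _) _ (fL t)).
  by have := itgM wfL' GL; apply: eq_itg => x; rewrite mulrA.
have -> : Itg (fun x => w (x - s * t) * (F x * g t x + f t x * G x)) =
    Itg (fun x => w (x - s * t) * (F x * g t x)) + Itg (fun x => w (x - s * t) * (f t x * G x)).
  by rewrite -(ItgD i1 i2); apply: eq_Itg => x; rewrite mulrDr.
by rewrite addrAC.
Qed.

End weighted_derive.

Section weighted_integrals.
Context {R : realType}.
Variables (v : R -> R) (M : R).
Hypotheses (mv : measurable_fun setT v) (vM : forall x, `|v x| <= M).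

Lemma itg_weight X : itg X -> itg (fun x => v x * X x).
Proof.
move=> iX; have iM := itgZ M (itg_norm iX).
apply: (itg_le (measurable_funM mv (itg_measurable iX)) iM) => x.
by rewrite normrM ler_wpM2r.
Qed.

Lemma Itg_weight5 (a1 a2 a3 a4 a5 : R) X1 X2 X3 X4 X5 :
  itg X1 -> itg X2 -> itg X3 -> itg X4 -> itg X5 ->
  a1 * Itg (fun x => v x * X1 x) + a2 * Itg (fun x => v x * X2 x) +
  a3 * Itg (fun x => v x * X3 x) + a4 * Itg (fun x => v x * X4 x) +
  a5 * Itg (fun x => v x * X5 x) =
  Itg (fun x => v x * (a1 * X1 x + a2 * X2 x + a3 * X3 x + a4 * X4 x + a5 * X5 x)).
Proof.
move=> i1 i2 i3 i4 i5.
have j1 := itgZ a1 (itg_weight i1); have j2 := itgZ a2 (itg_weight i2).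
have j3 := itgZ a3 (itg_weight i3); have j4 := itgZ a4 (itg_weight i4).
have j5 := itgZ a5 (itg_weight i5).
rewrite -(ItgZ a1 (itg_weight i1)) -(ItgZ a2 (itg_weight i2)) -(ItgZ a3 (itg_weight i3)).
rewrite -(ItgZ a4 (itg_weight i4)) -(ItgZ a5 (itg_weight i5)).
rewrite -(ItgD j1 j2) -(ItgD (itgD j1 j2) j3) -(ItgD (itgD (itgD j1 j2) j3) j4).
rewrite -(ItgD (itgD (itgD (itgD j1 j2) j3) j4) j5).
apply: eq_Itg => x; move: (X1 x) (X2 x) (X3 x) (X4 x) (X5 x) (v x) => *; ring.
Qed.

End weighted_integrals.

Section energy_identity_arith.
Context {R : realType}.
Variables (b kappa : R).
Hypothesis b0 : 0 < b.

Lemma is_derive_translate (w w' : R -> R) (c x : R) : (forall x : R, is_derive x (1 : R) w (w' x)) ->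
  is_derive x (1 : R) (fun y => w (y - c)) (w' (x - c)).
Proof.
move=> d; have d1 : is_derive x (1 : R) (fun y : R => y - c) (1 - 0).
  by apply: is_deriveB.
have d2 := @is_derive1_comp R w (fun y : R => y - c) x _ _ (d (x - c)) d1.
by apply: (is_derive_eq d2); rewrite subr0 mulr1.
Qed.

Lemma transport_arith (U E Ux Ex m n M N Mx Nx : R) : m = (1 - kappa) * U + U * E ->
  n = (1 - kappa) * E + 2^-1 * U ^+ 2 ->
  let d1 := b^-1 * (n + 1 * m - (N + 1 * M)) in let d2 := b^-1 * (n + -1 * m - (N + -1 * M)) in
  let Fu := 0 * Ux - kappa * Ex - Nx in let Fe := 0 * Ex - kappa * Ux - Mx in
  kappa * b / 4 * (d1 * (Ux + 1 * Ex) + (Ux + 1 * Ex) * d1) +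
  kappa * b / 4 * (d2 * (Ux + -1 * Ex) + (Ux + -1 * Ex) * d2) +
  2^-1 * (Fu * U + U * Fu) + 2^-1 * (Fe * E + E * Fe) +
  2^-1 * (Fu * (U * E) + U * (Fu * E + U * Fe)) =
  - kappa ^+ 2 * (Ux * E + U * Ex) + - kappa * (Ux * N + U * Nx) + - kappa * (Ex * M + E * Mx) +
  -1 * (Mx * N + M * Nx) + b * (b^-1 * (M - m) * Nx + Mx * (b^-1 * (N - n))).
Proof. by move=> -> -> /=; field; rewrite gt_eqF. Qed.

Lemma parts5_arith (a1 a2 a3 a4 a5 p1 p2 p3 p4 p5 q1 q2 q3 q4 q5 : R) :
  p1 = - q1 -> p2 = - q2 -> p3 = - q3 -> p4 = - q4 -> p5 = - q5 ->
  a1 * p1 + a2 * p2 + a3 * p3 + a4 * p4 + a5 * p5 =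
  - (a1 * q1 + a2 * q2 + a3 * q3 + a4 * q4 + a5 * q5).
Proof. by move=> -> -> -> -> ->; ring. Qed.

(** The flux term b kappa^2 u_x eta_x comes from the opposite frame speeds kappa and - kappa, which
    multiply (u_x + eta_x)^2 and (u_x - eta_x)^2. *)
Lemma flux_arith (U E Ux Ex s M N Mx Nx : R) :
  - (- kappa ^+ 2 * (U * E) + - kappa * (U * N) + - kappa * (E * M) + -1 * (M * N) +
    b * (Mx * Nx)) -
  (kappa * b / 4 * (s - 1 * kappa) * ((Ux + 1 * Ex) * (Ux + 1 * Ex)) +
   kappa * b / 4 * (s - -1 * kappa) * ((Ux + -1 * Ex) * (Ux + -1 * Ex)) +
   2^-1 * (s - 0) * (U * U) + 2^-1 * (s - 0) * (E * E) + 2^-1 * (s - 0) * (U * (U * E))) =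
  (kappa * U + M) * (kappa * E + N) - b * (Mx * Nx) + b * kappa ^+ 2 * (Ux * Ex) -
  s * (2^-1 * (kappa * b * (Ux ^+ 2 + Ex ^+ 2) + U ^+ 2 + E ^+ 2 + U ^+ 2 * E)).
Proof. by field. Qed.

Lemma derive5_arith (a1 a2 a3 a4 a5 c1 c2 c3 c4 c5 p1 p2 p3 p4 p5 q1 q2 q3 q4 q5 : R) :
  a1 * (p1 - c1 * q1) + a2 * (p2 - c2 * q2) + a3 * (p3 - c3 * q3) + a4 * (p4 - c4 * q4) +
  a5 * (p5 - c5 * q5) = (a1 * p1 + a2 * p2 + a3 * p3 + a4 * p4 + a5 * p5) -
  (a1 * c1 * q1 + a2 * c2 * q2 + a3 * c3 * q3 + a4 * c4 * q4 + a5 * c5 * q5).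
Proof. ring. Qed.

End energy_identity_arith.

Section solution.
Context {R : realType}.
Local Notation mu := (@lebesgue_measure R).
Local Notation L2 := (@L2 R).
Local Notation wd := is_weak_derivative.
Variables (b kappa : R) (b0 : 0 < b).
Variables u eta ux etax : R -> R -> R.
Hypotheses (uL : forall t, L2 (u t)) (eL : forall t, L2 (eta t)).
Hypotheses (uxL : forall t, L2 (ux t)) (exL : forall t, L2 (etax t)).
Hypotheses (uwd : forall t, wd (u t) (ux t)) (ewd : forall t, wd (eta t) (etax t)).
Hypotheses (cu : forall t, contL2 u t) (ce : forall t, contL2 eta t).
Hypotheses (cux : forall t, contL2 ux t) (cex : forall t, contL2 etax t).

Definition prod_term (u eta : R -> R -> R) : R -> R -> R := fun t x => u t x * eta t x.
Definition square_term (u : R -> R -> R) : R -> R -> R := fun t x => 2^-1 * u t x ^+ 2.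

Lemma wd_ae_bounded (f f' : R -> R) : L2 f -> L2 f' -> wd f f' ->
  {ae mu, forall x, `|f x| <= Num.sqrt (2 * (nrm f * nrm f'))}.
Proof.
move=> fL f'L ff'; apply: (ae_imp (wd_sup fL f'L ff')) => x H.
by rewrite -sqrtr_sqr ler_sqrt// mulr_ge0// mulr_ge0// nrm_ge0.
Qed.

(** This is [wd_parts] with the test function as weight. *)
Lemma wdM (f f' g g' : R -> R) : L2 f -> L2 f' -> L2 g -> L2 g' -> wd f f' -> wd g g' ->
  wd (fun x => f x * g x) (fun x => f' x * g x + f x * g' x).
Proof.
move=> fL f'L gL g'L ff' gg'; apply/wdP => phi tp.
have [M pM] := test_bounded tp; have [M' pM'] := test_bounded (test_derive1 tp).
have pM1 x : `|phi x| <= Num.max M M' by rewrite le_max pM.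
have pM2 x : `|phi^`()%classic x| <= Num.max M M' by rewrite le_max pM' orbT.
have := wd_parts (fun x => smooth_is_derive x (test_smooth tp))
  (smooth_continuous (test_smooth (test_derive1 tp))) pM1 pM2 fL f'L gL g'L ff' gg'.
move/(congr1 (@GRing.opp R)); rewrite opprK => /esym.
have -> : Itg (fun x => phi^`()%classic x * (f x * g x)) =
  ip (fun x => f x * g x) phi^`()%classic by apply: eq_Itg => x; rewrite mulrC.
by move=> ->; congr (- _); apply: eq_Itg => x; rewrite mulrC.
Qed.

Let ub t := wd_ae_bounded (uL t) (uxL t) (uwd t).
Let eb t := wd_ae_bounded (eL t) (exL t) (ewd t).
Let csu t := wd_contsup uL uxL uwd (@cu t) (@cux t).
Let cse t := wd_contsup eL exL ewd (@ce t) (@cex t).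

Lemma L2_prod t : L2 (prod_term u eta t).
Proof. exact: (L2M_ae (L2_measurable (uL t)) (ub t) (eL t)). Qed.

Lemma L2_square t : L2 (square_term u t).
Proof.
have := L2Z 2^-1 (L2M_ae (L2_measurable (uL t)) (ub t) (uL t)).
by apply: eq_L2 => x; rewrite -expr2.
Qed.

Let px t x := ux t x * eta t x + u t x * etax t x.
Let qx t x := 2^-1 * (ux t x * u t x + u t x * ux t x).

Let pxL t : L2 (px t).
Proof.
apply: L2D; last exact: (L2M_ae (L2_measurable (uL t)) (ub t) (exL t)).
have := L2M_ae (L2_measurable (eL t)) (eb t) (uxL t).
by apply: eq_L2 => x; rewrite mulrC.
Qed.

Let qxL t : L2 (qx t).
Proof.
have h := L2M_ae (L2_measurable (uL t)) (ub t) (uxL t).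
have := L2Z 2^-1 (L2D h h).
by apply: eq_L2 => x; rewrite /qx; ring.
Qed.

Let pwd t : wd (prod_term u eta t) (px t).
Proof. by apply: wdM. Qed.

Let qwd t : wd (square_term u t) (qx t).
Proof.
have h := L2M_ae (L2_measurable (uL t)) (ub t) (uL t).
have h' : L2 (fun x => ux t x * u t x + u t x * ux t x).
  by have := L2Z 2 (qxL t); apply: eq_L2 => x; rewrite /qx mulrA divff// mul1r.
have := wdZ 2^-1 h h' (wdM (uL t) (uxL t) (uL t) (uxL t) (uwd t) (uwd t)).
by apply: eq_wd => // x; rewrite -expr2.
Qed.

Let cp t : contL2 (prod_term u eta) t.
Proof. exact: (contL2M uL eL (ub t) (contsup_bounded (eb t) (@cse t)) (@cu t) (@ce t)). Qed.

Let cq t : contL2 (square_term u) t.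
Proof.
have h r := L2M_ae (L2_measurable (uL r)) (ub r) (uL r).
have := contL2Z 2^-1 h (contL2M uL uL (ub t) (contsup_bounded (ub t) (@csu t)) (@cu t) (@cu t)).
by apply: eq_contL2 => r x; rewrite -expr2.
Qed.

Lemma contL2_Aop (f : R -> R -> R) t : (forall t, L2 (f t)) -> contL2 f t ->
  contL2 (fun s => Aop b (f s)) t.
Proof.
move=> fL; apply: (@contL2_le _ _ _ _ 1) => // s; rewrite mul1r.
have := Aop_nrm b0 (L2B (fL s) (fL t)).
by rewrite (_ : Aop b _ = fun x => Aop b (f s) x - Aop b (f t) x)//; apply/funext => x; exact: AopB.
Qed.

Lemma contL2_Kop (f : R -> R -> R) t : (forall t, L2 (f t)) -> contL2 f t ->
  contL2 (fun s => Kop b (f s)) t.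
Proof.
move=> fL; apply: (@contL2_le _ _ _ _ (Num.sqrt b)^-1) => // s.
have := Kop_nrm b0 (L2B (fL s) (fL t)).
by rewrite (_ : Kop b _ = fun x => Kop b (f s) x - Kop b (f t) x)//; apply/funext => x; exact: KopB.
Qed.

Let m := source kappa u (prod_term u eta).
Let n := source kappa eta (square_term u).
Let mx t x := (1 - kappa) * ux t x + px t x.
Let nx t x := (1 - kappa) * etax t x + qx t x.

Lemma L2_m t : L2 (m t).
Proof. exact: (L2_source kappa uL L2_prod). Qed.

Lemma L2_n t : L2 (n t).
Proof. exact: (L2_source kappa eL L2_square). Qed.

Let mxL t : L2 (mx t).
Proof. exact: L2D (L2Z _ (uxL t)) (pxL t). Qed.

Let nxL t : L2 (nx t).
Proof. exact: L2D (L2Z _ (exL t)) (qxL t). Qed.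

Let mwd t : wd (m t) (mx t).
Proof.
exact: (wdD (L2Z _ (uL t)) (L2Z _ (uxL t)) (L2_prod t) (pxL t) (wdZ _ (uL t) (uxL t) (uwd t)) (pwd t)).
Qed.

Let nwd t : wd (n t) (nx t).
Proof.
exact: (wdD (L2Z _ (eL t)) (L2Z _ (exL t)) (L2_square t) (qxL t) (wdZ _ (eL t) (exL t) (ewd t)) (qwd t)).
Qed.

Let cm t : contL2 m t.
Proof. exact: (contL2D (fun r => L2Z _ (uL r)) L2_prod (contL2Z _ uL (@cu t)) (@cp t)). Qed.

Let cn t : contL2 n t.
Proof. exact: (contL2D (fun r => L2Z _ (eL r)) L2_square (contL2Z _ eL (@ce t)) (@cq t)). Qed.

Lemma contL2_rhs (s : R) (f' g' h : R -> R -> R) t : (forall t, L2 (f' t)) -> (forall t, L2 (g' t)) ->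
  (forall t, L2 (h t)) -> contL2 f' t -> contL2 g' t -> contL2 h t ->
  contL2 (fun t x => s * f' t x - kappa * g' t x - Kop b (h t) x) t.
Proof.
move=> f'L g'L hL cf cg ch.
have h1 := contL2D (fun r => L2Z s (f'L r)) (fun r => L2Z (- kappa) (g'L r)) (contL2Z s f'L cf) (contL2Z (- kappa) g'L cg).
have KL r := L2_Kop b0 (hL r).
have := contL2D (fun r => L2D (L2Z s (f'L r)) (L2Z (- kappa) (g'L r))) (fun r => L2Z (-1) (KL r))
  h1 (contL2Z (-1) KL (contL2_Kop hL ch)).
by apply: eq_contL2 => r x; rewrite mulNr mulN1r.
Qed.

Hypothesis eq_eta : weak_equation b (- (kappa * b)) eta u (prod_term u eta).
Hypothesis eq_u : weak_equation b (- (kappa * b)) u eta (square_term u).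

Let Fe (s : R) t x := rhs b kappa s etax ux u (prod_term u eta) t x.
Let Fu (s : R) t x := rhs b kappa s ux etax eta (square_term u) t x.

Let FeL s t : L2 (Fe s t).
Proof. exact: (L2_rhs kappa b0 uL L2_prod exL uxL s t). Qed.

Let FuL s t : L2 (Fu s t).
Proof. exact: (L2_rhs kappa b0 eL L2_square uxL exL s t). Qed.

Let cFe s t : contL2 (Fe s) t.
Proof. exact: (contL2_rhs s exL uxL L2_m (@cex t) (@cux t) (@cm t)). Qed.

Let cFu s t : contL2 (Fu s) t.
Proof. exact: (contL2_rhs s uxL exL L2_n (@cux t) (@cex t) (@cn t)). Qed.

Lemma eta_pairing s chi t : test_function chi ->
  is_derive t (1 : R) (fun r => ip (frame s eta r) (Rho b chi))
    (ip (fun x => Fe s t (x + s * t)) (Rho b chi)).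
Proof. exact: (pairing_derive b0 t eL uL L2_prod exL uxL ewd uwd ce (cFe s) eq_eta). Qed.

Lemma u_pairing s chi t : test_function chi ->
  is_derive t (1 : R) (fun r => ip (frame s u r) (Rho b chi))
    (ip (fun x => Fu s t (x + s * t)) (Rho b chi)).
Proof. exact: (pairing_derive b0 t uL eL L2_square uxL exL uwd ewd cu (cFu s) eq_u). Qed.

Lemma frame0 (f : R -> R -> R) t : frame 0 f t = f t.
Proof. by apply/funext => x; rewrite /frame mul0r addr0. Qed.

(** The frame at rest is enough for the undifferentiated unknowns: eta_t = - kappa u_x - K m
    involves one derivative only and is continuous in L^2. *)
Lemma diffL2_eta t : diffL2 eta t (Fe 0 t).
Proof.
apply: (weak_diffL2 b0 eL (FeL 0) _ (@cFe 0 t)) => chi tc s.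
have := eta_pairing 0 s tc; rewrite mul0r.
rewrite (_ : (fun r => ip (frame 0 eta r) _) = (fun r => ip (eta r) (Rho b chi))); last first.
  by apply/funext => r; rewrite frame0.
by rewrite (_ : (fun x => Fe 0 s (x + 0)) = Fe 0 s)//; apply/funext => x; rewrite addr0.
Qed.

Lemma diffL2_u t : diffL2 u t (Fu 0 t).
Proof.
apply: (weak_diffL2 b0 uL (FuL 0) _ (@cFu 0 t)) => chi tc s.
have := u_pairing 0 s tc; rewrite mul0r.
rewrite (_ : (fun r => ip (frame 0 u r) _) = (fun r => ip (u r) (Rho b chi))); last first.
  by apply/funext => r; rewrite frame0.
by rewrite (_ : (fun x => Fu 0 s (x + 0)) = Fu 0 s)//; apply/funext => x; rewrite addr0.
Qed.

(** For sg = 1 and sg = -1, [combo sg u eta] are the Riemann invariants of the principal part u_t =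
    - kappa eta_x, eta_t = - kappa u_x. *)
Definition combo (sg : R) (f g : R -> R -> R) : R -> R -> R := fun t x => f t x + sg * g t x.

Lemma L2_combo sg (f g : R -> R -> R) t : (forall t, L2 (f t)) -> (forall t, L2 (g t)) ->
  L2 (combo sg f g t).
Proof. by move=> fL gL; apply: L2D => //; exact: L2Z. Qed.

Lemma contL2_combo sg (f g : R -> R -> R) t : (forall t, L2 (f t)) -> (forall t, L2 (g t)) ->
  contL2 f t -> contL2 g t -> contL2 (combo sg f g) t.
Proof.
move=> fL gL cf cg.
exact: (contL2D fL (fun r => L2Z sg (gL r)) cf (contL2Z sg gL cg)).
Qed.

Lemma wd_combo sg (f f' g g' : R -> R -> R) t : (forall t, L2 (f t)) -> (forall t, L2 (g t)) ->
  (forall t, L2 (f' t)) -> (forall t, L2 (g' t)) -> (forall t, wd (f t) (f' t)) ->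
  (forall t, wd (g t) (g' t)) -> wd (combo sg f g t) (combo sg f' g' t).
Proof.
move=> fL gL f'L g'L ff' gg'.
exact: (wdD (fL t) (f'L t) (L2Z sg (gL t)) (L2Z sg (g'L t)) (ff' t) (wdZ sg (gL t) (g'L t) (gg' t))).
Qed.

Let AL (f : R -> R -> R) (fL : forall t, L2 (f t)) t : L2 (Aop b (f t)) := L2_Aop b0 (fL t).
Let KL (f : R -> R -> R) (fL : forall t, L2 (f t)) t : L2 (Kop b (f t)) := L2_Kop b0 (fL t).

Let NM sg := combo sg n m.
Let ANM sg := combo sg (fun t => Aop b (n t)) (fun t => Aop b (m t)).
Let KNM sg := combo sg (fun t => Kop b (n t)) (fun t => Kop b (m t)).

(* [z = u + sg eta] satisfies [z_t + sg kappa z_x = - K (n + sg m)] with [K = d/dx A],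
   and [d/dx K = (A - 1) / b] is bounded, so [z_x] is differentiable in the frame
   moving at speed [sg kappa]. *)
Lemma diffL2_gradient (sg : R) t : sg * sg = 1 ->
  diffL2 (frame (sg * kappa) (combo sg ux etax)) t
    (fun x => b^-1 * (NM sg t (x + sg * kappa * t) - ANM sg t (x + sg * kappa * t))).
Proof.
move=> sg1; set c := sg * kappa.
have NL r : L2 (NM sg r) := L2_combo sg r L2_n L2_m.
have ANL r : L2 (ANM sg r) := L2_combo sg r (AL L2_n) (AL L2_m).
have KNL r : L2 (KNM sg r) := L2_combo sg r (KL L2_n) (KL L2_m).
have NwL r : L2 (combo sg nx mx r) := L2_combo sg r nxL mxL.
have Nwd r : wd (NM sg r) (combo sg nx mx r) := wd_combo sg r L2_n L2_m nxL mxL nwd mwd.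
have Awd r : wd (ANM sg r) (KNM sg r) := wd_combo sg r (AL L2_n) (AL L2_m) (KL L2_n) (KL L2_m)
  (fun t => Aop_wd b0 (L2_n t)) (fun t => Aop_wd b0 (L2_m t)).
have DL r : L2 (fun x => b^-1 * (NM sg r x - ANM sg r x)) := L2Z _ (L2B (NL r) (ANL r)).
have zL r : L2 (combo sg u eta r) := L2_combo sg r uL eL.
have zxL r : L2 (combo sg ux etax r) := L2_combo sg r uxL exL.
have zwd r : wd (combo sg u eta r) (combo sg ux etax r) := wd_combo sg r uL eL uxL exL uwd ewd.
have Kwd r : wd (fun x => -1 * KNM sg r x) (fun x => b^-1 * (NM sg r x - ANM sg r x)).
  have h1 := wdD (KL L2_n r) (L2Z b^-1 (L2B (AL L2_n r) (L2_n r)))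
    (L2Z sg (KL L2_m r)) (L2Z sg (L2Z b^-1 (L2B (AL L2_m r) (L2_m r))))
    (Kop_wd b0 (L2_n r)) (wdZ sg (KL L2_m r) (L2Z b^-1 (L2B (AL L2_m r) (L2_m r))) (Kop_wd b0 (L2_m r))).
  have := wdZ (-1) (KNL r) (L2D (L2Z b^-1 (L2B (AL L2_n r) (L2_n r)))
    (L2Z sg (L2Z b^-1 (L2B (AL L2_m r) (L2_m r))))) h1.
  by apply: eq_wd => // x; rewrite /NM /ANM /combo; ring.
(* The frame speed c = sg kappa and sg^2 = 1 cancel all terms in u_x and eta_x; only the smoothing
   part remains. *)
have Fz r : combo sg (Fu c) (Fe c) r = fun x => -1 * KNM sg r x.
  apply/funext => x; rewrite /combo /Fu /Fe /rhs /KNM /combo /c -/m -/n.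
  move: (ux r x) (etax r x) (Kop b (n r) x) (Kop b (m r) x) => p q k l.
  by clear -sg1; ring: sg1.
have cN : contL2 (frame c (NM sg)) t.
  exact: (@contL2_frame _ c (NM sg) _ t NL NwL Nwd (contL2_combo sg L2_n L2_m (@cn t) (@cm t))).
have cA : contL2 (frame c (ANM sg)) t.
  exact: (@contL2_frame _ c (ANM sg) _ t ANL KNL Awd (contL2_combo sg (AL L2_n) (AL L2_m)
    (contL2_Aop L2_n (@cn t)) (contL2_Aop L2_m (@cm t)))).
pose D r x := b^-1 * (NM sg r (x + c * r) - ANM sg r (x + c * r)).
have DsL r : L2 (D r) := L2_shift (c * r) (DL r).
have cD : contL2 D t.
  have h := contL2D (fun r => L2_shift (c * r) (NL r)) (fun r => L2Z (-1) (L2_shift (c * r) (ANL r)))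
    cN (contL2Z (-1) (fun r => L2_shift (c * r) (ANL r)) cA).
  have := contL2Z b^-1 (fun r => L2D (L2_shift (c * r) (NL r)) (L2Z (-1) (L2_shift (c * r) (ANL r)))) h.
  by apply: eq_contL2 => r x; rewrite /D /frame mulN1r.
apply: (weak_diffL2 b0 (fun r => L2_shift (c * r) (zxL r)) DsL _ cD) => chi tc s.
(* The pairing of z_x with [Rho b chi] is minus the pairing of z with [Rho b] of chi', whose time
   derivative is known; the x-derivative is then returned to the bounded term d/dx K. *)
have tc1 := test_derive1 tc; have r1L := L2_Rho b tc1.
have d1 := u_pairing c s tc1; have d2 := is_deriveZ sg (eta_pairing c s tc1).
have := is_deriveN (is_deriveD d1 d2).
have -> : - ((fun r => ip (frame c u r) (Rho b chi^`()%classic)) +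
    sg *: (fun r => ip (frame c eta r) (Rho b chi^`()%classic))) =
    (fun r => ip (frame c (combo sg ux etax) r) (Rho b chi)).
  apply/funext => r.
  rewrite -[LHS]/(- (ip (frame c u r) (Rho b chi^`()%classic) +
    sg * ip (frame c eta r) (Rho b chi^`()%classic))).
  rewrite -(ipZl sg (L2_shift (c * r) (eL r)) r1L).
  rewrite -(ipDl (L2_shift (c * r) (uL r)) (L2Z sg (L2_shift (c * r) (eL r))) r1L).
  have := wd_Rho b (L2_shift (c * r) (zL r)) (L2_shift (c * r) (zxL r))
    (wd_shift (c * r) (zL r) (zxL r) (zwd r)) tc.
  by move=> ->; rewrite opprK.
move=> d; apply: (is_derive_eq d); clear d d1 d2.
rewrite -[LHS]/(- (ip (fun x => Fu c s (x + c * s)) (Rho b chi^`()%classic) +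
    sg * ip (fun x => Fe c s (x + c * s)) (Rho b chi^`()%classic))).
rewrite -(ipZl sg (L2_shift (c * s) (FeL c s)) r1L).
rewrite -(ipDl (L2_shift (c * s) (FuL c s)) (L2Z sg (L2_shift (c * s) (FeL c s))) r1L).
have E x : Fu c s (x + c * s) + sg * Fe c s (x + c * s) = -1 * KNM sg s (x + c * s).
  by have := congr1 (@^~ (x + c * s)) (Fz s).
rewrite (_ : (fun x => _) = (fun x => -1 * KNM sg s (x + c * s))); last exact/funext.
have KN1 := L2Z (-1) (KNL s).
have := wd_Rho b (L2_shift (c * s) KN1) (DsL s) (wd_shift (c * s) KN1 (DL s) (Kwd s)) tc.
by move=> ->; rewrite opprK.
Qed.

Definition energy_density t x := 2^-1 * (kappa * b * (ux t x ^+ 2 + etax t x ^+ 2) +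
  u t x ^+ 2 + eta t x ^+ 2 + u t x ^+ 2 * eta t x).

Definition energy_flux t x :=
  (kappa * u t x + Aop b (m t) x) * (kappa * eta t x + Aop b (n t) x) -
  b * (Kop b (m t) x * Kop b (n t) x) + b * kappa ^+ 2 * (ux t x * etax t x).

(** The gradient part is diagonalised, u_x^2 + eta_x^2 being half of (u_x + eta_x)^2 + (u_x -
    eta_x)^2, so that in each product both factors are differentiable in a common frame. *)
Let lin_density t x : energy_density t x =
  kappa * b / 4 * (combo 1 ux etax t x * combo 1 ux etax t x) +
  kappa * b / 4 * (combo (-1) ux etax t x * combo (-1) ux etax t x) +
  2^-1 * (u t x * u t x) + 2^-1 * (eta t x * eta t x) + 2^-1 * (u t x * prod_term u eta t x).
Proof.
rewrite /energy_density /combo /prod_term.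
move: (u t x) (eta t x) (ux t x) (etax t x) => p1 p2 p3 p4; by field.
Qed.

(** Each of the five products is differentiated in its own frame. The terms carrying w then form
    exact x-derivatives, and five integrations by parts turn them into terms carrying w'. *)
Lemma energy_derive (w w' w'' : R -> R) (B s t : R) :
  (forall x : R, is_derive x (1 : R) w (w' x)) ->
  (forall x : R, is_derive x (1 : R) w' (w'' x)) ->
  (forall x, `|w x| <= B) -> (forall x, `|w' x| <= B) -> (forall x, `|w'' x| <= B) ->
  is_derive t (1 : R) (fun r => Itg (fun x => w (x - s * r) * energy_density r x))
    (Itg (fun x => w' (x - s * t) * (energy_flux t x - s * energy_density t x))).
Proof.
move=> d1 d2 w0 w1 w2.
have vL sg r : L2 (combo sg ux etax r) := L2_combo sg r uxL exL.
have NL sg r : L2 (NM sg r) := L2_combo sg r L2_n L2_m.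
have ANL sg r : L2 (ANM sg r) := L2_combo sg r (AL L2_n) (AL L2_m).
have GL sg : L2 (fun x => b^-1 * (NM sg t x - ANM sg t x)) := L2Z _ (L2B (NL sg t) (ANL sg t)).
have du : diffL2 (frame 0 u) t (fun x => Fu 0 t (x + 0 * t)).
  apply: eq_diffL2 (diffL2_u t) => [r x|x]; first by rewrite frame0.
  by rewrite mul0r addr0.
have de : diffL2 (frame 0 eta) t (fun x => Fe 0 t (x + 0 * t)).
  apply: eq_diffL2 (diffL2_eta t) => [r x|x]; first by rewrite frame0.
  by rewrite mul0r addr0.
pose Fp x := Fu 0 t x * eta t x + u t x * Fe 0 t x.
have FpL : L2 Fp.
  apply: L2D; last exact: (L2M_ae (L2_measurable (uL t)) (ub t) (FeL 0 t)).
  have := L2M_ae (L2_measurable (eL t)) (eb t) (FuL 0 t).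
  by apply: eq_L2 => x; rewrite mulrC.
have dp : diffL2 (frame 0 (prod_term u eta)) t (fun x => Fp (x + 0 * t)).
  have := diffL2M uL eL (FuL 0 t) (FeL 0 t) (ub t) (eb t) (@cse t) (diffL2_u t) (diffL2_eta t).
  apply: eq_diffL2 => [r x|x]; first by rewrite frame0.
  by rewrite mul0r addr0.
have m1 : (-1 : R) * -1 = 1 by rewrite mulrNN mulr1.
have D1 := weighted_derive s d1 d2 w0 w1 w2 (vL 1) (vL 1) (GL 1) (GL 1)
  (diffL2_gradient t (mulr1 (1 : R))) (diffL2_gradient t (mulr1 (1 : R))).
have D2 := weighted_derive s d1 d2 w0 w1 w2 (vL (-1)) (vL (-1)) (GL (-1)) (GL (-1))
  (diffL2_gradient t m1) (diffL2_gradient t m1).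
have D3 := weighted_derive s d1 d2 w0 w1 w2 uL uL (FuL 0 t) (FuL 0 t) du du.
have D4 := weighted_derive s d1 d2 w0 w1 w2 eL eL (FeL 0 t) (FeL 0 t) de de.
have D5 := weighted_derive s d1 d2 w0 w1 w2 uL L2_prod (FuL 0 t) FpL du dp.
pose a := kappa * b / 4.
have D := is_deriveD (is_deriveD (is_deriveD (is_deriveD (is_deriveZ a D1) (is_deriveZ a D2))
  (is_deriveZ 2^-1 D3)) (is_deriveZ 2^-1 D4)) (is_deriveZ 2^-1 D5).
clear D1 D2 D3 D4 D5.
have mw r : measurable_fun setT (fun x : R => w (x - r)) := measurable_weight r d1.
have mw' r : measurable_fun setT (fun x : R => w' (x - r)) := measurable_weight r d2.
have iV sg r := itgM (vL sg r) (vL sg r).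
have iU r := itgM (uL r) (uL r); have iE r := itgM (eL r) (eL r).
have iP r := itgM (uL r) (L2_prod r).
have E r : Itg (fun x => w (x - s * r) * energy_density r x) =
  a * Itg (fun x => w (x - s * r) * (combo 1 ux etax r x * combo 1 ux etax r x)) +
  a * Itg (fun x => w (x - s * r) * (combo (-1) ux etax r x * combo (-1) ux etax r x)) +
  2^-1 * Itg (fun x => w (x - s * r) * (u r x * u r x)) +
  2^-1 * Itg (fun x => w (x - s * r) * (eta r x * eta r x)) +
  2^-1 * Itg (fun x => w (x - s * r) * (u r x * prod_term u eta r x)).
  rewrite (@Itg_weight5 _ _ B (mw (s * r)) (fun x => w0 _) a a 2^-1 2^-1 2^-1 _ _ _ _ _
    (iV 1 r) (iV (-1) r) (iU r) (iE r) (iP r)).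
  by apply: eq_Itg => x; rewrite lin_density.
rewrite (funext E); apply: (is_derive_eq D); clear D E.
rewrite /GRing.scale/= derive5_arith.
rewrite (@Itg_weight5 _ _ B (mw (s * t)) (fun x => w0 _) a a 2^-1 2^-1 2^-1 _ _ _ _ _
  (itgD (itgM (GL 1) (vL 1 t)) (itgM (vL 1 t) (GL 1)))
  (itgD (itgM (GL (-1)) (vL (-1) t)) (itgM (vL (-1) t) (GL (-1))))
  (itgD (itgM (FuL 0 t) (uL t)) (itgM (uL t) (FuL 0 t)))
  (itgD (itgM (FeL 0 t) (eL t)) (itgM (eL t) (FeL 0 t)))
  (itgD (itgM (FuL 0 t) (L2_prod t)) (itgM (uL t) FpL))).
rewrite (@Itg_weight5 _ _ B (mw' (s * t)) (fun x => w1 _) _ _ _ _ _ _ _ _ _ _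
  (iV 1 t) (iV (-1) t) (iU t) (iE t) (iP t)).
have ML := AL L2_m t; have ML' := AL L2_n t; have KmL := KL L2_m t; have KnL := KL L2_n t.
have KmxL := L2Z b^-1 (L2B ML (L2_m t)); have KnxL := L2Z b^-1 (L2B ML' (L2_n t)).
have Mwd := Aop_wd b0 (L2_m t); have Nwd := Aop_wd b0 (L2_n t).
have Kmwd := Kop_wd b0 (L2_m t); have Knwd := Kop_wd b0 (L2_n t).
have dw x := is_derive_translate (s * t) x d1.
have cw' : continuous (fun x : R => w' (x - s * t)).
  by move=> x; apply: (is_derive_continuous (fun y => is_derive_translate (s * t) y d2)).
have parts (f f' g g' : R -> R) : L2 f -> L2 f' -> L2 g -> L2 g' -> wd f f' -> wd g g' ->
    Itg (fun x => w (x - s * t) * (f' x * g x + f x * g' x)) =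
    - Itg (fun x => w' (x - s * t) * (f x * g x)).
  by move=> fL f'L gL g'L; apply: (wd_parts dw cw' (fun x => w0 _) (fun x => w1 _)).
have P1 := parts _ _ _ _ (uL t) (uxL t) (eL t) (exL t) (uwd t) (ewd t).
have P2 := parts _ _ _ _ (uL t) (uxL t) ML' KnL (uwd t) Nwd.
have P3 := parts _ _ _ _ (eL t) (exL t) ML KmL (ewd t) Mwd.
have P4 := parts _ _ _ _ ML KmL ML' KnL Mwd Nwd.
have P5 := parts _ _ _ _ KmL KmxL KnL KnxL Kmwd Knwd.
rewrite (_ : Itg (fun x => w (x - s * t) * _) =
  Itg (fun x => w (x - s * t) * (- kappa ^+ 2 * (ux t x * eta t x + u t x * etax t x) +
    - kappa * (ux t x * Aop b (n t) x + u t x * Kop b (n t) x) +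
    - kappa * (etax t x * Aop b (m t) x + eta t x * Kop b (m t) x) +
    -1 * (Kop b (m t) x * Aop b (n t) x + Aop b (m t) x * Kop b (n t) x) +
    b * (b^-1 * (Aop b (m t) x - m t x) * Kop b (n t) x +
      Kop b (m t) x * (b^-1 * (Aop b (n t) x - n t x)))))); last first.
  apply: eq_Itg => x; congr (_ * _).
  exact: (transport_arith b0 (ux t x) (etax t x) (Aop b (m t) x) (Aop b (n t) x)
    (Kop b (m t) x) (Kop b (n t) x) (erefl (m t x)) (erefl (n t x))).
rewrite -(@Itg_weight5 _ _ B (mw (s * t)) (fun x => w0 _) (- kappa ^+ 2) (- kappa) (- kappa) (-1) b _ _ _ _ _
  (itgD (itgM (uxL t) (eL t)) (itgM (uL t) (exL t)))
  (itgD (itgM (uxL t) ML') (itgM (uL t) KnL))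
  (itgD (itgM (exL t) ML) (itgM (eL t) KmL))
  (itgD (itgM KmL ML') (itgM ML KnL))
  (itgD (itgM KmxL KnL) (itgM KmL KnxL))).
rewrite (parts5_arith _ _ _ _ _ P1 P2 P3 P4 P5).
rewrite (@Itg_weight5 _ _ B (mw' (s * t)) (fun x => w1 _) (- kappa ^+ 2) (- kappa) (- kappa) (-1) b _ _ _ _ _
  (itgM (uL t) (eL t)) (itgM (uL t) ML') (itgM (eL t) ML) (itgM ML ML') (itgM KmL KnL)).
have iS := itg_weight (mw' (s * t)) (fun x => w1 _)
  (itgD (itgD (itgD (itgD (itgZ (- kappa ^+ 2) (itgM (uL t) (eL t)))
    (itgZ (- kappa) (itgM (uL t) ML'))) (itgZ (- kappa) (itgM (eL t) ML)))
    (itgZ (-1) (itgM ML ML'))) (itgZ b (itgM KmL KnL))).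
have iD := itg_weight (mw' (s * t)) (fun x => w1 _)
  (itgD (itgD (itgD (itgD (itgZ (a * (s - 1 * kappa)) (iV 1 t))
    (itgZ (a * (s - -1 * kappa)) (iV (-1) t))) (itgZ (2^-1 * (s - 0)) (iU t)))
    (itgZ (2^-1 * (s - 0)) (iE t))) (itgZ (2^-1 * (s - 0)) (iP t))).
rewrite -(ItgN iS) -(ItgB (itgN iS) iD); apply: eq_Itg => x.
rewrite -mulrN -mulrBr; congr (_ * _); exact: flux_arith.
Qed.

End solution.

(** * Monotonicity of weighted energies *)

Section logistic.
Context {R : realType}.
Variable (l : R).
Hypothesis l0 : 0 < l.
Implicit Types (x y : R).

(** This profile is chosen because |w''| <= l w' holds everywhere, with l as small as desired. Thus
    w' itself is an admissible weight for [Aop_weighted], while w >= 1/2 for x >= 0 and w tends to 0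
    on the left. *)
Definition logistic x := (1 + expR (- (l * x)))^-1.
Definition dlogistic x := l * (logistic x * (1 - logistic x)).
Definition ddlogistic x := l * (dlogistic x * (1 - 2 * logistic x)).

Let den x : 0 < 1 + expR (- (l * x)).
Proof. by rewrite ltr_wpDr// expR_ge0. Qed.

Lemma logistic_gt0 x : 0 < logistic x.
Proof. by rewrite invr_gt0. Qed.

Lemma logistic_lt1 x : logistic x < 1.
Proof. by rewrite invf_lt1// ltrDl expR_gt0. Qed.

Lemma logistic_ge_half x : 0 <= x -> 2^-1 <= logistic x.
Proof.
move=> x0; rewrite lef_pV2 ?posrE// -[2]/(1 + 1 : R) lerD2l -expR0 ler_expR.
by rewrite oppr_le0 mulr_ge0// ltW.
Qed.

Lemma le_logistic x y : x <= y -> logistic x <= logistic y.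
Proof.
move=> xy; rewrite lef_pV2 ?posrE// lerD2l ler_expR lerN2.
by rewrite ler_wpM2l// ltW.
Qed.

Lemma logistic_tail x : x <= 0 -> logistic x <= (1 - l * x)^-1.
Proof.
move=> x0; have h : 0 < 1 - l * x.
  by rewrite ltr_wpDr// -mulrN mulr_ge0 ?oppr_ge0// ltW.
rewrite lef_pV2 ?posrE//; have := expR_ge1Dx (- (l * x)) => H.
apply: (le_trans H); rewrite lerDr//.
Qed.

Lemma logistic_derive x : is_derive x (1 : R) logistic (dlogistic x).
Proof.
have d1 : is_derive x (1 : R) (fun y => - (l * y)) (- (l * 1)).
  by apply: is_deriveN; apply: is_deriveZ.
have d2 := @is_derive1_comp R expR (fun y => - (l * y)) x _ _ (is_derive_expR (- (l * x))) d1.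
have d3 : is_derive x (1 : R) (fun y => 1 + expR (- (l * y))) (0 + expR (- (l * x)) * - (l * 1)).
  by apply: is_deriveD; exact: d2.
have nz : 1 + expR (- (l * x)) != 0 by rewrite gt_eqF.
have d4 : is_derive x (1 : R) logistic (- (1 + expR (- (l * x))) ^- 2 * (0 + expR (- (l * x)) * - (l * 1))).
  exact: is_deriveV.
apply: (is_derive_eq d4); rewrite /dlogistic /logistic /GRing.scale/=.
move: (expR _) nz => e nz; field; exact: nz.
Qed.

Lemma dlogistic_derive x : is_derive x (1 : R) dlogistic (ddlogistic x).
Proof.
have d := logistic_derive x.
have d1 : is_derive x (1 : R) (fun y => 1 - logistic y) (0 - dlogistic x).
  by apply: is_deriveB.
have d2 := is_deriveZ l (is_deriveM d d1).
apply: (is_derive_eq d2); rewrite /ddlogistic /dlogistic /GRing.scale/=; ring.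
Qed.

Lemma dlogistic_ge0 x : 0 <= dlogistic x.
Proof.
by rewrite /dlogistic !mulr_ge0 ?subr_ge0// ltW// ?logistic_gt0 ?logistic_lt1.
Qed.

Lemma dlogistic_le x : dlogistic x <= l.
Proof.
rewrite /dlogistic -[leRHS]mulr1 ler_pM2l//.
have := logistic_gt0 x; have := logistic_lt1 x; nra.
Qed.

Lemma ddlogistic_le x : `|ddlogistic x| <= l * dlogistic x.
Proof.
rewrite /ddlogistic normrM gtr0_norm// ler_pM2l// normrM ger0_norm ?dlogistic_ge0//.
rewrite -[leRHS]mulr1 ler_wpM2l ?dlogistic_ge0//.
rewrite ler_norml; have := logistic_gt0 x; have := logistic_lt1 x; lra.
Qed.

End logistic.

(** * Pointwise bounds on flux and density *)

Section flux_bound_arith.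
Context {R : realType}.

(** Convexity of the square for the mean of U and M / (1 - k) with weights k and 1 - k. *)
Lemma square_convex (k U M : R) : 0 < k -> k < 1 ->
  (k * U + M) ^+ 2 <= k * U ^+ 2 + (1 - k)^-1 * M ^+ 2.
Proof.
move=> k0 k1; have q0 : 0 < 1 - k by lra.
rewrite -subr_ge0 (_ : _ - _ = k * (1 - k)^-1 * ((1 - k) * U - M) ^+ 2).
  by rewrite mulr_ge0 ?sqr_ge0// mulr_ge0 ?invr_ge0; lra.
field; lra.
Qed.

Lemma two_mul_le (x y z w : R) : x ^+ 2 <= z -> y ^+ 2 <= w -> `|x * y| <= 2^-1 * (z + w).
Proof.
move=> xz yw; rewrite ler_norml; apply/andP; split.
  have := sqr_ge0 (x + y); nra.
have := sqr_ge0 (x - y); nra.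
Qed.

(** The gradient products fit under k^2 <= k and 1 <= 1/(1 - k), so that M and M_x appear exactly in
    the combination M^2 + b M_x^2 bounded by [Aop_weighted]. *)
Lemma flux_pointwise (k b U E Ux Ex M N Mx Nx : R) : 0 < k -> k < 1 -> 0 < b ->
  `|(k * U + M) * (k * E + N) - b * (Mx * Nx) + b * k ^+ 2 * (Ux * Ex)| <=
  2^-1 * (k * (U ^+ 2 + E ^+ 2) + k * b * (Ux ^+ 2 + Ex ^+ 2) +
    (1 - k)^-1 * ((M ^+ 2 + b * Mx ^+ 2) + (N ^+ 2 + b * Nx ^+ 2))).
Proof.
move=> k0 k1 b0; have q0 : 0 < 1 - k by lra.
have q1 : 1 <= (1 - k)^-1 by rewrite invf_ge1//; lra.
have h1 := two_mul_le (square_convex U M k0 k1) (square_convex E N k0 k1).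
have h2 := two_mul_le (lexx (Mx ^+ 2)) (lexx (Nx ^+ 2)).
have h3 := two_mul_le (lexx (Ux ^+ 2)) (lexx (Ex ^+ 2)).
have n2 : `|b * (Mx * Nx)| <= 2^-1 * ((1 - k)^-1 * (b * Mx ^+ 2 + b * Nx ^+ 2)).
  rewrite normrM gtr0_norm//.
  apply: (@le_trans _ _ (2^-1 * (b * Mx ^+ 2 + b * Nx ^+ 2))).
    by apply: (le_trans (ler_wpM2l (ltW b0) h2)); lra.
  rewrite ler_pM2l; last by lra.
  rewrite -[leLHS]mul1r ler_wpM2r//.
  by rewrite addr_ge0// mulr_ge0 ?sqr_ge0// ltW.
have n3 : `|b * k ^+ 2 * (Ux * Ex)| <= 2^-1 * (k * b * (Ux ^+ 2 + Ex ^+ 2)).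
  have kk : 0 <= b * k ^+ 2 by rewrite mulr_ge0 ?sqr_ge0// ltW.
  rewrite normrM ger0_norm//; apply: (le_trans (ler_wpM2l kk h3)).
  rewrite mulrCA ler_pM2l; last by lra.
  apply: ler_wpM2r; first by rewrite addr_ge0 ?sqr_ge0.
  have : k ^+ 2 <= k by nra.
  by nra.
apply: (le_trans (ler_normD _ _)); apply: (le_trans (lerD (ler_normB _ _) n3)).
apply: (le_trans (lerD (lerD h1 n2) (lexx _))).
move: (1 - k)^-1 (M ^+ 2) (N ^+ 2) (Mx ^+ 2) (Nx ^+ 2) (U ^+ 2) (E ^+ 2) => *.
rewrite le_eqVlt; apply/orP; left; apply/eqP; ring.
Qed.

(** With q = 1 - k and |U|, |E| <= q/20, the squares of m and n add up to at most (13/10) q^2 (U^2 +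
    E^2). The coefficient 1 - q + (4/3) (13/10) q stays below 2 - q/10, which is what the cubic term
    leaves of 2. *)
Lemma density_pointwise (k b e U E Ux Ex m n : R) : 0 < k -> k < 1 -> 0 < b ->
  0 <= e -> 20 * e <= 1 - k -> `|U| <= e -> `|E| <= e ->
  m = (1 - k) * U + U * E -> n = (1 - k) * E + 2^-1 * U ^+ 2 ->
  k * (U ^+ 2 + E ^+ 2) + k * b * (Ux ^+ 2 + Ex ^+ 2) +
    (1 - k)^-1 * (4 / 3 * m ^+ 2 + 4 / 3 * n ^+ 2) <=
  4 * (2^-1 * (k * b * (Ux ^+ 2 + Ex ^+ 2) + U ^+ 2 + E ^+ 2 + U ^+ 2 * E)).
Proof.
move=> k0 k1 b0 e0 ek Ue Ee -> ->.
have q0 : 0 < 1 - k by lra.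
set q := 1 - k in q0 ek *.
have q1 : q < 1 by rewrite /q; lra.
move: Ue Ee; rewrite !ler_norml => /andP[U1 U2] /andP[E1 E2].
have U0 := sqr_ge0 U; have E0 := sqr_ge0 E.
have hm : (q * U + U * E) ^+ 2 <= q ^+ 2 * (12 / 10 * U ^+ 2).
  rewrite (_ : _ ^+ 2 = (q + E) ^+ 2 * U ^+ 2); last by ring.
  rewrite [leRHS]mulrA; apply: ler_wpM2r => //.
  have : 0 <= q + E <= 21 / 20 * q by lra.
  by nra.
have UU : U ^+ 2 <= (q / 20) ^+ 2 by nra.
have hU : (2^-1 * U ^+ 2) ^+ 2 <= (q / 40) ^+ 2 * U ^+ 2.
  rewrite (_ : _ ^+ 2 = 4^-1 * U ^+ 2 * U ^+ 2); last by field.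
  rewrite ler_wpM2r//; lra.
have hn : (q * E + 2^-1 * U ^+ 2) ^+ 2 <= q ^+ 2 * (11 / 10 * E ^+ 2) + q ^+ 2 * (1 / 10 * U ^+ 2).
  (* Young's inequality (p + z)^2 <= (11/10) p^2 + 11 z^2. *)
  have := sqr_ge0 (q * E - 10 * (2^-1 * U ^+ 2)).
  move: hU; move: (2^-1 * U ^+ 2) => z hU hz; nra.
have hd : 0 <= k * b * (Ux ^+ 2 + Ex ^+ 2).
  by rewrite !mulr_ge0 ?addr_ge0 ?sqr_ge0// ltW.
have hmn : q^-1 * (4 / 3 * (q * U + U * E) ^+ 2 + 4 / 3 * (q * E + 2^-1 * U ^+ 2) ^+ 2) <=
    q * (4 / 3 * (13 / 10) * (U ^+ 2 + E ^+ 2)).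
  rewrite ler_pdivrMl//; nra.
have hc : - (e * U ^+ 2) <= U ^+ 2 * E by nra.
have hkq : k = 1 - q by rewrite /q; ring.
rewrite hkq in hd *; nra.
Qed.

Lemma flux_combine (F A q Gm Gn Mm Nn D : R) : 0 <= q ->
  F <= 2^-1 * (A + q * (Gm + Gn)) -> Gm <= 4 / 3 * Mm -> Gn <= 4 / 3 * Nn ->
  A + q * (4 / 3 * Mm + 4 / 3 * Nn) <= 4 * D -> F <= 2 * D.
Proof.
move=> q0 h1 h2 h3 h4; have := ler_wpM2l q0 (lerD h2 h3); lra.
Qed.

End flux_bound_arith.

(** * The weighted flux estimate *)

Section energy_bounds.
Context {R : realType}.
Local Notation mu := (@lebesgue_measure R).
Local Notation L2 := (@L2 R).
Local Notation wd := is_weak_derivative.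
Variables (b kappa : R) (b0 : 0 < b) (k0 : 0 < kappa) (k1 : kappa < 1).
Variables u eta ux etax : R -> R -> R.
Hypotheses (uL : forall t, L2 (u t)) (eL : forall t, L2 (eta t)).
Hypotheses (uxL : forall t, L2 (ux t)) (exL : forall t, L2 (etax t)).
Hypotheses (uwd : forall t, wd (u t) (ux t)) (ewd : forall t, wd (eta t) (etax t)).

Let e := energy_density b kappa u eta ux etax.
Let fl := energy_flux b kappa u eta ux etax.

Let iU t := L2_sqr (uL t). Let iE t := L2_sqr (eL t).
Let iUx t := L2_sqr (uxL t). Let iEx t := L2_sqr (exL t).
Let pL t := L2_prod uL eL uxL uwd t.

Let iP t : itg (fun x => u t x ^+ 2 * eta t x).
Proof.
by have := itgM (uL t) (pL t); apply: eq_itg => x; rewrite /prod_term expr2 mulrA.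
Qed.

Let idx t := itgZ (kappa * b) (itgD (iUx t) (iEx t)).

Lemma itg_density t : itg (e t).
Proof. exact: (itgZ 2^-1 (itgD (itgD (itgD (idx t) (iU t)) (iE t)) (iP t))). Qed.

Let mL t := L2_m kappa uL eL uxL uwd t.
Let nL t := L2_n kappa uL eL uxL uwd t.

Lemma itg_flux t : itg (fl t).
Proof.
have AmL := L2_Aop b0 (mL t); have AnL := L2_Aop b0 (nL t).
have KmL := L2_Kop b0 (mL t); have KnL := L2_Kop b0 (nL t).
exact: (itgD (itgB (itgM (L2D (L2Z kappa (uL t)) AmL) (L2D (L2Z kappa (eL t)) AnL))
  (itgZ b (itgM KmL KnL))) (itgZ (b * kappa ^+ 2) (itgM (uxL t) (exL t)))).
Qed.

(* Speed 2 leaves room for the loss 4/3 of [Aop_weighted] and for the cubic terms. *)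
Lemma flux_bound (w w' : R -> R) (M l r t : R) :
  (forall x : R, is_derive x (1 : R) w (w' x)) -> continuous w' ->
  (forall x, 0 <= w x) -> (forall x, w x <= M) -> (forall x, `|w' x| <= l * w x) ->
  0 <= l -> l * Num.sqrt b <= 4^-1 -> 0 <= r -> 20 * r <= 1 - kappa ->
  {ae mu, forall x, `|u t x| <= r} -> {ae mu, forall x, `|eta t x| <= r} ->
  `|Itg (fun x => w x * fl t x)| <= 2 * Itg (fun x => w x * e t x).
Proof.
move=> dw cw' w0 wM w'w l0 lb r0 rk ur er.
have q0 : 0 <= (1 - kappa)^-1 by rewrite invr_ge0; lra.
have mw : measurable_fun setT w by apply: continuous_measurable; exact: is_derive_continuous.
have wM' x : `|w x| <= M by rewrite ger0_norm.
have iw X (iX : itg X) := itg_weight mw wM' iX.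
set m := source kappa u (prod_term u eta) t; set n := source kappa eta (square_term u) t.
have AmL := L2_Aop b0 (mL t); have AnL := L2_Aop b0 (nL t).
have KmL := L2_Kop b0 (mL t); have KnL := L2_Kop b0 (nL t).
pose a x := kappa * (u t x ^+ 2 + eta t x ^+ 2) + kappa * b * (ux t x ^+ 2 + etax t x ^+ 2).
have ia : itg a := itgD (itgZ kappa (itgD (iU t) (iE t))) (idx t).
pose gm x := Aop b m x ^+ 2 + b * Kop b m x ^+ 2.
pose gn x := Aop b n x ^+ 2 + b * Kop b n x ^+ 2.
have igm : itg gm := itgD (L2_sqr AmL) (itgZ b (L2_sqr KmL)).
have ign : itg gn := itgD (L2_sqr AnL) (itgZ b (L2_sqr KnL)).
pose q := (1 - kappa)^-1.
have h1 : `|Itg (fun x => w x * fl t x)| <=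
    Itg (fun x => w x * (2^-1 * (a x + q * (gm x + gn x)))).
  apply: (le_trans (le_norm_Itg (iw _ (itg_flux t)))).
  apply: le_Itg.
  - exact: itg_norm (iw _ (itg_flux t)).
  - exact: (iw _ (itgZ 2^-1 (itgD ia (itgZ q (itgD igm ign))))).
  move=> x; rewrite normrM (ger0_norm (w0 x)); apply: ler_wpM2l; first exact: w0.
  exact: flux_pointwise.
have E1 : Itg (fun x => w x * (2^-1 * (a x + q * (gm x + gn x)))) =
    2^-1 * (Itg (fun x => w x * a x) + q * (Itg (fun x => w x * gm x) + Itg (fun x => w x * gn x))).
  rewrite -(ItgD (iw _ igm) (iw _ ign)) -(ItgZ q (itgD (iw _ igm) (iw _ ign))).
  rewrite -(ItgD (iw _ ia) (itgZ q (itgD (iw _ igm) (iw _ ign)))).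
  rewrite -(ItgZ 2^-1 (itgD (iw _ ia) (itgZ q (itgD (iw _ igm) (iw _ ign))))).
  by apply: eq_Itg => x; move: (w x) (a x) (gm x) (gn x) => *; ring.
have hm := Aop_weighted b0 dw cw' w0 wM w'w l0 lb (mL t).
have hn := Aop_weighted b0 dw cw' w0 wM w'w l0 lb (nL t).
have im := L2_sqr (mL t); have inn := L2_sqr (nL t).
have E2 : Itg (fun x => w x * (a x + q * (4 / 3 * m x ^+ 2 + 4 / 3 * n x ^+ 2))) =
    Itg (fun x => w x * a x) + q * (4 / 3 * Itg (fun x => w x * m x ^+ 2) + 4 / 3 * Itg (fun x => w x * n x ^+ 2)).
  rewrite -(ItgZ (4 / 3) (iw _ im)) -(ItgZ (4 / 3) (iw _ inn)).
  have j1 := itgZ (4 / 3) (iw _ im); have j2 := itgZ (4 / 3) (iw _ inn).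
  rewrite -(ItgD j1 j2) -(ItgZ q (itgD j1 j2)) -(ItgD (iw _ ia) (itgZ q (itgD j1 j2))).
  by apply: eq_Itg => x; rewrite -/m -/n; move: (w x) (a x) (m x) (n x) => *; ring.
have h3 : Itg (fun x => w x * (a x + q * (4 / 3 * m x ^+ 2 + 4 / 3 * n x ^+ 2))) <=
    Itg (fun x => w x * (4 * e t x)).
  apply: le_Itg_ae.
  - exact: (iw _ (itgD ia (itgZ q (itgD (itgZ (4 / 3) im) (itgZ (4 / 3) inn))))).
  - exact: (iw _ (itgZ 4 (itg_density t))).
  apply: (ae_imp (ae_and ur er)) => x [h4 h5]; apply: ler_wpM2l; first exact: w0.
  by apply: (@density_pointwise R kappa b r _ _ (ux t x) (etax t x) (m x) (n x)).
have E3 : Itg (fun x => w x * (4 * e t x)) = 4 * Itg (fun x => w x * e t x).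
  by rewrite -(ItgZ 4 (iw _ (itg_density t))); apply: eq_Itg => x; rewrite mulrCA.
rewrite E1 in h1; rewrite E2 E3 in h3.
exact: (flux_combine q0 h1 hm hn h3).
Qed.

End energy_bounds.

(** * Tails of an integrable density *)

Section tails.
Context {R : realType}.
Local Notation mu := (@lebesgue_measure R).
Variable l : R.
Hypothesis l0 : 0 < l.

Lemma logistic_measurable (sg y : R) : measurable_fun setT (fun x : R => logistic l (sg * x - y)).
Proof.
apply: continuous_measurable => x; apply: (@continuous_comp R R R (fun x => sg * x - y) (logistic l)).
  by apply: cvgB; [apply: cvgM; [exact: cvg_cst|exact: cvg_id]|exact: cvg_cst].
exact: (is_derive_continuous (logistic_derive l)).
Qed.

Lemma itg_logistic (sg y : R) (f : R -> R) : itg f -> itg (fun x => logistic l (sg * x - y) * f x).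
Proof.
move=> iF; apply: (@itg_weight _ _ 1 (logistic_measurable sg y) _ _ iF) => x.
by rewrite gtr0_norm ?logistic_gt0// ltW// logistic_lt1.
Qed.

Lemma logistic_cvg0 (x : R) : logistic l (x - n%:R) @[n --> \oo] --> 0.
Proof.
apply/cvgr0Pnorm_le => e e0; near=> n.
have nx : x + l^-1 * e^-1 <= n%:R by near: n; exact: nbhs_infty_ger.
have le0 : 0 < l^-1 * e^-1 by rewrite mulr_gt0 ?invr_gt0.
rewrite gtr0_norm ?logistic_gt0//; apply: (le_trans (logistic_tail l0 _)).
  by rewrite subr_le0; apply: le_trans nx; rewrite lerDl ltW.
have h : e^-1 <= l * (n%:R - x) by rewrite -ler_pdivrMl// lerBrDl.
rewrite -[leRHS]invrK lef_pV2 ?posrE ?invr_gt0//; last first.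
  by rewrite ltr_pwDl// -mulrN opprB (le_trans _ h)// invr_ge0 ltW.
by rewrite -mulrN opprB (le_trans h)// lerDr.
Unshelve. all: by end_near. Qed.

(** Dominated convergence along integer shifts, extended to all larger y because the profile
    decreases in y. That comparison needs a nonnegative integrand, hence |f|. *)
Lemma logistic_tail_integral (sg : R) (f : R -> R) : itg f -> forall e : R, 0 < e ->
  exists Y, forall y, Y <= y -> Itg (fun x => logistic l (sg * x - y) * f x) <= e.
Proof.
move=> iF e e0; have inF := itg_norm iF.
pose T y := Itg (fun x => logistic l (sg * x - y) * `|f x|).
have Tn : T n%:R @[n --> \oo] --> 0.
  pose fn (n : nat) x : \bar R := (logistic l (sg * x - n%:R) * `|f x|)%:E.
  have : (\int[mu]_x (fn n x) @[n --> \oo] --> \int[mu]_x (cst 0 x))%E.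
    apply: (@dominated_cvg _ _ _ mu setT measurableT fn (cst 0%E) (fun x => (`|f x|)%:E)) => //.
    - by move=> n; apply/measurable_EFinP; exact: itg_measurable (itg_logistic _ _ inF).
    - move=> x _; apply: cvg_EFin; first by apply: nearW.
      rewrite -[X in _ --> X](mul0r `|f x|); apply: cvgM; last exact: cvg_cst.
      exact: logistic_cvg0.
    - move=> n x _; rewrite /fn abse_EFin lee_fin normrM normr_id ler_piMl//.
      by rewrite gtr0_norm ?logistic_gt0// ltW// logistic_lt1.
  rewrite integral0 => /fine_cvg; exact.
move/cvgr0Pnorm_le : Tn => /(_ e e0)[N _ HN].
exists N%:R => y Ny.
have := HN N (leqnn N) => /= h; apply: le_trans (le_trans (ler_norm _) h).
apply: le_Itg; [exact: itg_logistic|exact: itg_logistic|].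
move=> x; apply: (@le_trans _ _ (logistic l (sg * x - y) * `|f x|)).
  by rewrite ler_wpM2l ?ler_norm// ltW// logistic_gt0.
by rewrite ler_wpM2r// le_logistic// lerB.
Qed.

End tails.

(** * Small solutions: conservation, bootstrap and monotonicity *)

Section dynamics.
Context {R : realType}.
Local Notation mu := (@lebesgue_measure R).
Local Notation L2 := (@L2 R).
Local Notation wd := is_weak_derivative.
Variables (b kappa : R) (b0 : 0 < b) (k0 : 0 < kappa) (k1 : kappa < 1).
Variables u eta ux etax : R -> R -> R.
Hypotheses (uL : forall t, L2 (u t)) (eL : forall t, L2 (eta t)).
Hypotheses (uxL : forall t, L2 (ux t)) (exL : forall t, L2 (etax t)).
Hypotheses (uwd : forall t, wd (u t) (ux t)) (ewd : forall t, wd (eta t) (etax t)).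
Hypotheses (cu : forall t, contL2 u t) (ce : forall t, contL2 eta t).
Hypotheses (cux : forall t, contL2 ux t) (cex : forall t, contL2 etax t).
Hypothesis eq_eta : weak_equation b (- (kappa * b)) eta u (prod_term u eta).
Hypothesis eq_u : weak_equation b (- (kappa * b)) u eta (square_term u).

Let e := energy_density b kappa u eta ux etax.
Let fl := energy_flux b kappa u eta ux etax.
Let ie t := itg_density b kappa uL eL uxL exL uwd t.

Definition size2 t := nrm (u t) ^+ 2 + nrm (ux t) ^+ 2 + nrm (eta t) ^+ 2 + nrm (etax t) ^+ 2.

Lemma size2_ge0 t : 0 <= size2 t.
Proof. by rewrite !addr_ge0 ?sqr_ge0. Qed.

Lemma size2_continuous : continuous size2.
Proof.
move=> t; rewrite /size2.
have c f : (forall t, L2 (f t)) -> (forall t, contL2 f t) -> {for t, continuous (fun t => nrm (f t) ^+ 2)}.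
  move=> fL cf; rewrite (_ : (fun _ => _) = fun t => ip (f t) (f t)).
    exact: contL2_ip.
  by apply/funext => r; rewrite nrm_sqr.
by do 3 (apply: cvgD; last exact: c); exact: c.
Qed.

Let sup_arith (U Z p q : R) : 0 <= p -> 0 <= q -> U ^+ 2 <= 2 * (p * q) -> p ^+ 2 + q ^+ 2 <= Z ->
  `|U| <= Num.sqrt Z.
Proof.
move=> p0 q0 h hz; rewrite -sqrtr_sqr ler_wsqrtr//; have := sqr_ge0 (p - q); nra.
Qed.

Lemma u_small t : {ae mu, forall x, `|u t x| <= Num.sqrt (size2 t)}.
Proof.
apply: (ae_imp (wd_sup (uL t) (uxL t) (uwd t))) => x h.
apply: (sup_arith (nrm_ge0 _) (nrm_ge0 _) h).
by rewrite /size2 -addrA lerDl addr_ge0 ?sqr_ge0.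
Qed.

Lemma eta_small t : {ae mu, forall x, `|eta t x| <= Num.sqrt (size2 t)}.
Proof.
apply: (ae_imp (wd_sup (eL t) (exL t) (ewd t))) => x h.
apply: (sup_arith (nrm_ge0 _) (nrm_ge0 _) h).
by rewrite /size2 -addrA lerDr addr_ge0 ?sqr_ge0.
Qed.

(** The energy identity with the constant weight 1. *)
Lemma energy_const t : Itg (e t) = Itg (e 0).
Proof.
have D r : is_derive r (1 : R) (fun r => Itg (e r)) 0.
  have := @energy_derive R b kappa b0 u eta ux etax uL eL uxL exL uwd ewd cu ce cux cex eq_eta eq_u
    (fun=> 1) (fun=> 0) (fun=> 0) 1 0 r.
  move=> /(_ (fun x => is_derive_cst _ _ _) (fun x => is_derive_cst _ _ _)).
  rewrite normr1 normr0 => /(_ (fun=> lexx _) (fun=> ler01) (fun=> ler01)).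
  rewrite (_ : (fun r => Itg (fun x => 1 * _)) = fun r => Itg (e r)); last first.
    by apply/funext => q; apply: eq_Itg => x; rewrite mul1r.
  move=> d; apply: (is_derive_eq d).
  by rewrite -[RHS](@Itg0 R); apply: eq_Itg => x; rewrite mul0r.
have [z _] := @mvt_is_derive R (fun r => Itg (e r)) (fun=> 0) 0 t D.
by rewrite mulr0 => /eqP; rewrite subr_eq0 => /eqP.
Qed.

(** The difference is the cubic term, bounded by the sup of |eta| times |u|^2. *)
Lemma energy_size t : `|2 * Itg (e t) - (kappa * b * (nrm (ux t) ^+ 2 + nrm (etax t) ^+ 2) +
  nrm (u t) ^+ 2 + nrm (eta t) ^+ 2)| <= Num.sqrt (size2 t) * nrm (u t) ^+ 2.
Proof.
have iU := L2_sqr (uL t); have iE := L2_sqr (eL t).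
have iUx := L2_sqr (uxL t); have iEx := L2_sqr (exL t).
have iP : itg (fun x => u t x * (u t x * eta t x)) := itgM (uL t) (L2_prod uL eL uxL uwd t).
have j1 := itgZ (kappa * b) (itgD iUx iEx).
have -> : 2 * Itg (e t) - (kappa * b * (nrm (ux t) ^+ 2 + nrm (etax t) ^+ 2) +
  nrm (u t) ^+ 2 + nrm (eta t) ^+ 2) = Itg (fun x => u t x * (u t x * eta t x)).
  rewrite !nrm_sqrE -(ItgD iUx iEx) -(ItgZ (kappa * b) (itgD iUx iEx)) -(ItgD j1 iU).
  rewrite -(ItgD (itgD j1 iU) iE) -(ItgZ 2 (ie t)).
  rewrite -(ItgB (itgZ 2 (ie t)) (itgD (itgD j1 iU) iE)); apply: eq_Itg => x.
  rewrite /e /energy_density; move: (u t x) (eta t x) (ux t x) (etax t x) => *; by field.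
apply: (le_trans (le_norm_Itg iP)); rewrite nrm_sqrE -(ItgZ _ iU); apply: le_Itg_ae.
- exact: itg_norm.
- exact: itgZ.
apply: (ae_imp (eta_small t)) => x h; rewrite mulrA normrM mulrC -expr2 (ger0_norm (sqr_ge0 _)).
by rewrite ler_wpM2r// sqr_ge0.
Qed.

Let bootstrap_arith (kb a1 a2 a3 a4 E S Z : R) : 0 < kb -> 0 <= a1 -> 0 <= a2 -> 0 <= a3 -> 0 <= a4 ->
  0 <= S -> Z = a1 + a2 + a3 + a4 -> `|2 * E - (kb * (a2 + a4) + a1 + a3)| <= S * a1 ->
  (Num.min kb 1 - S) * Z <= 2 * E /\ 2 * E <= (kb + 1 + S) * Z.
Proof.
move=> kb0 h1 h2 h3 h4 S0 ->; rewrite ler_norml => /andP[g1 g2].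
have m1 : Num.min kb 1 <= kb by rewrite ge_min lexx.
have m2 : Num.min kb 1 <= 1 by rewrite ge_min lexx orbT.
move: (Num.min _ _) m1 m2 => c m1 m2.
have q1 : c * a1 <= a1 by nra.
have q2 : c * a2 <= kb * a2 by nra.
have q3 : c * a3 <= a3 by nra.
have q4 : c * a4 <= kb * a4 by nra.
have p2 := mulr_ge0 S0 h2; have p3 := mulr_ge0 S0 h3; have p4 := mulr_ge0 S0 h4.
have k1' := mulr_ge0 (ltW kb0) h1; have k3' := mulr_ge0 (ltW kb0) h3.
split; lra.
Qed.

Lemma energy_equiv t : (Num.min (kappa * b) 1 - Num.sqrt (size2 t)) * size2 t <= 2 * Itg (e t) /\
  2 * Itg (e t) <= (kappa * b + 1 + Num.sqrt (size2 t)) * size2 t.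
Proof.
apply: (bootstrap_arith (mulr_gt0 k0 b0) (sqr_ge0 _) (sqr_ge0 _) (sqr_ge0 _) (sqr_ge0 _)
  (sqrtr_ge0 _) (erefl _) (energy_size t)).
Qed.

(** At the crossing twice the energy is at least (c - r) r^2 >= r^3; at time 0 it is at most (k + 2)
    Z < r^3. *)
Let bootstrap_contra (E c S Z k r : R) : (c - r) * r ^+ 2 <= 2 * E -> 2 * E <= (k + 1 + S) * Z ->
  (k + 2) * Z < r * r ^+ 2 -> 2 * r <= c -> S <= 1 -> 0 <= Z -> 0 < r -> False.
Proof.
move=> h1 h2 z0 rc s1 s0 r0; have r2 : 0 < r ^+ 2 by rewrite exprn_gt0.
have p : (k + 1 + S) * Z <= (k + 2) * Z by apply: ler_wpM2r => //; lra.
have := le_lt_trans (le_trans (le_trans h1 h2) p) z0.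
by rewrite ltr_pM2r//; lra.
Qed.

(* A first crossing of [r ^+ 2] would contradict energy conservation. *)
Lemma size2_small r : 0 < r -> r <= 1 -> 2 * r <= Num.min (kappa * b) 1 ->
  (kappa * b + 2) * size2 0 < r * r ^+ 2 -> forall t, size2 t < r ^+ 2.
Proof.
move=> r0 r1 rc z0 t; rewrite ltNge; apply/negP => zt.
have kb0 : 0 < kappa * b by rewrite mulr_gt0.
have s0 := size2_ge0 0.
have z0r : size2 0 < r ^+ 2.
  by move: z0 s0 r0 r1 kb0; move: (kappa * b) (size2 0) => k z; nra.
have [z zE] : exists z, size2 z = r ^+ 2.
  have [t0|t0] := leP 0 t.
    have [|c _ cE] := @IVT R size2 0 t (r ^+ 2) t0 (continuous_subspaceT size2_continuous).
      by rewrite ge_min le_max (ltW z0r) zt orbT.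
    by exists c.
  have [|c _ cE] := @IVT R size2 t 0 (r ^+ 2) (ltW t0) (continuous_subspaceT size2_continuous).
    by rewrite ge_min le_max (ltW z0r) zt orbT.
  by exists c.
have [h1 _] := energy_equiv z; have [_ h2] := energy_equiv 0.
have sz : Num.sqrt (size2 z) = r by rewrite zE sqrtr_sqr gtr0_norm.
have s1 : Num.sqrt (size2 0) <= 1.
  by rewrite -(sqrtr1 R) ler_wsqrtr//; apply: (le_trans (ltW z0r)); rewrite expr_le1// ltW.
rewrite (energy_const z) sz zE in h1.
exact: (bootstrap_contra h1 h2 z0 rc s1 s0 r0).
Qed.

(* [sg] selects the side of the profile; its speed [2 * sg * Num.sg t] makes it recede
   from the origin as time runs from 0 to [t]. *)
Lemma energy_monotone (l r sg t y : R) : 0 < l -> l * Num.sqrt b <= 4^-1 ->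
  0 <= r -> 20 * r <= 1 - kappa -> (forall t, size2 t <= r ^+ 2) -> sg * sg = 1 ->
  Itg (fun x => logistic l (sg * x - 2 * `|t| - y) * e t x) <=
  Itg (fun x => logistic l (sg * x - y) * e 0 x).
Proof.
move=> l0 lb r0 rk small sg1.
(* A sign of t that equals 1 at t = 0, so that tau^2 = 1 always. *)
pose tau : R := if 0 <= t then 1 else -1.
have tt : tau * t = `|t|.
  rewrite /tau; case: (boolP (0 <= t)) => h; first by rewrite mul1r ger0_norm.
  by rewrite mulN1r ltr0_norm// ltNge.
have tau1 : tau * tau = 1 by rewrite /tau; case: ifP; rewrite ?mul1r ?mulrNN ?mulr1.
have n1 : `|tau * sg| = 1.
  have : (tau * sg) ^+ 2 = 1 by rewrite expr2 mulrACA tau1 sg1 mulr1.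
  by move/(congr1 Num.sqrt); rewrite sqrtr_sqr sqrtr1.
pose s := 2 * sg * tau.
have dA x : is_derive x (1 : R) (fun x : R => sg * x - y) sg.
  have d1 : is_derive x (1 : R) (fun x : R => sg * x - y) (sg * 1 - 0).
    by apply: is_deriveB; apply: is_deriveZ.
  by apply: (is_derive_eq d1); rewrite mulr1 subr0.
pose W x := logistic l (sg * x - y); pose W' x := sg * dlogistic l (sg * x - y).
pose W'' x := ddlogistic l (sg * x - y).
have nsg : `|sg| = 1.
  by have := congr1 Num.sqrt sg1; rewrite -expr2 sqrtr_sqr sqrtr1.
have d1 x : is_derive x (1 : R) W (W' x).
  have d := @is_derive1_comp R (logistic l) (fun x => sg * x - y) x _ _ (logistic_derive l _) (dA x).
  by apply: (is_derive_eq d); rewrite mulrC.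
have d2' x : is_derive x (1 : R) (fun x => dlogistic l (sg * x - y)) (sg * W'' x).
  have d := @is_derive1_comp R (dlogistic l) (fun x => sg * x - y) x _ _ (dlogistic_derive l _) (dA x).
  by apply: (is_derive_eq d); rewrite mulrC.
have d2 x : is_derive x (1 : R) W' (W'' x).
  have d := is_deriveZ sg (d2' x).
  by apply: (is_derive_eq d); rewrite /GRing.scale/= mulrA sg1 mul1r.
pose B := 1 + l + l * l.
have ll : 0 <= l * l by rewrite mulr_ge0// ltW.
have w0 x : `|W x| <= B.
  rewrite gtr0_norm ?logistic_gt0// /B -addrA ler_wpDr ?addr_ge0 ?(ltW l0)//.
  by rewrite ltW// logistic_lt1.
have dl x : `|dlogistic l x| <= l by rewrite ger0_norm ?dlogistic_ge0 ?dlogistic_le.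
have w1 x : `|W' x| <= B.
  by rewrite normrM nsg mul1r (le_trans (dl _))// /B addrAC lerDr addr_ge0.
have w2 x : `|W'' x| <= B.
  apply: (le_trans (ddlogistic_le l0 _)); rewrite /B.
  apply: (@le_trans _ _ (l * l)); first by rewrite ler_wpM2l ?(ltW l0)// dlogistic_le.
  by rewrite lerDr addr_ge0 ?(ltW l0).
pose F r := Itg (fun x => W (x - s * r) * e r x).
pose G r := Itg (fun x => W' (x - s * r) * (fl r x - s * e r x)).
have dF r' : is_derive r' (1 : R) F (G r').
  exact: (@energy_derive R b kappa b0 u eta ux etax uL eL uxL exL uwd ewd cu ce cux cex eq_eta eq_u
    W W' W'' B s r' d1 d2 w0 w1 w2).
(* The flux estimate is used with weight [rh], the derivative of the logistic profile. Its factor 2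
   is compensated exactly by the speed 2, and [tau] gives the sign for both directions of time. *)
have sG z : tau * G z <= 0.
  pose rh x := dlogistic l (sg * (x - s * z) - y).
  pose rh' x := sg * W'' (x - s * z).
  have dr x : is_derive x (1 : R) rh (rh' x).
    by have := @is_derive_translate R (fun x => dlogistic l (sg * x - y)) (fun x => sg * W'' x) (s * z) x d2'.
  have cW'' : continuous W''.
    move=> x; apply: (@continuous_comp R R R (fun x => sg * x - y) (ddlogistic l)).
      by apply: cvgB; [apply: cvgM; [exact: cvg_cst|exact: cvg_id]|exact: cvg_cst].
    rewrite /ddlogistic; apply: cvgM; first exact: cvg_cst.
    apply: cvgM; first exact: (is_derive_continuous (dlogistic_derive l)).
    apply: cvgB; first exact: cvg_cst.
    by apply: cvgM; [exact: cvg_cst|exact: (is_derive_continuous (logistic_derive l))].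
  have cr' : continuous rh'.
    move=> x; apply: cvgM; first exact: cvg_cst.
    apply: (@continuous_comp R R R (fun x => x - s * z) W''); last exact: cW''.
    by apply: cvgB; [exact: cvg_id|exact: cvg_cst].
  have rh0 x : 0 <= rh x := dlogistic_ge0 l0 _.
  have rhl x : rh x <= l := dlogistic_le l0 _.
  have r'r x : `|rh' x| <= l * rh x by rewrite normrM nsg mul1r ddlogistic_le.
  have us : {ae mu, forall x, `|u z x| <= r}.
    apply: (ae_imp (u_small z)) => x /le_trans; apply.
    by rewrite -(ger0_norm r0) -sqrtr_sqr ler_wsqrtr.
  have es : {ae mu, forall x, `|eta z x| <= r}.
    apply: (ae_imp (eta_small z)) => x /le_trans; apply.
    by rewrite -(ger0_norm r0) -sqrtr_sqr ler_wsqrtr.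
  have fb := flux_bound b0 k0 k1 uL eL uxL exL uwd dr cr' rh0 rhl r'r (ltW l0) lb r0 rk us es.
  have ifl := itg_flux kappa b0 uL eL uxL exL uwd z.
  have mr : measurable_fun setT rh by apply: continuous_measurable; exact: is_derive_continuous dr.
  have rn x : `|rh x| <= l by rewrite ger0_norm.
  have E : tau * G z = tau * sg * Itg (fun x => rh x * fl z x) - 2 * Itg (fun x => rh x * e z x).
    have i1 := itg_weight mr rn ifl; have i2 := itg_weight mr rn (ie z).
    have -> : G z = sg * Itg (fun x => rh x * fl z x) - sg * s * Itg (fun x => rh x * e z x).
      rewrite -(ItgZ sg i1) -(ItgZ (sg * s) i2) -(ItgB (itgZ sg i1) (itgZ (sg * s) i2)).
      apply: eq_Itg => x; rewrite -[W' _]/(sg * rh x) -/(fl z x) -/(e z x).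
      move: (rh x) (fl z x) (e z x) => *; ring.
    rewrite mulrBr mulrA; congr (_ - _); rewrite mulrA; congr (_ * _).
    rewrite /s; transitivity (2 * (sg * sg) * (tau * tau)); first by ring.
    by rewrite sg1 tau1 !mulr1.
  rewrite E subr_le0; apply: le_trans fb; apply: (le_trans (ler_norm _)).
  by rewrite normrM n1 mul1r.
have [z _ zE] := @mvt_is_derive R F G 0 t dF.
have Fle : F t <= F 0.
  rewrite -subr_le0 zE subr0 (_ : t = `|t| * tau); last by rewrite -tt mulrC mulrA tau1 mul1r.
  by rewrite -mulrA mulr_ge0_le0.
apply: le_trans (le_trans Fle _); rewrite le_eqVlt; apply/orP; left; apply/eqP; apply: eq_Itg => x.
  rewrite /W /s -tt; congr (logistic l _ * _).
  transitivity (sg * x - 2 * (sg * sg) * (tau * t) - y); first by rewrite sg1 mulr1.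
  by ring.
by rewrite /W mulr0 subr0.
Qed.

End dynamics.

(** * Decay and travelling waves *)

Section sobolev_functions.
Context {R : realType}.
Local Notation mu := (@lebesgue_measure R).
Local Notation L2 := (@L2 R).
Local Notation wd := is_weak_derivative.
Implicit Types f g U N : R -> R.

Lemma H1_L2 f : H1 f -> L2 f.
Proof. by case. Qed.

Lemma H1_wderiv f : H1 f -> L2 (wderiv f) /\ wd f (wderiv f).
Proof. by move=> [_ fg]; have := @xgetPex _ (cst 0) _ fg. Qed.

Lemma wderiv_L2 f : H1 f -> L2 (wderiv f).
Proof. by case/H1_wderiv. Qed.

Lemma wderiv_wd f : H1 f -> wd f (wderiv f).
Proof. by case/H1_wderiv. Qed.

Lemma H1B f g : H1 f -> H1 g -> H1 (f \- g).
Proof.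
move=> fH gH; have fL := H1_L2 fH; have gL := H1_L2 gH; split; first exact: L2B.
exists (fun x => wderiv f x - wderiv g x); split; first exact: L2B (wderiv_L2 fH) (wderiv_L2 gH).
exact: (wdB fL (wderiv_L2 fH) gL (wderiv_L2 gH) (wderiv_wd fH) (wderiv_wd gH)).
Qed.

Lemma H1norm_itg U N : H1 U -> H1 N ->
  itg (fun x => U x ^+ 2 + wderiv U x ^+ 2 + N x ^+ 2 + wderiv N x ^+ 2).
Proof.
move=> UH NH.
exact: (itgD (itgD (itgD (L2_sqr (H1_L2 UH)) (L2_sqr (wderiv_L2 UH))) (L2_sqr (H1_L2 NH)))
  (L2_sqr (wderiv_L2 NH))).
Qed.

Lemma H1norm_setT U N : H1 U -> H1 N -> H1norm setT U N ^+ 2 =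
  nrm U ^+ 2 + nrm (wderiv U) ^+ 2 + nrm N ^+ 2 + nrm (wderiv N) ^+ 2.
Proof.
move=> UH NH; rewrite sqr_sqrtr; last by apply: Itg_ge0 => x; rewrite !addr_ge0 ?sqr_ge0.
have h1 := L2_sqr (H1_L2 UH); have h2 := L2_sqr (wderiv_L2 UH).
have h3 := L2_sqr (H1_L2 NH); have h4 := L2_sqr (wderiv_L2 NH).
have E := ItgD (itgD (itgD h1 h2) h3) h4.
rewrite (ItgD (itgD h1 h2) h3) (ItgD h1 h2) in E.
by apply: (etrans E); congr (_ + _ + _ + _); exact/esym/nrm_sqrE.
Qed.

Let component_arith (a b c d h : R) : 0 <= h -> h ^+ 2 = a ^+ 2 + b ^+ 2 + c ^+ 2 + d ^+ 2 ->
  [/\ a <= h, b <= h, c <= h & d <= h].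
Proof.
move=> h0 E; have := sqr_ge0 a; have := sqr_ge0 b; have := sqr_ge0 c; have := sqr_ge0 d.
by move=> *; split; nra.
Qed.

Lemma H1norm_ge U N : H1 U -> H1 N ->
  [/\ nrm U <= H1norm setT U N, nrm (wderiv U) <= H1norm setT U N,
      nrm N <= H1norm setT U N & nrm (wderiv N) <= H1norm setT U N].
Proof.
by move=> UH NH; apply: component_arith; [exact: sqrtr_ge0|exact: H1norm_setT].
Qed.

(** [wderiv] chooses representatives, so it is additive only almost everywhere, by uniqueness of
    weak derivatives; norms do not see the difference. *)
Lemma nrm_wderivB f g : H1 f -> H1 g ->
  nrm (fun x => wderiv f x - wderiv g x) = nrm (wderiv (f \- g)).
Proof.
move=> fH gH; have fL := H1_L2 fH; have gL := H1_L2 gH; have dH := H1B fH gH.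
have dL := L2B (wderiv_L2 fH) (wderiv_L2 gH).
apply: nrm_ae => //; first exact: wderiv_L2.
apply: (wd_unique dL (wderiv_L2 dH) _ (wderiv_wd dH)).
exact: (wdB fL (wderiv_L2 fH) gL (wderiv_L2 gH) (wderiv_wd fH) (wderiv_wd gH)).
Qed.

Lemma continuous_in_H1_contL2 (u eta : R -> R -> R) : continuous_in_H1 u eta ->
  forall t, [/\ contL2 u t, contL2 eta t, contL2 (fun t => wderiv (u t)) t &
    contL2 (fun t => wderiv (eta t)) t].
Proof.
move=> [H cH] t.
have near_le (e : R) : 0 < e -> \forall h \near (0 : R),
    H1norm setT (u (t + h) \- u t) (eta (t + h) \- eta t) <= e.
  move=> e0; have /cvgr0Pnorm_le /(_ e e0) := cH t.
  move=> /nbhs_ballP[d /= d0 hd]; apply/nbhs_ballP; exists d => //= h.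
  rewrite /ball/= sub0r normrN => hh; apply: (le_trans (ler_norm _)).
  by apply: hd; rewrite /ball/= opprD addrA subrr sub0r normrN.
have ge h := H1norm_ge (H1B (H (t + h)).1 (H t).1) (H1B (H (t + h)).2 (H t).2).
split=> e e0; have := near_le e e0; apply: filterS => h; have [h1 h2 h3 h4] := ge h => he.
- exact: le_trans h1 he.
- exact: le_trans h3 he.
- by rewrite (nrm_wderivB (H (t + h)).1 (H t).1); exact: le_trans h2 he.
- by rewrite (nrm_wderivB (H (t + h)).2 (H t).2); exact: le_trans h4 he.
Qed.

End sobolev_functions.

(** * Decay in the exterior region *)

Section decay.
Context {R : realType}.
Local Notation mu := (@lebesgue_measure R).
Local Notation L2 := (@L2 R).
Local Notation wd := is_weak_derivative.
Variables (b kappa : R) (b0 : 0 < b) (k0 : 0 < kappa) (k1 : kappa < 1).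
Variables u eta : R -> R -> R.
Hypothesis cH : continuous_in_H1 u eta.
Hypothesis sol : abcd_solution (- (kappa * b)) b (- (kappa * b)) u eta.
Variables (r eps delta : R) (r0 : 0 < r) (r1 : r <= 1) (eps0 : 0 < eps) (delta0 : 0 < delta).
Hypothesis rk : 20 * r <= 1 - kappa.
Hypothesis rc : 2 * r <= Num.min (kappa * b) 1.
Hypothesis small : (kappa * b + 2) * H1norm setT (u 0) (eta 0) ^+ 2 < r * r ^+ 2.

Let uH t := (cH.1 t).1. Let eH t := (cH.1 t).2.
Let ux t := wderiv (u t). Let ex t := wderiv (eta t).
Let uL t := H1_L2 (uH t). Let eL t := H1_L2 (eH t).
Let uxL t := wderiv_L2 (uH t). Let exL t := wderiv_L2 (eH t).
Let uwd t := wderiv_wd (uH t). Let ewd t := wderiv_wd (eH t).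
Let cu t : contL2 u t. Proof. by case: (continuous_in_H1_contL2 cH t) => h _ _ _. Qed.
Let ce t : contL2 eta t. Proof. by case: (continuous_in_H1_contL2 cH t) => _ h _ _. Qed.
Let cux t : contL2 ux t. Proof. by case: (continuous_in_H1_contL2 cH t) => _ _ h _. Qed.
Let cex t : contL2 ex t. Proof. by case: (continuous_in_H1_contL2 cH t) => _ _ _ h. Qed.
Let eq_eta : weak_equation b (- (kappa * b)) eta u (prod_term u eta).
Proof. by move=> phi tp; case: (sol tp). Qed.
Let eq_u : weak_equation b (- (kappa * b)) u eta (square_term u).
Proof. by move=> phi tp; case: (sol tp). Qed.

Let e := energy_density b kappa u eta ux ex.
Let ie t : itg (e t) := itg_density b kappa uL eL uxL exL uwd t.

Let size_le t : size2 u eta ux ex t <= r ^+ 2.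
Proof.
apply: ltW; apply: (size2_small b0 k0 uL eL uxL exL uwd ewd cu ce cux cex eq_eta eq_u r0 r1 rc).
by move: small; rewrite (H1norm_setT (uH 0) (eH 0)).
Qed.

Let density t x := u t x ^+ 2 + ux t x ^+ 2 + eta t x ^+ 2 + ex t x ^+ 2.
Let id t : itg (density t) := H1norm_itg (uH t) (eH t).

Let c := Num.min (kappa * b) 1.
Let c0 : 0 < c. Proof. by rewrite lt_min ltr01 mulr_gt0. Qed.

Let coercive_arith (kb U E Ux Ex : R) : 0 < kb -> 2 * r <= Num.min kb 1 -> `|E| <= r ->
  Num.min kb 1 * (U ^+ 2 + Ux ^+ 2 + E ^+ 2 + Ex ^+ 2) <=
  4 * (2^-1 * (kb * (Ux ^+ 2 + Ex ^+ 2) + U ^+ 2 + E ^+ 2 + U ^+ 2 * E)).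
Proof.
move=> kb0 rm; rewrite ler_norml => /andP[E1 E2].
have m1 : Num.min kb 1 <= kb by rewrite ge_min lexx.
have m2 : Num.min kb 1 <= 1 by rewrite ge_min lexx orbT.
have m0 : 0 < Num.min kb 1 by rewrite lt_min kb0 ltr01.
move: (Num.min kb 1) rm m1 m2 m0 => m rm m1 m2 m0.
have U0 := sqr_ge0 U; have E0 := sqr_ge0 E; have Ux0 := sqr_ge0 Ux; have Ex0 := sqr_ge0 Ex.
have h1 : - (2^-1 * U ^+ 2) <= U ^+ 2 * E by nra.
have h2 : m * Ux ^+ 2 <= kb * Ux ^+ 2 by rewrite ler_wpM2r.
have h3 : m * Ex ^+ 2 <= kb * Ex ^+ 2 by rewrite ler_wpM2r.
have h4 : m * U ^+ 2 <= U ^+ 2 by rewrite ler_piMl.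
have h5 : m * E ^+ 2 <= E ^+ 2 by rewrite ler_piMl.
have h6 : 0 <= kb * Ux ^+ 2 by rewrite mulr_ge0// ltW.
have h7 : 0 <= kb * Ex ^+ 2 by rewrite mulr_ge0// ltW.
lra.
Qed.

(** Since |eta| <= r <= 1/2 almost everywhere, the cubic term costs at most half of u^2, so the
    comparison holds pointwise and survives any nonnegative weight. *)
Let coercive t : {ae mu, forall x, density t x <= 4 / c * e t x}.
Proof.
apply: (ae_imp (eta_small u ux eL exL ewd t)) => x ex_le.
have er : `|eta t x| <= r.
  by apply: (le_trans ex_le); rewrite -(ger0_norm (ltW r0)) -sqrtr_sqr ler_wsqrtr.
rewrite mulrAC ler_pdivlMr// mulrC.
exact: (coercive_arith (u t x) (ux t x) (ex t x) (mulr_gt0 k0 b0) rc er).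
Qed.

(** The steepest profile that [Aop_weighted] admits: l sqrt b = 1/4. *)
Let l := (4 * Num.sqrt b)^-1.
Let l0 : 0 < l. Proof. by rewrite invr_gt0 mulr_gt0// sqrtr_gt0. Qed.
Let lb : l * Num.sqrt b <= 4^-1.
Proof.
have s0 : 0 < Num.sqrt b by rewrite sqrtr_gt0.
by rewrite /l invfM -mulrA mulVf ?mulr1// gt_eqF.
Qed.

(** Each profile is centred at an edge of the region, so it is at least 1/2 on the half-line beyond
    that edge. *)
Let region_le t x : \1_(exterior_region eps delta t) x <=
  2 * logistic l (1 * x - 2 * `|t| - delta * `|t|) +
  2 * logistic l (-1 * x - 2 * `|t| - eps * `|t|).
Proof.
have g1 := logistic_gt0 l (1 * x - 2 * `|t| - delta * `|t|).
have g2 := logistic_gt0 l (-1 * x - 2 * `|t| - eps * `|t|).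
rewrite indicE; have [|] := boolP (x \in _); last by move=> _ /=; lra.
rewrite inE => -[]; rewrite /= in_itv/= ?andbT => h.
  have := @logistic_ge_half R l l0 (-1 * x - 2 * `|t| - eps * `|t|).
  by move=> /(_ ltac:(lra)); lra.
have := @logistic_ge_half R l l0 (1 * x - 2 * `|t| - delta * `|t|).
by move=> /(_ ltac:(lra)); lra.
Qed.

(** The constant 8 / c is the 2 of [region_le] times the 4 / c of [coercive]; the two weighted
    energies are then carried back to time 0 by [energy_monotone]. *)
Let region_energy t : H1norm (exterior_region eps delta t) (u t) (eta t) ^+ 2 <=
  8 / c * (Itg (fun x => logistic l (1 * x - delta * `|t|) * e 0 x) +
           Itg (fun x => logistic l (-1 * x - eps * `|t|) * e 0 x)).
Proof.
have m1 := energy_monotone b0 k0 k1 uL eL uxL exL uwd ewd cu ce cux cex eq_eta eq_u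
  t (delta * `|t|) l0 lb (ltW r0) rk size_le (mulr1 (1 : R)).
have mm : (-1 : R) * -1 = 1 by rewrite mulrNN mulr1.
have m2 := energy_monotone b0 k0 k1 uL eL uxL exL uwd ewd cu ce cux cex eq_eta eq_u
  t (eps * `|t|) l0 lb (ltW r0) rk size_le mm.
have c8 : 0 <= 8 / c by rewrite divr_ge0// ltW.
apply: le_trans (ler_wpM2l c8 (lerD m1 m2)); clear m1 m2.
rewrite sqr_sqrtr; last first.
  rewrite Itg_set; apply: Itg_ge0 => x; rewrite mulr_ge0//.
  by rewrite !addr_ge0 ?sqr_ge0.
rewrite Itg_set.
pose w1 x := logistic l (1 * x - 2 * `|t| - delta * `|t|).
pose w2 x := logistic l (-1 * x - 2 * `|t| - eps * `|t|).
have i1 : itg (fun x => w1 x * e t x).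
  have := itg_logistic l 1 (2 * `|t| + delta * `|t|) (ie t).
  by apply: eq_itg => x; rewrite /w1 opprD addrA.
have i2 : itg (fun x => w2 x * e t x).
  have := itg_logistic l (-1) (2 * `|t| + eps * `|t|) (ie t).
  by apply: eq_itg => x; rewrite /w2 opprD addrA.
have j1 : itg (fun x => \1_(exterior_region eps delta t) x * density t x).
  apply: (@itg_weight _ _ 1 _ _ _ (id t)).
    apply: measurable_indic; apply: measurableU; exact: measurable_itv.
  by move=> x; rewrite indicE; case: (_ \in _); rewrite ?normr1 ?normr0.
rewrite -(ItgD i1 i2) -(ItgZ (8 / c) (itgD i1 i2)).
apply: le_Itg_ae => //; first exact: itgZ (itgD i1 i2).
apply: (ae_imp (coercive t)) => x h.
have d0 : 0 <= density t x by rewrite !addr_ge0 ?sqr_ge0.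
apply: (le_trans (ler_wpM2r d0 (region_le t x))).
have w0 : 0 <= 2 * w1 x + 2 * w2 x by rewrite addr_ge0 ?mulr_ge0// ltW// logistic_gt0.
apply: (le_trans (ler_wpM2l w0 h)); rewrite le_eqVlt; apply/orP; left; apply/eqP.
move: (w1 x) (w2 x) (e t x) c^-1 => p q s k; ring.
Qed.

Lemma exterior_decay (x : R) : 0 < x -> exists T, forall t, T <= `|t| ->
  H1norm (exterior_region eps delta t) (u t) (eta t) <= x.
Proof.
(* Two tails of this size, multiplied by 8 / c, add up to x^2. *)
move=> x0; have y0 : 0 < c / 16 * x ^+ 2 by rewrite mulr_gt0 ?exprn_gt0// divr_gt0.
have [Y1 HY1] := logistic_tail_integral l0 1 (ie 0) y0.
have [Y2 HY2] := logistic_tail_integral l0 (-1) (ie 0) y0.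
exists (Num.max (Y1 / delta) (Y2 / eps)) => t; rewrite ge_max => /andP[t1 t2].
rewrite -ler_sqr ?nnegrE ?sqrtr_ge0 ?(ltW x0)//.
apply: (le_trans (region_energy t)).
have h1 := HY1 (delta * `|t|); have h2 := HY2 (eps * `|t|).
have {}t1 : Y1 <= delta * `|t| by rewrite mulrC -ler_pdivrMr.
have {}t2 : Y2 <= eps * `|t| by rewrite mulrC -ler_pdivrMr.
have c8 : 0 <= 8 / c by rewrite divr_ge0// ltW.
apply: (le_trans (ler_wpM2l c8 (lerD (h1 t1) (h2 t2)))).
rewrite le_eqVlt; apply/orP; left; apply/eqP; field; rewrite gt_eqF//.
Qed.

End decay.

(** * Absence of fast travelling waves *)

Section travelling_waves.
Context {R : realType}.
Local Notation mu := (@lebesgue_measure R).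
Local Notation L2 := (@L2 R).
Local Notation wd := is_weak_derivative.
Variables (b kappa : R) (b0 : 0 < b) (k0 : 0 < kappa) (k1 : kappa < 1).
Implicit Types f g q F : R -> R.

Lemma Rho_orthogonal F : L2 F -> (forall chi, test_function chi -> ip F (Rho b chi) = 0) ->
  {ae mu, forall x, F x = 0}.
Proof.
move=> FL F0; apply: nrm0_ae => //.
have AL := L2_Aop b0 FL.
have rL n := L2_Rho b (moll_test n AL).
have H := cvgL2_ip (fun=> FL) rL FL FL (cvgL2_cst F) (Rho_cvg b0 FL).
rewrite (_ : (fun n => ip F (Rho b (moll n (Aop b F)))) = fun=> 0) in H; last first.
  by apply/funext => n; apply: F0; exact: moll_test.
have /eqP : ip F F = 0 by rewrite -(cvg_lim _ H)//; apply: cvg_lim => //; exact: cvg_cst.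
by rewrite -nrm_sqr sqrf_eq0 => /eqP.
Qed.

Lemma Kop_shift f c x : Kop b (fun y => f (y - c)) (x + c) = Kop b f x.
Proof.
by rewrite /Kop /avg; congr (_ * (_ - _)); apply: eq_Itg => z; congr (_ * f _); ring.
Qed.

(** In the frame of the wave every pairing is constant in time, so om f' - kappa g' - K m is
    orthogonal to all [Rho b chi] and vanishes. It is the weak derivative of the stated expression,
    which lies in L^2 and is therefore 0. *)
Lemma travelling_equation f g q f' g' om : L2 f -> L2 g -> L2 q -> L2 f' -> L2 g' ->
  wd f f' -> wd g g' ->
  weak_equation b (- (kappa * b)) (travelling om f) (travelling om g) (travelling om q) ->
  {ae mu, forall x, om * f x - kappa * g x - Aop b (fun x => (1 - kappa) * g x + q x) x = 0}.
Proof.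
move=> fL gL qL f'L g'L ff' gg' H.
pose m x := (1 - kappa) * g x + q x.
have mL : L2 m by apply: L2D => //; exact: L2Z.
have AL := L2_Aop b0 mL; have KL := L2_Kop b0 mL.
pose F x := om * f' x - kappa * g' x - Kop b m x.
have FL : L2 F by apply: L2B => //; apply: L2B; exact: L2Z.
have TL h (hL : L2 h) t : L2 (travelling om h t) := L2_shift (- (om * t)) hL.
have Twd h h' (hL : L2 h) (h'L : L2 h') (hh' : wd h h') t : wd (travelling om h t) (travelling om h' t).
  exact: (wd_shift (- (om * t)) hL h'L hh').
have F0 : {ae mu, forall x, F x = 0}.
  apply: Rho_orthogonal => // chi tc.
  have W theta (tt : test_function theta) := weak_pairing b0 (TL f fL) (TL g gL) (TL q qL)
    (TL f' f'L) (TL g' g'L) (Twd f f' fL f'L ff') (Twd g g' gL g'L gg') om H tt tc.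
  have E t : ip (fun x => travelling om f t (x + om * t)) (Rho b chi) = ip f (Rho b chi).
    by congr ip; apply/funext => x; rewrite /travelling addrK.
  have E' t : ip (fun x => rhs b kappa om (travelling om f') (travelling om g')
      (travelling om g) (travelling om q) t (x + om * t)) (Rho b chi) = ip F (Rho b chi).
    have K x : Kop b (source kappa (travelling om g) (travelling om q) t) (x + om * t) = Kop b m x.
      exact: (Kop_shift m (om * t) x).
    have T h x : travelling om h t (x + om * t) = h x by rewrite /travelling addrK.
    have -> // : (fun x => rhs b kappa om (travelling om f') (travelling om g')
      (travelling om g) (travelling om q) t (x + om * t)) = F.
    apply/funext => x; rewrite -[LHS]/(om * travelling om f' t (x + om * t) -
      kappa * travelling om g' t (x + om * t) - Kop b (source kappa (travelling om g) (travelling om q) t) (x + om * t)).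
    by rewrite (T f' x) (T g' x) (K x).
  have D : is_derive (0 : R) (1 : R) (fun=> ip f (Rho b chi)) (ip F (Rho b chi)).
    apply: (weak_derivative_is_derive (G := fun=> ip f (Rho b chi)) (B := fun=> ip F (Rho b chi))).
    - exact: cont_cst.
    - exact: cont_cst.
    - by move=> theta tt; rewrite -(W theta tt); apply: eq_Itg => t; rewrite E E'.
  have [_ <-] := D; exact: derive_cst.
have fgL := L2B (L2Z om fL) (L2Z kappa gL); have f'g'L := L2B (L2Z om f'L) (L2Z kappa g'L).
have Hwd : wd (fun x => om * f x - kappa * g x - Aop b m x) F.
  apply: (wdB fgL f'g'L AL KL _ (Aop_wd b0 mL)).
  exact: (wdB (L2Z om fL) (L2Z om f'L) (L2Z kappa gL) (L2Z kappa g'L) (wdZ om fL f'L ff')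
    (wdZ kappa gL g'L gg')).
apply: wd0; first exact: L2B.
apply/wdP => phi tp; rewrite ((wdP _ _).1 Hwd _ tp); congr (- _).
exact: (ip_ae FL (@L2_0 R) (test_L2 tp) F0).
Qed.

Let sum_arith (x A M g q : R) : x <= kappa * g + A -> A <= M -> M <= (1 - kappa) * g + q ->
  x <= g + q.
Proof. lra. Qed.

(** Contractivity of [A] lets the coefficients kappa and 1 - kappa of |g| add up to 1. *)
Lemma travelling_bound f g q om : L2 f -> L2 g -> L2 q ->
  {ae mu, forall x, om * f x - kappa * g x - Aop b (fun x => (1 - kappa) * g x + q x) x = 0} ->
  `|om| * nrm f <= nrm g + nrm q.
Proof.
move=> fL gL qL H; pose m x := (1 - kappa) * g x + q x.
have gL' := L2Z (1 - kappa) gL.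
have mL : L2 m by exact: L2D.
have AL := L2_Aop b0 mL.
rewrite -(nrmZ om fL).
have -> : nrm (fun x => om * f x) = nrm (fun x => kappa * g x + Aop b m x).
  apply: nrm_ae; [exact: L2Z|by apply: L2D => //; exact: L2Z|].
  by apply: (ae_imp H) => x /eqP; rewrite -addrA -opprD subr_eq0 => /eqP.
have q0 : 0 <= 1 - kappa by rewrite subr_ge0 ltW.
have h1 := nrmD (L2Z kappa gL) AL; rewrite (nrmZ kappa gL) (gtr0_norm k0) in h1.
have h2 := nrmD gL' qL; rewrite (nrmZ (1 - kappa) gL) (ger0_norm q0) in h2.
exact: (sum_arith h1 (Aop_nrm b0 mL) h2).
Qed.

(** The inequalities give N <= (7/8) U and (13/8) U <= N, so both vanish. *)
Let wave_arith (o U N Q1 Q2 : R) : 2 < o -> 0 <= U -> 0 <= N -> o * N <= U + Q1 ->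
  o * U <= N + Q2 -> Q1 <= 3 / 4 * U -> Q2 <= 3 / 8 * U -> U = 0 /\ N = 0.
Proof.
move=> o2 U0 N0 h1 h2 h3 h4.
have p1 : 2 * N <= o * N by rewrite ler_wpM2r// ltW.
have p2 : 2 * U <= o * U by rewrite ler_wpM2r// ltW.
by split; apply/eqP; rewrite eq_le; apply/andP; split; lra.
Qed.

Let sup_arith (p x : R) : x <= 2 * p -> p <= 2^-1 * 2^-1 -> x <= (3 / 4) ^+ 2.
Proof. by move=> h1 h2; rewrite expr2; lra. Qed.

Let half_arith (x U : R) : x <= 3 / 4 * U -> 2^-1 * x <= 3 / 8 * U.
Proof. lra. Qed.

Lemma no_fast_waves om (U N : R -> R) : H1 U -> H1 N -> 2 < `|om| -> H1norm setT U N <= 2^-1 ->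
  abcd_solution (- (kappa * b)) b (- (kappa * b)) (travelling om U) (travelling om N) ->
  {ae mu, forall x, U x = 0 /\ N x = 0}.
Proof.
move=> UH NH om2 sm sol.
have UL := H1_L2 UH; have NL := H1_L2 NH; have UxL := wderiv_L2 UH; have NxL := wderiv_L2 NH.
have Uwd := wderiv_wd UH; have Nwd := wderiv_wd NH.
have [s1 s2 s3 s4] := H1norm_ge UH NH.
(* A norm of at most 1/2 gives f^2 <= 2 (1/2) (1/2) = 1/2, which is below (3/4)^2. *)
have sup f : H1 f -> nrm f <= H1norm setT U N -> nrm (wderiv f) <= H1norm setT U N ->
    {ae mu, forall x, `|f x| <= 3 / 4}.
  move=> fH h1 h2; apply: (ae_imp (wd_sup (H1_L2 fH) (wderiv_L2 fH) (wderiv_wd fH))) => x hx.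
  have h : nrm f * nrm (wderiv f) <= 2^-1 * 2^-1.
    by apply: ler_pM; rewrite ?nrm_ge0//; exact: le_trans sm.
  rewrite -ler_sqr ?nnegrE ?divr_ge0// real_normK ?num_real//.
  exact: (sup_arith hx h).
have Us := sup U UH s1 s2; have Ns := sup N NH s3 s4.
pose q1 x := U x * N x; pose q2 x := 2^-1 * U x ^+ 2.
have q1L : L2 q1 := L2M_ae (L2_measurable UL) Us NL.
have UUL := L2M_ae (L2_measurable UL) Us UL.
have q2L : L2 q2 by have := L2Z 2^-1 UUL; apply: eq_L2 => x; rewrite -expr2.
have e1 : weak_equation b (- (kappa * b)) (travelling om N) (travelling om U) (travelling om q1).
  by move=> phi tp; case: (sol phi tp) => h _; exact: h.
have e2 : weak_equation b (- (kappa * b)) (travelling om U) (travelling om N) (travelling om q2).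
  by move=> phi tp; case: (sol phi tp) => _ h; exact: h.
have n1 : nrm q1 <= 3 / 4 * nrm U.
  have := nrmM (L2_measurable NL) Ns UL; rewrite ger0_norm ?divr_ge0//.
  by rewrite (_ : (fun x => N x * U x) = q1)//; apply/funext => x; rewrite mulrC.
have n2 : nrm q2 <= 3 / 8 * nrm U.
  have := nrmM (L2_measurable UL) Us UL; rewrite ger0_norm ?divr_ge0// => h.
  rewrite (_ : q2 = fun x => 2^-1 * (U x * U x)); last by apply/funext => x; rewrite -expr2.
  rewrite (nrmZ 2^-1 UUL) ger0_norm ?invr_ge0//.
  exact: half_arith.
have a1 := travelling_bound NL UL q1L (travelling_equation NL UL q1L NxL UxL Nwd Uwd e1).
have a2 := travelling_bound UL NL q2L (travelling_equation UL NL q2L UxL NxL Uwd Nwd e2).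
have [U0 N0] := wave_arith om2 (nrm_ge0 U) (nrm_ge0 N) a1 a2 n1 n2.
have aU := nrm0_ae UL U0; have aN := nrm0_ae NL N0.
exact: ae_and.
Qed.

End travelling_waves.

Theorem corollary2p1 (R : realType) (a b c : R)
    (hb : 6^-1 < b) (ha : a = 6^-1 - b) (hc : c = 6^-1 - b) :
  (forall eps delta : R, 0 < eps -> 0 < delta ->
    exists2 eps0 : R, 0 < eps0 &
      forall u eta : R -> R -> R,
        continuous_in_H1 u eta ->
        abcd_solution a b c u eta ->
        H1norm setT (u 0) (eta 0) < eps0 ->
        (H1norm (exterior_region eps delta t) (u t) (eta t)
           @[t --> +oo] --> 0) /\
        (H1norm (exterior_region eps delta t) (u t) (eta t)
           @[t --> -oo] --> 0)) /\
  (forall s : R, 2 < s ->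
    exists2 eps0 : R, 0 < eps0 &
      forall (omega : R) (U N : R -> R),
        H1 U -> H1 N ->
        s <= `|omega| ->
        H1norm setT U N < eps0 ->
        abcd_solution a b c (travelling omega U) (travelling omega N) ->
        {ae lebesgue_measure, forall x, U x = 0 /\ N x = 0}).
Proof.
have b0 : 0 < b by apply: lt_trans hb; rewrite invr_gt0.
(* The solution of 1/6 - b = - kappa b; b > 1/6 places it in ]0, 1[. *)
pose kappa := (b - 6^-1) / b.
have kb : kappa * b = b - 6^-1 by rewrite /kappa mulfVK// gt_eqF.
have k0 : 0 < kappa by rewrite divr_gt0// subr_gt0.
have k1 : kappa < 1 by rewrite ltr_pdivrMr// mul1r gtrBl invr_gt0.
have -> : a = - (kappa * b) by rewrite kb opprB.
have -> : c = - (kappa * b) by rewrite kb opprB.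
have kb0 : 0 < kappa * b by rewrite mulr_gt0.
split=> [eps delta eps0 delta0|s s2]; last first.
  (* One threshold serves all speeds above 2. *)
  exists 2^-1; first by rewrite invr_gt0.
  move=> om U N UH NH so sm; apply: (no_fast_waves b0 k0 k1 UH NH _ (ltW sm)).
  exact: lt_le_trans so.
have m0 : 0 < Num.min (kappa * b) 1 by rewrite lt_min kb0 ltr01.
(* The first bound keeps the energy coercive, the second is the smallness required by the flux
   estimate. *)
pose r := Num.min (Num.min (kappa * b) 1 / 2) ((1 - kappa) / 20).
have r0 : 0 < r by rewrite lt_min !divr_gt0// subr_gt0.
have rc : 2 * r <= Num.min (kappa * b) 1.
  by rewrite mulrC -ler_pdivlMr// ge_min lexx.
have r1 : r <= 1.
  have : Num.min (kappa * b) 1 <= 1 by rewrite ge_min lexx orbT.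
  by move: rc r0; move: (Num.min (kappa * b) 1) => m *; lra.
have rk : 20 * r <= 1 - kappa by rewrite mulrC -ler_pdivlMr// ge_min lexx orbT.
have kb2 : 0 < kappa * b + 2 by rewrite addr_gt0.
have r3 : 0 < r * r ^+ 2 by rewrite mulr_gt0// exprn_gt0.
(* Chosen so that (kappa b + 2) e0^2 = r^3, the threshold of [size2_small]. *)
pose e0 := Num.sqrt (r * r ^+ 2 / (kappa * b + 2)).
exists e0; first by rewrite sqrtr_gt0 divr_gt0.
move=> u eta cH sol sm.
have small : (kappa * b + 2) * H1norm setT (u 0) (eta 0) ^+ 2 < r * r ^+ 2.
  rewrite mulrC -ltr_pdivlMr// -[ltRHS]sqr_sqrtr; last by rewrite divr_ge0// ltW.
  by rewrite ltr_sqr ?nnegrE ?sqrtr_ge0.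
have H := exterior_decay b0 k0 k1 cH sol r0 r1 eps0 delta0 rk rc small.
split; apply/cvgr0Pnorm_le => x /H[T HT].
- near=> t; rewrite ger0_norm ?sqrtr_ge0//; apply: HT.
  apply: le_trans (ler_norm t); near: t; by apply: nbhs_pinfty_ge; exact: num_real.
- near=> t; rewrite ger0_norm ?sqrtr_ge0//; apply: HT.
  rewrite -normrN; apply: le_trans (ler_norm (- t)); rewrite lerNr.
  near: t; by apply: nbhs_ninfty_le; exact: num_real.
Unshelve. all: by end_near. Qed.
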